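(* Let $G/H$ be a compact homogeneous space. If $G=G_1\times\cdots\times G_p$ and $H=H_1\times\cdots\times H_p$, $p\ge 2$, with $H_i\subsetneq G_i$ and $\dim N_{G_i}(H_i)=\dim H_i$ for each $i=1,\dots,p$, then there is a homotopy equivalence $$\Delta_{G/H}\ \approx\ \Delta_{G_1/H_1}*\cdots*\Delta_{G_p/H_p}*S^{p-2}.$$
   Context: All Lie groups $G,H,G_i,H_i$ are compact and connected, $H_i\subset G_i$. For a compact homogeneous space $G/H$ with $\dim N_G(H)=\dim H$ there are only finitely many subalgebras $\mathfrak k$ with $\mathfrak h\subsetneq\mathfrak k\subsetneq\mathfrak g$ (where $\mathfrak h,\mathfrak g$ are the Lie algebras of $H,G$), and $\Delta_{G/H}$ denotes the flag complex of the set of these subalgebras ordered by inclusion: its $(r-1)$-simplices are the chains $\mathfrak k_1\subsetneq\cdots\subsetneq\mathfrak k_r$. It may be empty. (Under the hypotheses, $\dim N_G(H)=\dim H$ holds for the product as well.) $*$ denotes the join of (realizations of) finite simplicial complexes, $|\Delta_1*\Delta_2|=\{((1-\lambda)x_1,\lambda x_2,\lambda): 0\le\lambda\le1,\ x_i\in|\Delta_i|\}$, with the convention $\emptyset*\Delta=\Delta$. $S^{p-2}$ is the $(p-2)$-sphere, $S^0$ being two points. *)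

(* Defs.v *)
From HB Require Import structures.
From mathcomp Require Import all_boot all_order all_algebra finmap.
From mathcomp Require Import all_classical all_reals all_analysis.

Set Implicit Arguments.
Unset Strict Implicit.
Unset Printing Implicit Defensive.

Import Order.TTheory GRing.Theory Num.Theory.
Import numFieldNormedType.Exports.

Local Open Scope classical_set_scope.
Local Open Scope ring_scope.

(** * Lie groups *)

(* [Ck k U f]: all iterated directional derivatives of [f] of order at most [k]
   exist and are continuous on the open set [U].  It is only used for
   finite-dimensional [V], where it is the usual notion of a C^k map. *)
Fixpoint Ck (R : realType) (V W : normedModType R) (k : nat) (U : set V)
    (f : V -> W) : Prop :=
  {in U, continuous f} /\
  if k is k'.+1 then
    forall v : V, {in U, forall x, derivable f x v} /\
                  Ck k' U (fun x => 'D_v f x)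
  else True.

Definition smooth (R : realType) (V W : normedModType R) (U : set V)
    (f : V -> W) : Prop :=
  forall k, Ck k U f.

(* A homeomorphism between open sets; the values of [chart_map] outside
   [chart_dom] and of [chart_inv] outside [chart_codom] are irrelevant. *)
Record chart (R : realType) (T : topologicalType) (n : nat) := Chart {
  chart_map :> T -> 'rV[R]_n;
  chart_inv : 'rV[R]_n -> T;
  chart_dom : set T;
  chart_dom_open : open chart_dom;
  chart_codom_open : open (chart_map @` chart_dom);
  chart_mapK : {in chart_dom, cancel chart_map chart_inv};
  chart_map_continuous : {in chart_dom, continuous chart_map};
  chart_inv_continuous : {in chart_map @` chart_dom, continuous chart_inv}
}.

Definition chart_codom (R : realType) (T : topologicalType) (n : nat)
    (c : chart R T n) : set 'rV[R]_n :=
  c @` chart_dom c.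

HB.mixin Record isLieGroup (R : realType) G
    of Group G & Topological G := {
  lie_dim : nat;
  atlas : set (chart R G lie_dim);
  chart_at : G -> chart R G lie_dim;
  chart_at_atlas : forall x, atlas (chart_at x);
  chart_at_dom : forall x, chart_dom (chart_at x) x;
  atlas_smooth : forall c d, atlas c -> atlas d ->
    smooth (c @` (chart_dom c `&` chart_dom d)) (d \o chart_inv c);
  lie_hausdorff : hausdorff_space G;
  lie_second_countable : @second_countable G;
  lie_mul_continuous : continuous (fun p : G * G => (p.1 * p.2)%g);
  lie_inv_continuous : continuous (fun x : G => (x^-1)%g);
  lie_mul_smooth : forall c d e, atlas c -> atlas d -> atlas e ->
    smooth [set u | [/\ chart_codom c u.1, chart_codom d u.2 &
                        chart_dom e (chart_inv c u.1 * chart_inv d u.2)%g]]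
           (fun u => e (chart_inv c u.1 * chart_inv d u.2)%g);
  lie_inv_smooth : forall c d, atlas c -> atlas d ->
    smooth [set u | chart_codom c u /\ chart_dom d (chart_inv c u)^-1%g]
           (fun u => d (chart_inv c u)^-1%g)
}.

#[short(type="lieGroupType")]
HB.structure Definition LieGroup (R : realType) :=
  {G of isLieGroup R G & Group G & Topological G}.

Section LieAlgebra.
Variables (R : realType) (G : lieGroupType R).

Local Notation n := (@lie_dim R G).

(* The tangent space of [G] at 1 is identified with R^n through this chart. *)
Definition chart1 : chart R G n := chart_at (1%g : G).

(* [X, Y] = (d Ad)_1 (X) (Y), where Ad x is the differential at 1 of
   y |-> x y x^-1. *)
Definition lie_bracket (X Y : 'rV[R]_n) : 'rV[R]_n :=
  'D_X (fun u : 'rV[R]_n => 'D_Y (fun v : 'rV[R]_n =>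
     chart1 (chart_inv chart1 u * chart_inv chart1 v
             * (chart_inv chart1 u)^-1)%g : 'rV[R]_n)
     (chart1 1%g)) (chart1 1%g).

(* The tangent space at 1 of a closed subgroup [K], as the set of velocities of
   the smooth curves in [K] through 1. *)
Definition lie_algebra (K : set G) : set 'rV[R]_n :=
  [set X | exists c : R^o -> G, c 0 = 1%g /\
     exists e : R, [/\ 0 < e,
       forall t, `|t| < e -> K (c t) /\ chart_dom chart1 (c t),
       smooth [set t : R^o | `|t| < e] (chart1 \o c) &
       'D_1 (chart1 \o c) 0 = X]].

Definition lie_subalgebra (k : {vspace 'rV[R]_n}) : Prop :=
  forall X Y, X \in k -> Y \in k -> lie_bracket X Y \in k.

(* Maximal number of linearly independent tangent vectors, that is, the
   dimension of the linear subspace [lie_algebra K]. *)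
Definition subgroup_dim (K : set G) : nat :=
  \max_(k < n.+1 | `[< exists s : k.-tuple 'rV[R]_n,
      free s /\ {in s, forall X, lie_algebra K X} >]) k.

Definition compact_connected_subgroup (K : set G) : Prop :=
  [/\ K 1%g, forall x y, K x -> K y -> K (x * y^-1)%g, compact K & connected K].

Definition normalizer (K H : set G) : set G :=
  [set x | K x /\ [set (h ^ x)%g | h in H] = H].

(* [G] is the internal direct product of its subgroups [K i]. *)
Definition direct_product (p : nat) (K : 'I_p -> set G) : Prop :=
  (forall i j x y, i != j -> K i x -> K j y -> commute x y) /\
  (forall x : G, exists! k : {ffun 'I_p -> G},
     (forall i, K i (k i)) /\ x = (\prod_(i < p) k i)%g).

Definition product_set (p : nat) (H : 'I_p -> set G) : set G :=
  [set x | exists h : 'I_p -> G,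
     (forall i, H i (h i)) /\ x = (\prod_(i < p) h i)%g].

Definition intermediate_subalgebra (K H : set G) : set {vspace 'rV[R]_n} :=
  [set k | [/\ lie_subalgebra k, lie_algebra H `<` [set` k] &
               [set` k] `<` lie_algebra K]].

End LieAlgebra.

(** * Homotopy equivalence of subspaces *)

(* A subspace of the coordinate space R^coords, which carries the product
   topology. *)
Record coord_subspace (R : realType) := CoordSubspace {
  coords : choiceType;
  points : set {ptws coords -> R}
}.
Arguments points {R} c _.

Definition homotopic_on (R : realType) (X Y : topologicalType)
    (A : set X) (B : set Y) (f g : X -> Y) : Prop :=
  exists F : X * R -> Y,
    [/\ {within A `*` `[0, 1]%classic, continuous F},
        forall x t, A x -> 0 <= t <= 1 -> B (F (x, t)),
        forall x, A x -> F (x, 0) = f x &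
        forall x, A x -> F (x, 1) = g x].

Definition homotopy_equivalent (R : realType) (A B : coord_subspace R) : Prop :=
  exists (f : {ptws coords A -> R} -> {ptws coords B -> R})
         (g : {ptws coords B -> R} -> {ptws coords A -> R}),
    [/\ {within points A, continuous f} /\
        (forall x, points A x -> points B (f x)),
        {within points B, continuous g} /\
        (forall y, points B y -> points A (g y)),
        homotopic_on R (points A) (points A) (g \o f) id &
        homotopic_on R (points B) (points B) (f \o g) id].

(** * Polyhedra *)

Definition order_complex (V : choiceType) (le : rel V) (P : set V) :
    set {fset V} :=
  [set s | [/\ s != fset0, {in s, forall v, P v} &
               {in s &, forall v w, le v w || le w v}]].

(* Barycentric coordinates; the simplicial complex [K] is given by the set of
   its nonempty simplices.  When it is finite, the topology induced by the
   product topology is the usual one. *)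
Definition realization (R : realType) (V : choiceType) (K : set {fset V}) :
    coord_subspace R :=
  @CoordSubspace R V [set x | exists2 s, K s &
    [/\ forall v, 0 <= x v, forall v, v \notin s -> x v = 0 &
        \sum_(v <- s) x v = 1]].

Definition join_point (R : realType) (V W : Type) (x : V -> R) (y : W -> R)
    (l : R) : (V + W + unit)%type -> R :=
  fun i => match i with
           | inl (inl v) => (1 - l) * x v
           | inl (inr w) => l * y w
           | inr _ => l
           end.

(* The last two sets are contained in the first one unless [B], respectively
   [A], is empty: they implement the convention that the join of the empty
   space with a space is that space. *)
Definition join (R : realType) (A B : coord_subspace R) : coord_subspace R :=
  @CoordSubspace R (coords A + coords B + unit)%type
    ([set z | exists x y (l : R), [/\ points A x, points B y, 0 <= l <= 1 &
                                z = join_point x y l]]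
     `|` [set z | exists2 x, points A x & z = join_point x (cst 0) 0]
     `|` [set z | exists2 y, points B y & z = join_point (cst 0) y 1]).

Definition sphere (R : realType) (d : nat) : coord_subspace R :=
  @CoordSubspace R 'I_d.+1 [set x | \sum_(i < d.+1) x i ^+ 2 = 1].

Definition Delta (R : realType) (G : lieGroupType R) (K H : set G) :
    coord_subspace R :=
  realization R (order_complex (fun k l => (k <= l)%VS)
                               (intermediate_subalgebra K H)).

(* Main.v *)
(* Lie algebra part. The normalizer condition forces every vector fixed by Ad(H_i)
   in g_i to lie in h_i (such a vector generates a one-parameter group centralizing
   H_i).  If k is an intermediate subalgebra of g and X in k has components X_i, then
   for x in H_i the vector Ad(x) X - X = Ad(x) X_i - X_i lies in k, so the compact
   group H_i acts on the affine space X_i + (k /\ g_i); it has a fixed point there,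
   which belongs to h_i, whence X_i belongs to k.
   Hence k is the direct sum of the k /\ g_i, and the poset of intermediate
   subalgebras is the product of the closed intervals [h_i, g_i] without its least
   and its greatest element.

   Topological part.  A point of the order complex of such a product poset is a
   probability measure carried by a chain.  It is determined by its marginals,
   which are measures carried by chains of [h_i, g_i], of the same total mass, such
   that not all of them charge h_i and not all of them charge g_i; conversely every
   such family occurs.  The restriction of the marginals to the open intervals and
   the p - 1 differences between the numbers mass(h_i) - mass(g_i) are free
   parameters, which after normalisation describe the join of the order complexes of
   the open intervals with the sphere S^(p-2).  This is a homeomorphism. *)

From HB Require Import structures.
Require Import Defs.
From mathcomp Require Import all_boot all_order all_algebra finmap.
From mathcomp Require Import all_classical all_reals all_analysis.
From mathcomp Require Import zify ring lra.

Set Implicit Arguments.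
Unset Strict Implicit.
Unset Printing Implicit Defensive.

Import Order.TTheory GRing.Theory Num.Theory.
Import numFieldNormedType.Exports.

Local Open Scope classical_set_scope.
Local Open Scope ring_scope.

(** * Differential calculus *)

(** The analytic obstacle is that Lie algebras of closed subgroups, one-parameter groups and fixed
    points of compact groups all have to be built by hand. They are drawn from strict
    differentiability of the product at the identity and from limits along ultrafilters: a vector
    that is merely a limit of rescaled chart coordinates of points of [K] tending to 1 already
    generates a one-parameter group in [K], as a limit of powers. This sequential description makes
    sums, comparison of subgroups and products accessible. Invariance of a subalgebra passes from
    the Lie algebra to the connected group because a compact subgroup with the same Lie algebra is
    open and closed. The fixed point of the affine action is the unique minimiser of an invariant
    convex function. In the topological part, the measure with given marginals has a closed formula
    in maxima of masses; it yields uniqueness and continuity at once, while existence is a separate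
    greedy construction. Cones in place of joins remove normalisations and the case distinctions for
    empty complexes. *)

Ltac rvring := apply/rowP => ?; rewrite !mxE; ring.

Section Frames.
Variable R : realType.

(** Finite dimension, in the form needed for the domains ['rV_n] and products of them: a generating
    family with coordinates. The bounds by 1 hold for the maximum norm and spare constants in the
    estimates along coordinate directions. *)
Record frame (V : normedModType R) := Frame {
  fdim : nat;
  fvec : 'I_fdim -> V;
  fco : 'I_fdim -> V -> R;
  fco_linear : forall i a u v, fco i (a *: u + v) = a * fco i u + fco i v;
  fco_le : forall i v, `|fco i v| <= `|v|;
  fvec_le : forall i, `|fvec i| <= 1;
  fco_sum : forall v, v = \sum_i fco i v *: fvec i
}.

Lemma ler_mx_entry m n (v : 'M[R]_(m, n)) i j : `|v i j| <= `|v|.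
Proof.
by rewrite [leRHS]/Num.Def.normr/= mx_normrE; exact: (le_bigmax _ _ (i, j)).
Qed.

Lemma mx_norm_le m n (v : 'M[R]_(m, n)) e :
  0 <= e -> (forall i j, `|v i j| <= e) -> `|v| <= e.
Proof.
by move=> e0 H; rewrite /Num.Def.normr/= mx_normrE (bigmax_le _ e0)//= => -[i j] _.
Qed.

Lemma rV_norm_le n (v : 'rV[R]_n) e :
  0 <= e -> (forall j, `|v 0 j| <= e) -> `|v| <= e.
Proof. by move=> e0 H; apply: mx_norm_le => // i j; rewrite ord1. Qed.

Lemma ler_fst (V W : normedModType R) (p : V * W) : `|p.1| <= `|p|.
Proof. by rewrite /Num.Def.normr/= le_max lexx. Qed.

Lemma ler_snd (V W : normedModType R) (p : V * W) : `|p.2| <= `|p|.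
Proof. by rewrite /Num.Def.normr/= le_max lexx orbT. Qed.

Lemma pair_norm_le (V W : normedModType R) (p : V * W) e :
  `|p.1| <= e -> `|p.2| <= e -> `|p| <= e.
Proof. by move=> h1 h2; rewrite /Num.Def.normr/= ge_max h1 h2. Qed.

Definition frame_rV n : frame 'rV[R]_n.
Proof.
apply: (@Frame _ n (fun i => delta_mx 0 i) (fun i v => v 0 i)).
- by move=> i a u v; rewrite !mxE.
- by move=> i v; exact: ler_mx_entry.
- move=> i; apply: mx_norm_le => // a j; rewrite mxE.
  by case: (_ && _); rewrite ?normr1 ?normr0.
- by move=> v; exact: row_sum_delta.
Defined.

Definition frame_pair (V W : normedModType R) (F : frame V) (F' : frame W) :
  frame (V * W)%type.
Proof.
apply: (@Frame (V * W)%type (fdim F + fdim F')%N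
  (fun k => match fintype.split k with inl i => (fvec i, 0) | inr j => (0, fvec j) end)
  (fun k v => match fintype.split k with inl i => fco i v.1 | inr j => fco j v.2 end)).
- by move=> i a u v; case: fintype.split => j; rewrite fco_linear.
- move=> i v; case: fintype.split => j; apply: le_trans (fco_le _ _) _.
    exact: ler_fst.
  exact: ler_snd.
- move=> i; case: fintype.split => j; apply: pair_norm_le => /=;
  by rewrite ?normr0 ?fvec_le.
- move=> [v w]; rewrite big_split_ord /=.
  under eq_bigr => i _ do rewrite (unsplitK (inl _ i)).
  under [X in _ + X]eq_bigr => i _ do rewrite (unsplitK (inr _ i)).
  have -> : \sum_(i < fdim F) fco i v *: ((fvec i, 0) : V * W) = (v, 0).
    rewrite {2}(fco_sum F v); elim/big_rec2: _ => //= i y1 [a b] _ [-> ->].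
    by apply/pair_equal_spec; rewrite /= ?scaler0 ?add0r.
  have -> : \sum_(i < fdim F') fco i w *: ((0, fvec i) : V * W) = (0, w).
    rewrite {2}(fco_sum F' w); elim/big_rec2: _ => //= i y1 [a b] _ [-> ->].
    by apply/pair_equal_spec; rewrite /= ?scaler0 ?add0r.
  by apply/pair_equal_spec; rewrite /= addr0 add0r.
Defined.

Lemma is_derive_line (V W : normedModType R) (f : V -> W) a e (t : R) :
  derivable f (a + t *: e) e ->
  is_derive t 1 (fun t : R => f (a + t *: e)) ('D_e f (a + t *: e)).
Proof.
move=> df.
have E : (fun h : R => h^-1 *: (((fun t : R => f (a + t *: e)) \o shift t) (h *: (1 : R))
   - f (a + t *: e))) = (fun h : R => h^-1 *: ((f \o shift (a + t *: e)) (h *: e)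
   - f (a + t *: e))).
  apply/funext => h /=; congr (_ *: (f _ - _)).
  by rewrite [h *: (1 : R)]mulr1 scalerDl addrCA.
by split; rewrite /derivable /derive E.
Qed.

(** The mean value theorem on a segment in direction [e], with the derivative compared to a fixed
    slope [D]: the step in one coordinate of [C1_strict_R]. *)
Lemma mean_step (V : normedModType R) (f : V -> R) a e D eta (c : R) :
  (forall t, `|t| <= `|c| -> derivable f (a + t *: e) e /\
     `|'D_e f (a + t *: e) - D| <= eta) ->
  `|f (a + c *: e) - f a - c * D| <= eta * `|c|.
Proof.
move=> H.
have dg (t : R) : `|t| <= `|c| ->
    is_derive t 1 (fun t : R => f (a + t *: e)) ('D_e f (a + t *: e)).
  by move=> /H[df _]; exact: is_derive_line.
have cg (t : R) : `|t| <= `|c| -> {for t, continuous (fun t : R => f (a + t *: e))}.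
  move=> /dg[+ _]; move=> /derivable1_diffP; exact: differentiable_continuous.
have [c0|c0|->] := ltgtP c 0; last first.
- by rewrite scale0r addr0 subrr mul0r subrr normr0 mulr0.
- have h1 t : t \in `]0, c[%R ->
      is_derive t 1 (fun t : R => f (a + t *: e)) ('D_e f (a + t *: e)).
    by rewrite in_itv /= => /andP[t0 tc]; apply: dg; rewrite !gtr0_norm// ltW.
  have h2 : {within `[0, c], continuous (fun t : R => f (a + t *: e))}.
    apply: continuous_in_subspaceT => t; rewrite inE/= in_itv /= => /andP[t0 tc].
    by apply: cg; rewrite ger0_norm// gtr0_norm.
  have [s + E] := MVT c0 h1 h2.
  move: E; rewrite in_itv /= scale0r addr0 subr0 => -> /andP[s0 sc].
  rewrite mulrC -mulrBr normrM mulrC ler_wpM2r//.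
  by apply: (H _ _).2; rewrite !gtr0_norm// ltW.
- have h1 t : t \in `]c, 0[%R ->
      is_derive t 1 (fun t : R => f (a + t *: e)) ('D_e f (a + t *: e)).
    by rewrite in_itv /= => /andP[t0 tc]; apply: dg; rewrite !ltr0_norm// lerN2 ltW.
  have h2 : {within `[c, 0], continuous (fun t : R => f (a + t *: e))}.
    apply: continuous_in_subspaceT => t; rewrite inE/= in_itv /= => /andP[t0 tc].
    by apply: cg; rewrite ler0_norm// ltr0_norm// lerN2.
  have [s + E] := MVT c0 h1 h2.
  rewrite in_itv /= => /andP[s0 sc]; move: E; rewrite scale0r addr0 sub0r => E.
  have -> : f (a + c *: e) - f a = 'D_e f (a + s *: e) * c.
    by apply: oppr_inj; rewrite -mulrN -E opprB.
  rewrite mulrC -mulrBr normrM mulrC ler_wpM2r//.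
  by apply: (H _ _).2; rewrite !ltr0_norm// lerN2 ltW.
Qed.

End Frames.

(** * Stability of C^k maps and strict differentiability *)

Section CkBasics.
Variable R : realType.
Implicit Types V W Z : normedModType R.

Lemma Ck_continuous k V W (U : set V) (f : V -> W) : Ck k U f ->
  forall x, U x -> {for x, continuous f}.
Proof. by case: k => [|k] [H _] x Ux; apply: H; rewrite inE. Qed.

Lemma Ck_mono k V W (U U' : set V) (f : V -> W) :
  U' `<=` U -> Ck k U f -> Ck k U' f.
Proof.
move=> s; elim: k f => [|k IH] f /= [c d]; split => //.
- by move=> x /[!inE] /s Ux; apply: c; rewrite inE.
- by move=> x /[!inE] /s Ux; apply: c; rewrite inE.
- move=> v; have [d1 d2] := d v; split; last exact: IH.
  by move=> x /[!inE] /s Ux; apply: d1; rewrite inE.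
Qed.

Lemma CkS k V W (U : set V) (f : V -> W) : Ck k.+1 U f -> Ck k U f.
Proof.
elim: k f => [|k IH] f [c d]; split => // v; have [d1 d2] := d v; split => //.
exact: IH.
Qed.

Lemma Ck_ext k V W (U : set V) (f g : V -> W) : open U ->
  (forall x, U x -> f x = g x) -> Ck k U f -> Ck k U g.
Proof.
move=> oU; elim: k f g => [|k IH] f g E [c d].
  have E' x : U x -> {near x, f =1 g}.
    by move=> Ux; apply: filterS (open_nbhs_nbhs (conj oU Ux)).
  split=> // x xU; have Ux : U x by rewrite inE in xU.
  rewrite /continuous_at /prop_for -E//; apply: cvg_trans (c x xU).
  exact/near_eq_cvg/E'.
have E' x : U x -> {near x, f =1 g}.
  by move=> Ux; apply: filterS (open_nbhs_nbhs (conj oU Ux)).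
split.
  move=> x xU; have Ux : U x by rewrite inE in xU.
  rewrite /continuous_at /prop_for -E//; apply: cvg_trans (c x xU).
  exact/near_eq_cvg/E'.
move=> v; have [d1 d2] := d v; split.
  move=> x xU; apply: near_eq_derivable (d1 x xU); apply: E'.
  by rewrite inE in xU.
apply: IH d2 => x Ux; apply: near_eq_derive; exact: E'.
Qed.

Lemma Ck_cst k V W (U : set V) (a : W) : Ck k U (fun _ : V => a).
Proof.
elim: k a => [|k IH] a; split => //; try by move=> x _; exact: cvg_cst.
move=> v; split; first by move=> x _; exact: derivable_cst.
rewrite [X in Ck _ _ X](_ : _ = (fun _ => 0)); first exact: IH.
by apply/funext => x; exact: derive_cst.
Qed.

Lemma Ck_linear k V W (U : set V) (f : {linear V -> W}) : continuous f -> Ck k U f.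
Proof.
move=> cf; have df x : differentiable f x by exact: linear_differentiable.
case: k => [|k]; split => //; try by move=> x _; exact: cf.
move=> v; split; first by move=> x _; exact: diff_derivable.
rewrite [X in Ck _ _ X](_ : _ = (fun _ => f v)); first exact: Ck_cst.
by apply/funext => x; rewrite deriveE// diff_lin.
Qed.

Lemma CkD k V W (U : set V) (f g : V -> W) : open U -> Ck k U f -> Ck k U g ->
  Ck k U (fun x => f x + g x).
Proof.
move=> oU; elim: k f g => [|k IH] f g [c d] [c' d'].
  by split => // x xU; apply: (@continuousD _ _ _ f g); [exact: c|exact: c'].
split; first by move=> x xU; apply: (@continuousD _ _ _ f g); [exact: c|exact: c'].
move=> v; have [d1 d2] := d v; have [d1' d2'] := d' v; split.
  by move=> x xU; apply: (@derivableD _ _ _ f g); [exact: d1|exact: d1'].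
apply: (@Ck_ext _ _ _ _ (fun x => 'D_v f x + 'D_v g x)) => //.
  by move=> x Ux; rewrite (@deriveD _ _ _ f g)//; [apply: d1|apply: d1']; rewrite inE.
exact: IH.
Qed.

Lemma CkM k V (U : set V) (f g : V -> R) : open U -> Ck k U f -> Ck k U g ->
  Ck k U (fun x => f x * g x).
Proof.
move=> oU; elim: k f g => [|k IH] f g F G.
  have [c _] := F; have [c' _] := G.
  by split => // x xU; apply: (@continuousM _ _ f g); [exact: c|exact: c'].
have [c d] := F; have [c' d'] := G.
split; first by move=> x xU; apply: (@continuousM _ _ f g); [exact: c|exact: c'].
move=> v; have [d1 d2] := d v; have [d1' d2'] := d' v; split.
  by move=> x xU; apply: (@derivableM _ _ f g); [exact: d1|exact: d1'].
apply: (@Ck_ext _ _ _ _ (fun x => f x * 'D_v g x + g x * 'D_v f x)) => //.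
  move=> x Ux; rewrite (@deriveM _ _ f g)//; [by apply: d1; rewrite inE|].
  by apply: d1'; rewrite inE.
by apply: CkD => //; apply: IH => //; exact: CkS.
Qed.

Lemma Ck_sum k V W (U : set V) m (f : 'I_m -> V -> W) : open U ->
  (forall i, Ck k U (f i)) -> Ck k U (fun x => \sum_i f i x).
Proof.
move=> oU H; elim: m f H => [|m IH] f H.
  under [X in Ck _ _ X]eq_fun do rewrite big_ord0; exact: Ck_cst.
under [X in Ck _ _ X]eq_fun do rewrite big_ord_recl.
by apply: CkD => //; exact: IH.
Qed.

Lemma rV_continuousP (T : topologicalType) n (f : T -> 'rV[R]_n) x :
  (forall j, {for x, continuous (fun y => f y 0 j)}) -> {for x, continuous f}.
Proof.
move=> H; apply/cvgrPdist_le => /= e e0; near=> y.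
apply: rV_norm_le; first exact: ltW.
near: y; apply: filter_forall => j.
have /cvgrPdist_le/(_ e e0) := H j; apply: filterS => y /=; by rewrite !mxE.
Unshelve. all: by end_near. Qed.

Lemma coord_continuous_at (T : topologicalType) n (f : T -> 'rV[R]_n) x j :
  {for x, continuous f} -> {for x, continuous (fun y => f y 0 j)}.
Proof.
move=> c; apply: (@continuous_comp _ _ _ f (fun v : 'rV_n => v 0 j)) => //.
exact: coord_continuous.
Qed.

Lemma Ck_rV k V n (U : set V) (f : V -> 'rV[R]_n) : open U ->
  Ck k U f <-> forall j, Ck k U (fun x => f x 0 j).
Proof.
move=> oU; elim: k f => [|k IH] f.
  split=> [[c _] j|H].
    split=> // x xU; apply: coord_continuous_at; exact: c.
  by split=> // x xU; apply: rV_continuousP => j; have [c _] := H j; exact: c.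
have E v x : derivable f x v -> forall j, 'D_v f x 0 j = 'D_v (fun x => f x 0 j) x.
  by move=> df j; rewrite derive_mx// mxE.
split=> [[c d] j|H].
  split; first by move=> x xU; apply: coord_continuous_at; exact: c.
  move=> v; have [d1 d2] := d v; split.
    by move=> x /d1; rewrite derivable_mxP; apply.
  apply: (@Ck_ext _ _ _ _ (fun x => 'D_v f x 0 j)) => //; last exact: (IH _).1 d2 j.
  by move=> x Ux; apply: E; apply: d1; rewrite inE.
split; first by move=> x xU; apply: rV_continuousP => j; have [c _] := H j; exact: c.
have D v x : x \in U -> derivable f x v.
  move=> xU; apply/derivable_mxP => i j; rewrite ord1.
  by have [_ /(_ v)[d _]] := H j; exact: d.
move=> v; split; first exact: D.
apply/IH => j; have [_ /(_ v)[_ d]] := H j.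
by apply: Ck_ext d => // x Ux; rewrite E//; apply: D; rewrite inE.
Qed.

(* Strict differentiability: it controls increments between any two points near [x]. *)
Definition sdiff V W (f : V -> W) x (L : V -> W) := forall e : R, 0 < e ->
  exists2 d, 0 < d & forall y z, `|y - x| < d -> `|z - x| < d ->
    `|f y - f z - L (y - z)| <= e * `|y - z|.

(** The candidate derivative, assembled from partial derivatives along the frame. It is linear by
    construction, which ['D_v f x] as a function of [v] is only known to be after [C1_deriveE]. *)
Definition jac V W (F : frame V) (f : V -> W) x (v : V) : W :=
  \sum_i fco (f:=F) i v *: 'D_(fvec i) f x.

Lemma jac_linear V W (F : frame V) (f : V -> W) x a u v :
  jac F f x (a *: u + v) = a *: jac F f x u + jac F f x v.
Proof.
rewrite /jac scaler_sumr -big_split; apply: eq_bigr => i _ /=.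
by rewrite fco_linear scalerDl scalerA.
Qed.

Lemma jac_le V W (F : frame V) (f : V -> W) x : exists2 C, 0 < C &
  forall v, `|jac F f x v| <= C * `|v|.
Proof.
exists (1 + \sum_i `|'D_(fvec (f:=F) i) f x|).
  by rewrite ltr_wpDr// sumr_ge0.
move=> v; apply: le_trans (ler_norm_sum _ _ _) _.
rewrite mulrDl mul1r ler_wpDl// mulr_suml; apply: ler_sum => i _.
by rewrite normrZ mulrC ler_wpM2l// fco_le.
Qed.

(** Pass from [z] to [y] by changing one frame coordinate at a time; each step is controlled by
    [mean_step], since the partial derivatives vary little near [x]. *)
Lemma C1_strict_R V (F : frame V) (U : set V) (f : V -> R) x : open U ->
  Ck 1 U f -> U x -> sdiff f x (jac F f x).
Proof.
move=> oU [c d] Ux e e0; set m := fdim F.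
pose e' := e / m.+1%:R.
have e'0 : 0 < e' by rewrite divr_gt0.
have : \forall w \near x, U w /\ forall i : 'I_m,
    `|'D_(fvec i) f w - 'D_(fvec i) f x| <= e'.
  near=> w; split; first by near: w; apply: open_nbhs_nbhs.
  near: w; apply: filter_forall => i; have [_ d2] := d (fvec i).
  have := Ck_continuous (k:=0) d2 Ux => /cvgrPdist_le/(_ e' e'0).
  by apply: filterS => w; rewrite distrC.
move=> /nbhs_ballP[d0 /= d00 B].
(* The way points [P k], and the segments between them, stay within [(2 m + 3) * del] of [x]: [m]
   steps of length at most [2 * del], one more for the segment, and [del] for [z]. This is less than
   [d0]. *)
pose del := d0 / (2 * m.+2%:R).
have del0 : 0 < del by rewrite divr_gt0// mulr_gt0.
have d0E : d0 = 2 * (m%:R + 2) * del.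
  rewrite /del -addn2 natrD; field.
  by rewrite lt0r_neq0// ltr_wpDr.
exists del => // y z yx zx; pose co i := fco (f:=F) i (y - z).
have cole i : `|co i| <= `|y - z| by exact: fco_le.
have yz : `|y - z| <= 2 * del.
  have -> : y - z = (y - x) - (z - x) by rewrite opprB addrA subrK.
  by apply: le_trans (ler_normB _ _) _; lra.
pose P k := z + \sum_(i < m | (i < k)%N) co i *: fvec i.
have P0 : P 0%N = z by rewrite /P big_pred0 ?addr0.
have Pm : P m = y.
  rewrite /P (eq_bigl xpredT); last by move=> i; rewrite ltn_ord.
  by rewrite -fco_sum addrC subrK.
have PS (k : 'I_m) : P k.+1 = P k + co k *: fvec k.
  rewrite /P -addrA; congr (_ + _); rewrite (bigD1 k) //= addrC; congr (_ + _).
  by apply: eq_bigl => i; rewrite ltnS ltn_neqAle andbC.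
have Pb (k : nat) : `|P k - z| <= m%:R * `|y - z|.
  rewrite /P addrAC subrr add0r (le_trans (ler_norm_sum _ _ _))//.
  rewrite big_mkcond /= (@le_trans _ _ (\sum_(i < m) `|y - z|))//; last first.
    by rewrite sumr_const card_ord mulr_natl.
  apply: ler_sum => i _; case: ifP => // _; rewrite normrZ -[leRHS]mulr1.
  by rewrite ler_pM// fvec_le.
have step (k : 'I_m) : `|f (P k.+1) - f (P k) - co k * 'D_(fvec k) f x| <= e' * `|y - z|.
  rewrite PS (le_trans (mean_step (D:='D_(fvec k) f x) (eta:=e') _))//; last first.
    by rewrite ler_wpM2l// ltW.
  move=> t tc; have [|Uw Dw] := B (P k + t *: fvec k).
    rewrite -ball_normE /= distrC.
    rewrite -[P k + _ - x](_ : (P k - z) + t *: fvec k + (z - x) = _); last first.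
      by rewrite addrAC addrA subrK addrAC.
    apply: le_lt_trans (ler_normD _ _) _.
    apply: le_lt_trans (lerD (ler_normD _ _) (lexx _)) _.
    have h1 : `|t *: fvec k| <= 2 * del.
      rewrite normrZ (le_trans _ yz)// (le_trans _ (cole k))//.
      by rewrite -[leRHS]mulr1 ler_pM// fvec_le.
    have h2 : m%:R * `|y - z| <= m%:R * (2 * del) by rewrite ler_wpM2l.
    have := Pb k; rewrite d0E; lra.
  split; last exact: Dw.
  by have [d1 _] := d (fvec k); apply: d1; rewrite inE.
have -> : f y - f z = \sum_(k < m) (f (P k.+1) - f (P k)).
  by rewrite -{1}Pm -{1}P0 -(telescope_sumr (f \o P))// big_mkord.
rewrite /jac -sumrB (le_trans (ler_norm_sum _ _ _))//.
rewrite (@le_trans _ _ (\sum_(i < m) e' * `|y - z|))//; first by apply: ler_sum.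
rewrite sumr_const card_ord -mulr_natl mulrA ler_wpM2r// /e' mulrCA.
by rewrite -[leRHS]mulr1 (ler_wpM2l (ltW e0))// ler_pdivrMr// mul1r ler_nat.
Unshelve. all: by end_near. Qed.

End CkBasics.

(** * Chain rules *)

Section CkComposition.
Variable R : realType.
Implicit Types V W Z : normedModType R.

Lemma finite_radius (I : finType) (P : I -> R -> Prop) :
  (forall i d d', 0 < d' -> d' <= d -> P i d -> P i d') ->
  (forall i, exists2 d, 0 < d & P i d) ->
  exists2 d, 0 < d & forall i, P i d.
Proof.
move=> Pm H.
suff [d d0 Hd] : exists2 d, 0 < d & forall i, i \in enum I -> P i d.
  by exists d => // i; apply: Hd; rewrite mem_enum.
elim: (enum I) => [|i s [d d0 IH]]; first by exists 1.
have [d' d'0 Pi] := H i; exists (Num.min d d') => [|j].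
  by rewrite lt_min d0.
rewrite inE => /orP[/eqP ->|/IH Pj].
  by apply: Pm Pi; rewrite ?lt_min ?d0// ge_min lexx orbT.
by apply: Pm Pj; rewrite ?lt_min ?d0// ge_min lexx.
Qed.

Definition linear_bounded V W (L : V -> W) :=
  (forall a u v, L (a *: u + v) = a *: L u + L v) /\
  exists2 C, 0 < C & forall v, `|L v| <= C * `|v|.

Lemma linear_boundedZ V W (L : V -> W) a u : linear_bounded L -> L (a *: u) = a *: L u.
Proof.
move=> [lin _]; have L0 : L 0 = 0.
  have := lin (-1) 0 0; rewrite scaler0 addr0 scaleN1r => /eqP.
  by rewrite addNr => /eqP.
by rewrite -[a *: u]addr0 lin L0 addr0.
Qed.

Lemma linear_boundedB V W (L : V -> W) u v : linear_bounded L -> L (u - v) = L u - L v.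
Proof.
by move=> lin; rewrite addrC -scaleN1r lin.1 scaleN1r addrC.
Qed.

Lemma jac_linear_bounded V W (F : frame V) (f : V -> W) x : linear_bounded (jac F f x).
Proof. by split; [exact: jac_linear|exact: jac_le]. Qed.

Lemma fco_linear_bounded V (F : frame V) i : linear_bounded (fco (f:=F) i : V -> R).
Proof.
split; first by move=> a u v; exact: fco_linear.
by exists 1 => // v; rewrite mul1r fco_le.
Qed.

Lemma linear_bounded_sdiff V W (L : V -> W) x : linear_bounded L -> sdiff L x L.
Proof.
move=> lin e e0; exists 1 => // y z _ _.
by rewrite (linear_boundedB _ _ lin) subrr normr0 mulr_ge0// ltW.
Qed.

Lemma linear_bounded_continuous V W (L : V -> W) : linear_bounded L -> continuous L.
Proof.
move=> lin x; have [_ [C C0 LC]] := lin; apply/cvgrPdist_le => e e0; near=> y.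
rewrite -linear_boundedB// (le_trans (LC _))// -ler_pdivlMl// mulrC.
near: y; apply: cvgr_dist_le; last by rewrite divr_gt0.
exact: cvg_id.
Unshelve. all: by end_near. Qed.

Lemma C1_strict V n (F : frame V) (U : set V) (f : V -> 'rV[R]_n) x : open U ->
  Ck 1 U f -> U x -> sdiff f x (jac F f x).
Proof.
move=> oU Cf Ux e e0.
have [|j|d d0 H] := @finite_radius 'I_n (fun j d => forall y z,
   `|y - x| < d -> `|z - x| < d ->
   `|f y 0 j - f z 0 j - jac F (fun x => f x 0 j) x (y - z)| <= e * `|y - z|).
- move=> j d d' d'0 dd' H y z h1 h2; apply: H; exact: lt_le_trans dd'.
- by apply: (C1_strict_R _ oU) => //; move/(Ck_rV _ _ oU): Cf; apply.
exists d => // y z h1 h2; apply: rV_norm_le; first by rewrite mulr_ge0// ltW.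
move=> j; rewrite !mxE (_ : jac F f x (y - z) 0 j = jac F (fun x => f x 0 j) x (y - z)); first exact: H.
rewrite /jac summxE; apply: eq_bigr => i _; rewrite mxE; congr (_ * _).
rewrite derive_mx ?mxE//; have [_ /(_ (fvec i))[+ _]] := Cf; apply.
by rewrite inE.
Qed.

(** The full derivative is asked of the outer map only, so that a curve, or a map with a single
    directional derivative, can be put inside. *)
Lemma sdiff_is_derive V W Z (f : V -> W) (g : Z -> V) t v L :
  linear_bounded L -> sdiff f (g t) L -> derivable g t v ->
  is_derive t v (f \o g) (L ('D_v g t)).
Proof.
move=> lin sd dg; set a := 'D_v g t.
have ga : (fun h : R => h^-1 *: (g (h *: v + t) - g t)) @ 0^' --> a by exact: dg.
have [_ [C C0 LC]] := lin.
suff H : (fun h : R => h^-1 *: (((f \o g) \o shift t) (h *: v) - (f \o g) t)) @ 0^' --> L a.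
  by apply: DeriveDef; [apply/cvg_ex; exists (L a)|exact: cvg_lim].
apply/cvgrPdist_le => e e0.
pose ep := e / (2 * (`|a| + 1)).
have a1 : 0 < `|a| + 1 by rewrite ltr_wpDl.
have ep0 : 0 < ep by rewrite divr_gt0// mulr_gt0.
have [d d0 Hd] := sd _ ep0.
have N1 := (cvgrPdist_le _ _).1 ga _ ltr01.
have N2 := (cvgrPdist_le _ _).1 ga _ (divr_gt0 e0 (mulr_gt0 (ltr0Sn R 1) C0)).
near=> h.
have hN : h != 0 by near: h; exact: nbhs_dnbhs_neq.
have q1 : `|a - h^-1 *: (g (h *: v + t) - g t)| <= 1 by near: h; exact: N1.
have q2 : `|a - h^-1 *: (g (h *: v + t) - g t)| <= e / (2 * C) by near: h; exact: N2.
(* The difference quotient [q] of [g] tends to [a] and is bounded by [|a| + 1], which explains the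
   constant [ep]. *)
set q := h^-1 *: (g (h *: v + t) - g t) in q1 q2.
have qa : `|q| <= `|a| + 1.
  rewrite -[q](subKr a) (le_trans (ler_normB _ _))// lerD2l//.
have gE : g (h *: v + t) - g t = h *: q by rewrite /q scalerA divff// scale1r.
have hd : `|g (h *: v + t) - g t| < d.
  rewrite gE normrZ (le_lt_trans (ler_wpM2l _ qa))// -ltr_pdivlMr//.
  by near: h; apply: dnbhs0_lt; rewrite divr_gt0.
have := Hd (g (h *: v + t)) (g t) hd; rewrite subrr normr0 => /(_ d0).
rewrite gE linear_boundedZ// normrZ => Hq.
have -> : L a - h^-1 *: (((f \o g) \o shift t) (h *: v) - (f \o g) t) =
   L (a - q) - h^-1 *: (f (g (h *: v + t)) - f (g t) - h *: L q).
  by rewrite (linear_boundedB _ _ lin) [h^-1 *: (_ - h *: _)]scalerBr scalerA mulVf// scale1r opprB addrA subrK.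
apply: le_trans (ler_normB _ _) _.
rewrite [leRHS](splitr e) lerD//.
  rewrite (le_trans (LC _))// (le_trans (ler_wpM2l (ltW C0) q2))//.
  by rewrite le_eqVlt; apply/orP; left; apply/eqP; field; exact: lt0r_neq0.
rewrite normrZ normfV ler_pdivrMl ?normr_gt0// (le_trans Hq)// mulrCA.
rewrite ler_wpM2l// (le_trans (ler_wpM2l (ltW ep0) qa))//.
rewrite le_eqVlt; apply/orP; left; apply/eqP; rewrite /ep; field; exact: lt0r_neq0.
Unshelve. all: by end_near. Qed.

Lemma is_derive_linear_comp V W Z (L : V -> W) (g : Z -> V) t v :
  linear_bounded L -> derivable g t v -> is_derive t v (fun z => L (g z)) (L ('D_v g t)).
Proof. by move=> lin; apply: sdiff_is_derive => //; exact: linear_bounded_sdiff. Qed.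

Lemma Ck_linear_comp k V W Z (U : set Z) (L : V -> W) (g : Z -> V) : open U ->
  linear_bounded L -> Ck k U g -> Ck k U (fun z => L (g z)).
Proof.
move=> oU lin; have cL := linear_bounded_continuous lin.
elim: k g => [|k IH] g [c d].
  by split => // x xU; apply: (@continuous_comp _ _ _ g L); [exact: c|exact: cL].
split; first by move=> x xU; apply: (@continuous_comp _ _ _ g L); [exact: c|exact: cL].
move=> v; have [d1 d2] := d v; split.
  by move=> x /d1 dx; have [] := is_derive_linear_comp lin dx.
apply: (@Ck_ext _ _ _ _ _ (fun x => L ('D_v g x))) => //; last exact: IH.
move=> x Ux; have dx : derivable g x v by apply: d1; rewrite inE.
by have [_ ->] := is_derive_linear_comp lin dx.
Qed.

(** Induction on [k]: the derivative of the composite is the sum over the frame of a coordinate of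
    ['D_v g] times ['D_(fvec i) f] after [g], and both factors lose only one order. *)
Lemma Ck_comp_R k V Z (F : frame V) (U : set V) (U' : set Z) (f : V -> R) (g : Z -> V) :
  open U -> open U' -> (forall z, U' z -> U (g z)) ->
  Ck k U f -> Ck k U' g -> Ck k U' (fun z => f (g z)).
Proof.
move=> oU oU' UU'; elim: k f => [|k IH] f Cf Cg.
  split=> // x xU; have Ux : U' x by rewrite inE in xU.
  by apply: (@continuous_comp _ _ _ g f);
    [exact: Ck_continuous Cg _ Ux|apply: Ck_continuous Cf _ _; exact: UU'].
have dfg z v : U' z -> is_derive z v (f \o g) (jac F f (g z) ('D_v g z)).
  move=> Uz; apply: sdiff_is_derive; first exact: jac_linear_bounded.
    apply: (C1_strict_R _ oU); last exact: UU'.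
    by elim: (k) Cf => // k' IH' /CkS.
  by have [_ /(_ v)[d1 _]] := Cg; apply: d1; rewrite inE.
split.
  move=> x xU; have Ux : U' x by rewrite inE in xU.
  by apply: (@continuous_comp _ _ _ g f);
    [exact: Ck_continuous Cg _ Ux|apply: Ck_continuous Cf _ _; exact: UU'].
move=> v; split.
  by move=> x; rewrite inE => Ux; have [] := dfg x v Ux.
apply: (@Ck_ext _ _ _ _ _ (fun z => jac F f (g z) ('D_v g z))) => //.
  by move=> x Ux; have [_ <-] := dfg x v Ux.
rewrite /jac; apply: Ck_sum => // i; apply: CkM => //.
  apply: Ck_linear_comp => //; first exact: fco_linear_bounded.
  by have [_ /(_ v)[]] := Cg.
apply: (IH ('D_(fvec i) f)); last exact: CkS.
by have [_ /(_ (fvec i))[]] := Cf.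
Qed.

Lemma Ck_comp k V Z n (F : frame V) (U : set V) (U' : set Z) (f : V -> 'rV[R]_n)
  (g : Z -> V) : open U -> open U' -> (forall z, U' z -> U (g z)) ->
  Ck k U f -> Ck k U' g -> Ck k U' (fun z => f (g z)).
Proof.
move=> oU oU' UU' Cf Cg; apply/Ck_rV => // j.
by apply: (Ck_comp_R F oU oU' (f:=fun x => f x 0 j)) => //; move/(Ck_rV _ _ oU): Cf; apply.
Qed.

Lemma is_derive_pair V W Z (g : Z -> V) (h : Z -> W) t v dg dh :
  is_derive t v g dg -> is_derive t v h dh ->
  is_derive t v (fun z => (g z, h z)) (dg, dh).
Proof.
move=> [d1 e1] [d2 e2].
suff H : (fun k : R => k^-1 *: (((fun z => (g z, h z)) \o shift t) (k *: v) - (g t, h t)))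
    @ 0^' --> (dg, dh).
  by apply: DeriveDef; [apply/cvg_ex; exists (dg, dh)|exact: cvg_lim].
have -> : (fun k : R => k^-1 *: (((fun z => (g z, h z)) \o shift t) (k *: v) - (g t, h t)))
  = (fun k : R => (k^-1 *: ((g \o shift t) (k *: v) - g t),
                   k^-1 *: ((h \o shift t) (k *: v) - h t))) by [].
by apply: cvg_pair; [rewrite -e1|rewrite -e2].
Qed.

Lemma Ck_pair k V W Z (U : set Z) (g : Z -> V) (h : Z -> W) : open U ->
  Ck k U g -> Ck k U h -> Ck k U (fun z => (g z, h z)).
Proof.
move=> oU; elim: k g h => [|k IH] g h [c d] [c' d'].
  by split => // x xU; apply: cvg_pair; [exact: c|exact: c'].
split; first by move=> x xU; apply: cvg_pair; [exact: c|exact: c'].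
move=> v; have [d1 d2] := d v; have [d1' d2'] := d' v.
have dp x : U x -> is_derive x v (fun z => (g z, h z)) ('D_v g x, 'D_v h x).
  by move=> Ux; apply: is_derive_pair; apply/derivableP; [apply: d1|apply: d1']; rewrite inE.
split; first by move=> x; rewrite inE => /dp[].
apply: (@Ck_ext _ _ _ _ _ (fun x => ('D_v g x, 'D_v h x))) => //; last exact: IH.
by move=> x /dp[_ <-].
Qed.

Lemma Ck_bounded_linear k V W (U : set V) (L : V -> W) : open U ->
  linear_bounded L -> Ck k U L.
Proof.
move=> oU lin; apply: (@Ck_linear_comp k V W V U L id) => //.
by apply: (@Ck_linear _ k V V U idfun) => x; exact: cvg_id.
Qed.

Lemma Ck_id k V (U : set V) : Ck k U (@id V).
Proof. by apply: (@Ck_linear _ k V V U idfun) => x; exact: cvg_id. Qed.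

Lemma C1_deriveE V n (F : frame V) (U : set V) (f : V -> 'rV[R]_n) x v :
  open U -> Ck 1 U f -> U x -> 'D_v f x = jac F f x v.
Proof.
move=> oU Cf Ux; have := @sdiff_is_derive _ _ _ f id x v (jac F f x)
  (jac_linear_bounded _ _ _) (C1_strict F oU Cf Ux) (@derivable_id _ _ x v).
by rewrite derive_id => -[].
Qed.

Lemma C1_sdiff V n (F : frame V) (U : set V) (f : V -> 'rV[R]_n) x :
  open U -> Ck 1 U f -> U x ->
  linear_bounded (fun v => 'D_v f x) /\ sdiff f x (fun v => 'D_v f x).
Proof.
move=> oU Cf Ux; rewrite (_ : (fun v => 'D_v f x) = jac F f x).
  by split; [exact: jac_linear_bounded|exact: C1_strict Cf Ux].
by apply/funext => v; exact: C1_deriveE Cf Ux.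
Qed.

Lemma C1_chain V Z n (F : frame V) (U : set V) (f : V -> 'rV[R]_n) (g : Z -> V) t v :
  open U -> Ck 1 U f -> U (g t) -> derivable g t v ->
  is_derive t v (f \o g) ('D_('D_v g t) f (g t)).
Proof.
move=> oU Cf Ug dg; have [lin sd] := C1_sdiff F oU Cf Ug.
exact: (sdiff_is_derive lin sd dg).
Qed.

End CkComposition.

(** * Lie groups in the chart at 1 *)

Section LocalLie.
Variables (R : realType) (G : lieGroupType R).
Local Notation n := (@lie_dim R G).
Local Notation E := 'rV[R]_n.
Local Notation gchart := (chart R G n).
Local Notation c1 := (@chart1 R G).
Implicit Types (x y z : G) (u v : E) (c d e : gchart).

Lemma chart_codom_map c x : chart_dom c x -> chart_codom c (c x).
Proof. by move=> cx; exists x. Qed.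

Lemma chart_invK c u : chart_codom c u -> c (chart_inv c u) = u.
Proof. by move=> [x cx <-]; rewrite (@chart_mapK _ _ _ c) ?inE. Qed.

Lemma chart_inv_dom c u : chart_codom c u -> chart_dom c (chart_inv c u).
Proof. by move=> [x cx <-]; rewrite (@chart_mapK _ _ _ c) ?inE. Qed.

Lemma mapK c x : chart_dom c x -> chart_inv c (c x) = x.
Proof. by move=> cx; rewrite (@chart_mapK _ _ _ c) ?inE. Qed.

Lemma cont_map c x : chart_dom c x -> {for x, continuous c}.
Proof. by move=> cx; apply: chart_map_continuous; rewrite inE. Qed.

Lemma cont_inv c u : chart_codom c u -> {for u, continuous (chart_inv c)}.
Proof. by move=> cu; apply: chart_inv_continuous; rewrite inE. Qed.

Lemma dom_nbhs c x : chart_dom c x -> nbhs x (chart_dom c).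
Proof. by move=> cx; apply: open_nbhs_nbhs; split => //; exact: chart_dom_open. Qed.

Lemma codom_nbhs c u : chart_codom c u -> nbhs u (chart_codom c).
Proof. by move=> cu; apply: open_nbhs_nbhs; split => //; exact: chart_codom_open. Qed.

Lemma continuous_mulg (T : topologicalType) (f g : T -> G) t :
  {for t, continuous f} -> {for t, continuous g} ->
  {for t, continuous (fun t => f t * g t)%g}.
Proof.
move=> cf cg; apply: (@continuous_comp _ _ _ (fun t => (f t, g t)) (fun p => p.1 * p.2)%g).
  exact: cvg_pair.
exact: lie_mul_continuous.
Qed.

Lemma continuous_invg (T : topologicalType) (f : T -> G) t :
  {for t, continuous f} -> {for t, continuous (fun t => (f t)^-1)%g}.
Proof.
by move=> cf; apply: (@continuous_comp _ _ _ f (fun x => x^-1)%g) => //; exact: lie_inv_continuous.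
Qed.

Definition mul_dom c d e : set (E * E) :=
  [set u | [/\ chart_codom c u.1, chart_codom d u.2 &
               chart_dom e (chart_inv c u.1 * chart_inv d u.2)%g]].
Definition mul_map c d e (u : E * E) : E := e (chart_inv c u.1 * chart_inv d u.2)%g.

Lemma mul_dom_open c d e : open (mul_dom c d e).
Proof.
rewrite openE => -[u v] [cu dv euv].
have f1 : {for (u, v), continuous (@fst E E)} by exact: cvg_fst.
have f2 : {for (u, v), continuous (@snd E E)} by exact: cvg_snd.
have cm : {for (u, v), continuous (fun w : E * E => (chart_inv c w.1 * chart_inv d w.2)%g)}.
  apply: continuous_mulg.
    by apply: (@continuous_comp _ _ _ (@fst E E) (chart_inv c)) => //; exact: cont_inv.
  by apply: (@continuous_comp _ _ _ (@snd E E) (chart_inv d)) => //; exact: cont_inv.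
have n1 := f1 _ (codom_nbhs cu); have n2 := f2 _ (codom_nbhs dv).
have n3 := cm _ (dom_nbhs euv).
by rewrite /interior; near=> w; split; near: w; [exact: n1|exact: n2|exact: n3].
Unshelve. all: by end_near. Qed.

Lemma mul_map_Ck k c d e : atlas c -> atlas d -> atlas e ->
  Ck k (mul_dom c d e) (mul_map c d e).
Proof. by move=> ac ad ae; exact: lie_mul_smooth. Qed.

Definition inv_dom c d : set E :=
  [set u | chart_codom c u /\ chart_dom d (chart_inv c u)^-1%g].
Definition inv_map c d (u : E) : E := d (chart_inv c u)^-1%g.

Lemma inv_dom_open c d : open (inv_dom c d).
Proof.
rewrite openE => u [cu du].
have cm : {for u, continuous (fun w : E => (chart_inv c w)^-1%g)}.
  by apply: continuous_invg; exact: cont_inv.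
have n1 := codom_nbhs cu; have n3 := cm _ (dom_nbhs du).
by rewrite /interior; near=> w; split; near: w; [exact: n1|exact: n3].
Unshelve. all: by end_near. Qed.

Lemma inv_map_Ck k c d : atlas c -> atlas d -> Ck k (inv_dom c d) (inv_map c d).
Proof. by move=> ac ad; exact: lie_inv_smooth. Qed.

Lemma atlas1 : atlas c1. Proof. exact: chart_at_atlas. Qed.
Lemma dom1 : chart_dom c1 1%g. Proof. exact: chart_at_dom. Qed.
Local Notation e0 := (c1 1%g).
Lemma codom1 : chart_codom c1 e0. Proof. exact: chart_codom_map dom1. Qed.

Definition phi x : E := c1 x - e0.
Definition near1 (r : R) x := chart_dom c1 x /\ `|phi x| < r.

Lemma phi1 : phi 1%g = 0. Proof. by rewrite /phi subrr. Qed.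

Lemma near1_1 r : 0 < r -> near1 r 1%g.
Proof. by move=> r0; split; [exact: dom1|rewrite phi1 normr0]. Qed.

Lemma near1_le r r' x : r <= r' -> near1 r x -> near1 r' x.
Proof. by move=> rr [? h]; split => //; exact: lt_le_trans rr. Qed.

Lemma phi_inj x y : chart_dom c1 x -> chart_dom c1 y -> phi x = phi y -> x = y.
Proof. by move=> dx dy /addIr h; rewrite -(mapK dx) h mapK. Qed.

Lemma continuous_phi x : chart_dom c1 x -> {for x, continuous phi}.
Proof.
move=> dx; apply: (@continuousB _ _ _ c1 (fun=> e0)); first exact: cont_map.
exact: cst_continuous.
Qed.

Lemma near1_nbhs r : 0 < r -> nbhs (1%g : G) (near1 r).
Proof.
move=> r0; have := continuous_phi dom1 => /cvgrPdist_lt/(_ r r0) h.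
have h' := dom_nbhs dom1; near=> x; split; first by near: x.
rewrite -[phi x]opprK normrN -[- _]add0r -phi1; near: x; exact: h.
Unshelve. all: by end_near. Qed.

Lemma nbhs_near1 (A : set G) : nbhs (1%g : G) A -> exists2 r, 0 < r & forall x, near1 r x -> A x.
Proof.
move=> nA; have := cont_inv codom1; rewrite /continuous_at/prop_for /= mapK; last exact: dom1.
move=> /(_ A nA) /nbhs_ballP[r /= r0 H]; exists r => // x [dx px].
rewrite -(mapK dx); apply: H; rewrite -ball_normE /=.
by rewrite distrC.
Qed.

Lemma phi_surj : exists2 r, 0 < r & forall u, `|u| < r -> exists x, chart_dom c1 x /\ phi x = u.
Proof.
have := codom_nbhs codom1 => /nbhs_ballP[r /= r0 H]; exists r => // u ur.
have cu : chart_codom c1 (u + e0).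
  by apply: H; rewrite -ball_normE /= opprD addrCA subrr addr0 normrN.
exists (chart_inv c1 (u + e0)); split; first exact: chart_inv_dom.
by rewrite /phi chart_invK// addrK.
Qed.

Lemma mul_dom11 : mul_dom c1 c1 c1 (e0, e0).
Proof.
split; [exact: codom1|exact: codom1|].
by rewrite /= (mapK dom1) mulg1; exact: dom1.
Qed.

(** By linearity it suffices to restrict to the two axes, where multiplication by 1 is the identity
    map in the chart. *)
Lemma mul_map_diff11 u v : 'D_(u, v) (mul_map c1 c1 c1) (e0, e0) = u + v.
Proof.
pose F := frame_pair (frame_rV R n) (frame_rV R n).
have C := @mul_map_Ck 1 _ _ _ atlas1 atlas1 atlas1.
have O := @mul_dom_open c1 c1 c1.
have [lin _] := C1_sdiff F O C mul_dom11.
have I : is_derive e0 u (@id E) u by apply: is_derive_id.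
have I' : is_derive e0 v (@id E) v by apply: is_derive_id.
have K w : is_derive e0 w (fun _ : E => e0) 0 by apply: is_derive_cst.
have gl := is_derive_pair I (K u).
have gr := is_derive_pair (K v) I'.
have -> : (u, v) = 1 *: (u, 0) + (0, v).
  by apply/pair_equal_spec; rewrite /= scaler0 scale1r addr0 add0r.
rewrite lin.1 scale1r; congr (_ + _).
  have [dl el] := gl.
  have [_] := @C1_chain _ _ _ _ F _ (mul_map c1 c1 c1) (fun w : E => (w, e0)) e0 u O C mul_dom11 dl.
  rewrite el => <-; rewrite -[RHS](derive_id e0 u); apply: near_eq_derive.
  apply: filterS (codom_nbhs codom1) => w cw.
  by rewrite /mul_map /= (mapK dom1) mulg1 chart_invK.
have [dl el] := gr.
have [_] := @C1_chain _ _ _ _ F _ (mul_map c1 c1 c1) (fun w : E => (e0, w)) e0 v O C mul_dom11 dl.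
rewrite el => <-; rewrite -[RHS](derive_id e0 v); apply: near_eq_derive.
apply: filterS (codom_nbhs codom1) => w cw.
by rewrite /mul_map /= (mapK dom1) mul1g chart_invK.
Qed.

(** Strictness pays here: two products are compared with an error proportional to the distance
    between their factors, not to the size of the factors. *)
Lemma phi_mul_strict eps : 0 < eps -> exists2 r, 0 < r & forall x x' y y',
  near1 r x -> near1 r x' -> near1 r y -> near1 r y' ->
  [/\ chart_dom c1 (x * y)%g, chart_dom c1 (x' * y')%g &
   `|phi (x * y)%g - phi (x' * y')%g - ((phi x - phi x') + (phi y - phi y'))|
     <= eps * (`|phi x - phi x'| + `|phi y - phi y'|)].
Proof.
move=> ep0; pose F := frame_pair (frame_rV R n) (frame_rV R n).
have C := @mul_map_Ck 1 _ _ _ atlas1 atlas1 atlas1.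
have O := @mul_dom_open c1 c1 c1.
have [_ sd] := C1_sdiff F O C mul_dom11.
have [d d0 Hd] := sd _ ep0.
have := open_nbhs_nbhs (conj O mul_dom11) => /nbhs_ballP[d' /= d'0 Hd'].
exists (Num.min d d'); first by rewrite lt_min d0.
have dist x y r : near1 r x -> near1 r y -> `|(c1 x, c1 y) - (e0, e0)| < r.
  move=> [_ h1] [_ h2].
  by rewrite [ltLHS]/Num.Def.normr /= gt_max; apply/andP; split.
move=> x x' y y' nx nx' ny ny'.
have := dist _ _ _ nx ny; rewrite lt_min => /andP[h1 h2].
have := dist _ _ _ nx' ny'; rewrite lt_min => /andP[h1' h2'].
have dmul a b : chart_dom c1 a -> chart_dom c1 b -> `|(c1 a, c1 b) - (e0, e0)| < d' ->
    chart_dom c1 (a * b)%g.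
  move=> da db h; have [_ _] : mul_dom c1 c1 c1 (c1 a, c1 b).
    by apply: Hd'; rewrite -ball_normE /ball_ /= distrC.
  rewrite -[(c1 a, c1 b).1]/(c1 a) -[(c1 a, c1 b).2]/(c1 b).
  by rewrite (mapK da) (mapK db).
have dxy := dmul _ _ nx.1 ny.1 h2; have dxy' := dmul _ _ nx'.1 ny'.1 h2'.
split=> //; have := Hd _ _ h1 h1'.
rewrite [X in 'D_X _ _](_ : _ = (c1 x - c1 x', c1 y - c1 y')) // mul_map_diff11.
rewrite /mul_map /= (mapK nx.1) (mapK ny.1) (mapK nx'.1) (mapK ny'.1).
have E a b : phi a - phi b = c1 a - c1 b by rewrite /phi opprB addrA subrK.
rewrite !E => h; apply: le_trans h _; rewrite ler_wpM2l//; first exact: ltW.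
by apply: pair_norm_le; rewrite /= ?lerDl ?lerDr.
Qed.

(** The error involves [y] alone, so that multiplying repeatedly by a small element accumulates an
    error linear in the number of factors. *)
Lemma phi_mul_est eps : 0 < eps -> exists2 r, 0 < r & forall x y,
  near1 r x -> near1 r y -> chart_dom c1 (x * y)%g /\
   `|phi (x * y)%g - (phi x + phi y)| <= eps * `|phi y|.
Proof.
move=> ep0; have [r r0 H] := phi_mul_strict ep0; exists r => // x y nx ny.
have [d _] := H x x y 1%g nx nx ny (near1_1 r0).
by rewrite mulg1 phi1 subr0 subrr normr0 !add0r => h; split; rewrite // opprD addrA.
Qed.

Lemma phi_div_est eps : 0 < eps -> exists2 r, 0 < r & forall x y,
  near1 r x -> near1 r y -> chart_dom c1 (x^-1 * y)%g /\
   `|phi (x^-1 * y)%g - (phi y - phi x)| <= eps * `|phi y - phi x|.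
Proof.
(* The bound obtained for [w = phi (x^-1 * y)] has [ep * |w|] on its right-hand side. Solving it
   gives [|w| <= (1 + eps) * |v|], and [ep * (1 + eps) = eps]. *)
move=> ep0; pose ep := eps / (1 + eps).
have ep1 : 0 < 1 + eps by rewrite addr_gt0.
have epp : 0 < ep by rewrite divr_gt0.
have [r r0 H] := phi_mul_strict epp.
(* x * 1 against x * (x^-1 y) *)
pose f (p : G * G) := (p.1^-1 * p.2)%g.
have cf : {for (1%g, 1%g), continuous f}.
  by apply: continuous_mulg; [apply: continuous_invg; exact: cvg_fst|exact: cvg_snd].
have : nbhs (f (1%g, 1%g)) (near1 r) by rewrite /f /= invg1 mulg1; exact: near1_nbhs.
move=> /cf [[A B] /= [nA nB] AB].
have [r1 r10 H1] := nbhs_near1 nA; have [r2 r20 H2] := nbhs_near1 nB.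
exists (Num.min r (Num.min r1 r2)); first by rewrite !lt_min r0 r10.
move=> x y nx ny.
have nxy : near1 r (x^-1 * y)%g.
  apply: (AB (x, y)); split => /=; [apply: H1; apply: near1_le nx|apply: H2; apply: near1_le ny].
    by rewrite !ge_min lexx orbT.
  by rewrite !ge_min lexx !orbT.
have nx' : near1 r x by apply: near1_le nx; rewrite ge_min lexx.
have [_ _] := H x x (x^-1 * y)%g 1%g nx' nx' nxy (near1_1 r0).
rewrite mulVKg mulg1 phi1 subr0 subrr normr0 !add0r => h; split; first exact: nxy.1.
set w := phi (x^-1 * y)%g in h *; set v := phi y - phi x in h *.
have hw : `|w| <= (1 + eps) * `|v|.
  have : `|w| <= `|v| + ep * `|w|.
    rewrite -[w in leLHS](subKr v) (le_trans (ler_normB _ _))// lerD2l//.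
  have -> : ep = 1 - (1 + eps)^-1 by rewrite /ep; field; exact: lt0r_neq0.
  rewrite mulrBl mul1r -lerBlDr opprB addrC subrK => h'.
  by rewrite -ler_pdivrMl//.
rewrite distrC (le_trans h)// (le_trans (ler_wpM2l (ltW epp) hw))//.
by rewrite mulrA /ep divfK// lt0r_neq0.
Qed.

End LocalLie.

(** * Closed subgroups and their Lie algebras *)

Section UltraLimits.

Lemma ultra_fmap (T V : Type) (U : set_system T) (f : T -> V) :
  UltraFilter U -> UltraFilter (f @ U).
Proof.
move=> UU; have PU : ProperFilter U by exact: ultra_proper.
have PfU : ProperFilter (f @ U) by exact: fmap_proper_filter.
refine (@Build_UltraFilter _ _ PfU _) => G PG sub; apply/seteqP; split=> [A GA|A]; last exact: sub.
 have [//|UA] := in_ultra_setVsetC (f @^-1` A) UU.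
have GC : G (~` A) by exact: sub.
by have [z []] := filter_ex (filterI GA GC).
Qed.

(** One ultrafilter makes the families for all parameters converge at once, which replaces the
    extraction of subsequences. *)
Lemma ultra_compact_lim (T : Type) (V : topologicalType) (U : set_system T) (K : set V)
  (f : T -> V) : UltraFilter U -> compact K -> (\forall k \near U, K (f k)) ->
  exists2 p, K p & f @ U --> p.
Proof.
rewrite compact_ultra => UU cK nK.
by have [p [Kp fp]] := cK _ (ultra_fmap f UU) nK; exists p.
Qed.

Lemma lim_norm_le (R : realType) (V : normedModType R) (T : Type) (U : set_system T)
  (v : T -> V) u a b : ProperFilter U -> v @ U --> u ->
  (forall eta, 0 < eta -> \forall k \near U, `|v k - a| <= b + eta) -> `|u - a| <= b.
Proof.
move=> PU vu H; apply/ler_addgt0Pr => e e0.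
have e20 : 0 < e / 2 by rewrite divr_gt0.
have h1 : \forall k \near U, `|u - v k| <= e / 2 by move/cvgrPdist_le: vu; apply.
have h2 := H _ e20.
have [k [k1 k2]] := filter_ex (filterI h1 h2).
have -> : u - a = (u - v k) + (v k - a) by rewrite addrA subrK.
by apply: le_trans (ler_normD _ _) _; lra.
Qed.

Lemma ultra_oo : exists2 U : set_system nat, UltraFilter U & \oo `<=` U.
Proof.
have [U [UU s]] := @ultraFilterLemma nat \oo _; by exists U.
Qed.

Lemma compact_norm_le (R : realType) n (r : R) : compact [set u : 'rV[R]_n | `|u| <= r].
Proof.
apply: bounded_closed_compact.
  exists r; split; first exact: num_real.
  by move=> M rM u /= ur; exact: le_trans ur (ltW rM).
apply: (@preimage_closed _ _ (fun u : 'rV[R]_n => `|u|) [set x | x <= r]); last exact: closed_le.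
by move=> u _; exact: norm_continuous.
Qed.

End UltraLimits.

(** * One-parameter groups from tangent sequences *)

Section OneParameter.
Variables (R : realType) (G : lieGroupType R).
Local Notation n := (@lie_dim R G).
Local Notation E := 'rV[R]_n.
Local Notation c1 := (@chart1 R G).
Implicit Types (x y z : G) (u v X Y : E) (K : set G) (c : R -> G).

Definition subgroup K := K 1%g /\ forall x y, K x -> K y -> K (x * y^-1)%g.

Lemma subgroupV K x : subgroup K -> K x -> K x^-1%g.
Proof. by move=> [k1 kd] kx; rewrite -[x^-1%g]mul1g; exact: kd. Qed.

Lemma subgroupM K x y : subgroup K -> K x -> K y -> K (x * y)%g.
Proof. by move=> sK kx ky; rewrite -[y]invgK; apply: sK.2 => //; exact: subgroupV. Qed.

Lemma subgroupX K x m : subgroup K -> K x -> K (x ^+ m)%g.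
Proof.
move=> sK kx; elim: m => [|m IH]; first by rewrite expg0; exact: sK.1.
by rewrite expgS; exact: subgroupM.
Qed.

Definition one_param c := forall s t, c (s + t) = (c s * c t)%g.

Definition velocity c X := forall eps : R, 0 < eps ->
  exists2 d, 0 < d & forall t, `|t| < d ->
    chart_dom c1 (c t) /\ `|phi (c t) - t *: X| <= eps * `|t|.

(** The sequential tangent cone at 1: [X] is a limit of [r_k *: phi x_k] with [x_k] in [K] tending
    to 1 and [r_k] tending to infinity. Unlike a smooth curve, such a sequence is directly available
    from products and limits; [lie_algebra_tangentP] identifies the two notions for compact
    subgroups. *)
Definition tangent K X := forall eps : R, 0 < eps -> exists x (r : R),
  [/\ K x, 0 < r, r^-1 < eps, near1 eps x & `|r *: phi x - X| < eps].

Lemma one_param0 c : one_param c -> c 0 = 1%g.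
Proof.
move=> cD; apply: (@mulgI _ (c 0)); by rewrite -cD addr0 mulg1.
Qed.

Lemma one_paramN c t : one_param c -> c (- t) = (c t)^-1%g.
Proof.
move=> cD; apply: (@mulgI _ (c t)); by rewrite -cD subrr mulgV one_param0.
Qed.

Lemma one_paramX c t m : one_param c -> c (m%:R * t) = (c t ^+ m)%g.
Proof.
move=> cD; elim: m => [|m IH]; first by rewrite mul0r one_param0.
by rewrite -natr1 mulrDl mul1r cD IH expgSr.
Qed.

Lemma one_param_commute c s t : one_param c -> commute (c s) (c t).
Proof. by move=> cD; rewrite /commute -!cD addrC. Qed.

Lemma cvg_mulg (T : Type) (F : set_system T) (FF : Filter F) (g h : T -> G) p q :
  g @ F --> p -> h @ F --> q -> (fun k => g k * h k)%g @ F --> (p * q)%g.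
Proof.
move=> gp hq; apply: (@cvg_comp _ _ _ (fun k => (g k, h k)) (fun p => p.1 * p.2)%g F
  (nbhs (p, q)) (nbhs (p * q)%g)); [exact: cvg_pair|exact: (@lie_mul_continuous R G (p, q))].
Qed.

(** Each factor adds an error of at most [eps * |phi x|]. The size hypothesis keeps all intermediate
    powers in the ball where [phi_mul_est] applies. *)
Lemma phi_expg eps : 0 < eps -> exists2 r, 0 < r & forall x N, chart_dom c1 x ->
  N%:R * `|phi x| * (1 + eps) < r ->
  chart_dom c1 (x ^+ N)%g /\ `|phi (x ^+ N)%g - N%:R *: phi x| <= eps * (N%:R * `|phi x|).
Proof.
move=> ep0; have [r r0 H] := @phi_mul_est R G _ ep0; exists r => // x N dx.
case: N => [|N].
  by rewrite expg0 mul0r scale0r phi1 subr0 normr0 mul0r mulr0; split=> //; exact: dom1.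
have ep1 : 1 <= 1 + eps by rewrite lerDl ltW.
move=> hN.
have px r' : r' * `|phi x| * (1 + eps) <= r' * `|phi x| * (1 + eps) by [].
have nx : near1 r x.
  split=> //; apply: le_lt_trans hN; rewrite -{1}[ `|phi x|]mulr1 ler_pM//.
  by rewrite ler_peMl// ler1n.
suff : forall M, (M <= N.+1)%N -> chart_dom c1 (x ^+ M)%g /\
    `|phi (x ^+ M)%g - M%:R *: phi x| <= eps * (M%:R * `|phi x|) by apply.
elim=> [_|M IH MN].
  by rewrite expg0 mul0r scale0r phi1 subr0 normr0 mulr0; split=> //; exact: dom1.
have [dM eM] := IH (ltnW MN).
have nM : near1 r (x ^+ M)%g.
  split=> //.
  have : `|phi (x ^+ M)%g| <= M%:R * `|phi x| * (1 + eps).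
    rewrite -[phi (x ^+ M)%g](subrK (M%:R *: phi x)).
    rewrite (le_trans (ler_normD _ _))// normrZ ger0_norm//.
    by rewrite mulrDr mulr1 addrC lerD2l mulrC.
  move=> h; apply: le_lt_trans h _; apply: le_lt_trans hN.
  rewrite ler_wpM2r//; first by rewrite (le_trans ler01).
  by rewrite ler_wpM2r// ler_nat ltnW.
have [d h] := H _ _ nM nx; rewrite -expgSr in d h; split=> //.
rewrite -natr1 scalerDl scale1r.
have -> : phi (x ^+ M.+1)%g - (M%:R *: phi x + phi x) =
   (phi (x ^+ M.+1)%g - (phi (x ^+ M)%g + phi x)) + (phi (x ^+ M)%g - M%:R *: phi x).
  by rvring.
apply: le_trans (ler_normD _ _) _; rewrite mulrDl mulrDr mul1r addrC; exact: lerD.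
Qed.

Lemma one_param_of_nonneg (f : R -> G) :
  (forall s t, 0 <= s -> 0 <= t -> f (s + t) = (f s * f t)%g) ->
  one_param (fun t => if 0 <= t then f t else (f (- t))^-1%g).
Proof.
move=> fD.
have comm s t : 0 <= s -> 0 <= t -> (f s * f t = f t * f s)%g.
  by move=> s0 t0; rewrite -!fD// addrC.
have commV s t : 0 <= s -> 0 <= t -> (f s * (f t)^-1 = (f t)^-1 * f s)%g.
  by move=> s0 t0; apply: commuteV; exact: comm.
have key s t : 0 <= s -> t < 0 ->
    (if 0 <= s + t then f (s + t) else (f (- (s + t)))^-1%g) = (f s * (f (- t))^-1)%g.
  move=> s0 t0; have nt : 0 <= - t by rewrite oppr_ge0 ltW.
  case: ifPn => st.
    by apply: (@mulIg _ (f (- t))); rewrite -fD// addrK mulgVK.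
  have st' : 0 <= - (s + t) by rewrite oppr_ge0 ltW// ltNge.
  apply: invg_inj; rewrite invgK invgM invgK; apply: (@mulIg _ (f s)).
  by rewrite -fD// mulgVK opprD addrAC addNr add0r.
move=> s t; have [s0|s0] := leP 0 s; have [t0|t0] := leP 0 t.
- by rewrite addr_ge0// fD.
- exact: key.
- by rewrite addrC key// commV// oppr_ge0 ltW.
- rewrite leNgt (_ : s + t < 0) /=; last by lra.
  by rewrite opprD addrC fD ?oppr_ge0 ?(ltW s0) ?(ltW t0)// invgM.
Qed.

Lemma velocity_nonneg c X : one_param c ->
  (forall eps : R, 0 < eps -> exists2 d, 0 < d & forall t, 0 <= t -> t < d ->
    chart_dom c1 (c t) /\ `|phi (c t) - t *: X| <= eps * t) -> velocity c X.
Proof.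
move=> cD H eps ep0.
have [r r0 Hr] := @phi_div_est R G 1 ltr01.
have X0 : 0 < `|X| + 1 by rewrite ltr_wpDl.
pose e1 := Num.min (eps / 4) 1.
have e10 : 0 < e1 by rewrite lt_min divr_gt0//=.
pose e2 := Num.min (eps / 4 / (`|X| + 1)) 1.
have e20 : 0 < e2 by rewrite lt_min !divr_gt0//=.
have [r2 r20 Hr2] := @phi_div_est R G e2 e20.
have [d d0 Hd] := H e1 e10.
exists (Num.min d (r2 / (`|X| + 1))); first by rewrite lt_min d0 divr_gt0.
move=> t; rewrite lt_min => /andP[t1 t2].
have [t0|t0] := leP 0 t.
  rewrite ger0_norm// in t1 t2 *; have [dt ht] := Hd t t0 t1; split=> //.
  apply: le_trans ht _; rewrite ler_wpM2r// ge_min; apply/orP; left; lra.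
rewrite ltr0_norm// in t1 t2 *; set s := - t in t1 t2 *.
have s0 : 0 <= s by rewrite oppr_ge0 ltW.
have [ds hs] := Hd s s0 t1.
have ps : `|phi (c s)| <= s * (`|X| + 1).
  rewrite -[phi _](subrK (s *: X)) (le_trans (ler_normD _ _))// normrZ ger0_norm//.
  rewrite mulrDr mulr1 addrC lerD2l (le_trans hs)// ler_piMl// ge_min lexx orbT//.
have ns : near1 r2 (c s) by split=> //; apply: le_lt_trans ps _; rewrite -ltr_pdivlMr.
have -> : c t = (c s)^-1%g by rewrite -[t]opprK one_paramN.
have [] := Hr2 (c s) 1%g ns (near1_1 G r20).
rewrite mulg1 phi1 sub0r opprK normrN => dm hm; split=> //.
have -> : phi (c s)^-1%g - t *: X = (phi (c s)^-1%g + phi (c s)) - (phi (c s) - s *: X).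
  by rewrite -[t]opprK -/s; rvring.
apply: le_trans (ler_normB _ _) _.
have h1 : e1 * s <= eps / 4 * s by rewrite ler_wpM2r// ge_min lexx.
have h2 : e2 * `|phi (c s)| <= eps / 4 * s.
  apply: le_trans (ler_wpM2l (ltW e20) ps) _.
  rewrite mulrCA mulrC ler_wpM2r// -ler_pdivlMr// ge_min lexx//.
have : eps / 4 * s <= eps / 2 * s by rewrite ler_wpM2r//; lra.
have -> : eps * s = eps / 4 * s + eps / 4 * s + eps / 2 * s by field.
by have := mulr_ge0 (ltW ep0) s0; lra.
Qed.

Lemma truncnD_bit (a b : R) : 0 <= a -> 0 <= b ->
  exists e : bool, Num.truncn (a + b) = (Num.truncn a + Num.truncn b + e)%N.
Proof.
move=> a0 b0; have /andP[a1 a2] := truncn_itv a0; have /andP[b1 b2] := truncn_itv b0.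
case: (leP (Num.truncn a + Num.truncn b).+1%:R (a + b)) => h.
  exists true; apply: truncn_def; rewrite addn1 h /=.
  by rewrite -natr1 in a2; rewrite -natr1 in b2; rewrite -!natr1 natrD; lra.
exists false; apply: truncn_def; rewrite addn0 h natrD; lra.
Qed.

(** The one-parameter group is the limit of the powers of [xs k] whose exponent is the integer part
    of [rs k * t]. Integer parts are additive up to 0 or 1, and the resulting extra factor [xs k]
    tends to 1; hence the limit is additive for nonnegative times. Compactness of [K] provides the
    limit for every [t], not only for small ones. *)
Lemma tangent_exp K X : subgroup K -> compact K -> tangent K X ->
  exists c, [/\ one_param c, forall t, K (c t) & velocity c X].
Proof.
move=> sK cK tX.
have /choice[xs Hxs] : forall k : nat, exists x, exists r : R, [/\ K x, 0 < r, r^-1 < k.+1%:R^-1,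
    near1 k.+1%:R^-1 x & `|r *: phi x - X| < k.+1%:R^-1].
  by move=> k; apply: tX; rewrite invr_gt0.
have {Hxs} /choice[rs Hs] := Hxs.
have [U UU ooU] := ultra_oo.
have inv0 (e : R) : 0 < e -> \forall k \near U, k.+1%:R^-1 < e.
  move=> e0; apply: ooU; have := near_infty_natSinv_lt (PosNum e0).
  by apply: filterS.
pose y k t := (xs k ^+ Num.truncn (rs k * t))%g.
have Ky k t : K (y k t) by apply: subgroupX => //; have [] := Hs k.
have /choice[f Hf] : forall t, exists p, K p /\ y^~ t @ U --> p.
  move=> t; have [|p Kp yp] := @ultra_compact_lim _ _ U K (y^~ t) UU cK.
    by apply: filterE => k; exact: Ky.
  by exists p.
have fD s t : 0 <= s -> 0 <= t -> f (s + t) = (f s * f t)%g.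
  move=> s0 t0; apply: (@cvg_unique _ (@lie_hausdorff R G) (y^~ (s + t) @ U)).
    by have [] := Hf (s + t).
  have /choice[b Hb] : forall k, exists b : bool, Num.truncn (rs k * (s + t)) =
       (Num.truncn (rs k * s) + Num.truncn (rs k * t) + b)%N.
    move=> k; rewrite mulrDr; have [_ r0 _ _ _] := Hs k.
    by apply: truncnD_bit; rewrite mulr_ge0// ltW.
  have -> : y^~ (s + t) = (fun k => y k s * y k t * xs k ^+ b k)%g.
    by apply/funext => k; rewrite /y Hb !expgnDr.
  have xb : (fun k => xs k ^+ b k)%g @ U --> (1%g : G).
    move=> A /nbhs_near1[r r0 HA].
    have := inv0 r r0; apply: filterS => k kr; apply: HA.
    have [_ _ _ nk _] := Hs k.
    case: (b k); last by rewrite expg0; exact: near1_1.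
    by rewrite expg1; apply: near1_le nk; exact: ltW.
  rewrite -[(f s * f t)%g]mulg1.
  apply: cvg_mulg => //; apply: cvg_mulg; [by have [] := Hf s|by have [] := Hf t].
pose c t := if 0 <= t then f t else (f (- t))^-1%g.
have cD : one_param c by exact: one_param_of_nonneg.
exists c; split => //.
  move=> t; rewrite /c; case: ifP => _; first by have [] := Hf t.
  by apply: subgroupV => //; have [] := Hf (- t).
apply: velocity_nonneg => // eps ep0.
have X0 : 0 < `|X| + 1 by rewrite ltr_wpDl.
pose e1 := eps / (`|X| + 1).
have e10 : 0 < e1 by rewrite divr_gt0.
have [r r0 Hr] := phi_expg e10.
have [ro ro0 Hro] := @phi_surj R G.
have e11 : 0 < 1 + e1 by rewrite addr_gt0.
(* Since [rs k * |phi (xs k)| <= |X| + 1], the first bound meets the size condition of [phi_expg],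
   and the second keeps the coordinates [phi (y k t)] eventually in the ball of radius [ro / 2], so
   that their limit is in the image of the chart. *)
exists (Num.min (r / ((`|X| + 1) * (1 + e1))) (ro / 2 / ((`|X| + 1) * (1 + e1)))).
  by rewrite lt_min !divr_gt0// mulr_gt0.
move=> t t0; rewrite lt_min !ltr_pdivlMr ?mulr_gt0// => /andP[t1 t2].
have rx1 : \forall k \near U, rs k * `|phi (xs k)| <= `|X| + 1.
  apply: filterE => k; have [_ rk _ _ h] := Hs k.
  rewrite -[X in X * _](gtr0_norm rk) -normrZ.
  rewrite -[_ *: _](subrK X) (le_trans (ler_normD _ _))// addrC lerD2l.
  by rewrite (le_trans (ltW h))// invf_le1// ler1n.
have Nt k : (Num.truncn (rs k * t))%:R <= rs k * t /\ `|(Num.truncn (rs k * t))%:R / rs k - t| <= k.+1%:R^-1.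
  have [_ rk rk' _ _] := Hs k.
  have /andP[h1 h2] := truncn_itv (mulr_ge0 (ltW rk) t0); split => //.
  rewrite -natr1 in h2; set N := (Num.truncn _)%:R in h1 h2 *.
  have A : t <= (N + 1) / rs k by rewrite ler_pdivlMr// [t * _]mulrC ltW.
  have B : N / rs k <= t by rewrite ler_pdivrMr// [t * _]mulrC.
  have I : 0 < (rs k)^-1 by rewrite invr_gt0.
  rewrite mulrDl mul1r in A; rewrite ler_distl.
  move: A B rk' I; set a := N / rs k; set b := (rs k)^-1; set e := _.+1%:R^-1.
  by move: a b e => a b e A B C I; apply/andP; split; lra.
have yk : \forall k \near U, chart_dom c1 (y k t) /\
   `|phi (y k t) - t *: X| <= e1 * (t * (`|X| + 1)) + k.+1%:R^-1 * (`|X| + 1 + t).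
  apply: filterS rx1 => k rxk; have [_ rk rk' nk hk] := Hs k; have [N1 N2] := Nt k.
  set N := Num.truncn (rs k * t) in N1 N2.
  have Nphi : N%:R * `|phi (xs k)| <= t * (`|X| + 1).
    apply: le_trans (ler_wpM2r (normr_ge0 _) N1) _.
    by rewrite mulrAC [_ * t]mulrC ler_wpM2l.
  have [|d h] := Hr (xs k) N nk.1.
    by apply: le_lt_trans t1; rewrite mulrA ler_wpM2r// ltW.
  split=> //; rewrite /y -/N.
  have -> : phi (xs k ^+ N)%g - t *: X = (phi (xs k ^+ N)%g - N%:R *: phi (xs k)) +
     ((N%:R / rs k - t) *: (rs k *: phi (xs k)) + t *: (rs k *: phi (xs k) - X)).
    by apply/rowP => j; rewrite !mxE; field; exact: lt0r_neq0.
  apply: le_trans (ler_normD _ _) _; apply: lerD.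
    by apply: le_trans h _; rewrite ler_wpM2l// ltW.
  apply: le_trans (ler_normD _ _) _; rewrite !normrZ mulrDr; apply: lerD.
    by apply: ler_pM => //; rewrite (gtr0_norm rk).
  by rewrite mulrC (ger0_norm t0) ler_wpM2r// ltW.
have cb := @compact_norm_le R n (ro / 2).
have [|u ub pu] := ultra_compact_lim (f := fun k => phi (y k t)) UU cb.
  have X10 : 0 < `|X| + 1 + t by rewrite ltr_wpDr.
  have h0 : 0 < ro / 2 - t * (`|X| + 1) * (1 + e1) by lra.
  have := inv0 _ (divr_gt0 h0 X10); apply: filterS2 yk => k [_ h].
  rewrite ltr_pdivlMr//; move: h; set i := k.+1%:R^-1; move: i => i h h'.
  rewrite /= -[phi _](subrK (t *: X)) (le_trans (ler_normD _ _))// normrZ (ger0_norm t0).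
  lra.
have [p [dp pp]] : exists x, chart_dom c1 x /\ phi x = u.
  by apply: Hro; apply: le_lt_trans ub _; lra.
(* The limit [u] taken in coordinates and the limit [f t] taken in the group agree, by continuity of
   the inverse chart and the Hausdorff property. *)
have fp : f t = p.
  apply: (@cvg_unique _ (@lie_hausdorff R G) (y^~ t @ U)); first by have [] := Hf t.
  have pE : chart_inv c1 (u + c1 1%g) = p by rewrite -pp /phi subrK mapK.
  have : (fun k => chart_inv c1 (phi (y k t) + c1 1%g)) @ U --> p.
    have cvD : (fun k => phi (y k t) + c1 1%g) @ U --> u + c1 1%g.
      exact: cvgD pu (cvg_cst _).
    rewrite -pE; apply: (@cvg_comp _ _ _ (fun k => phi (y k t) + c1 1%g) (chart_inv c1) U
      (nbhs (u + c1 1%g)) _ cvD).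
    by apply: cont_inv; rewrite -pp /phi subrK; exact: chart_codom_map.
  apply: cvg_trans; apply: near_eq_cvg; apply: filterS yk => k [dk _].
  by rewrite /phi subrK mapK.
rewrite /c t0 fp; split=> //; rewrite pp.
have -> : eps * t = e1 * (t * (`|X| + 1)) by rewrite /e1; field; exact: lt0r_neq0.
apply: (lim_norm_le _ pu) => eta eta0.
have tX0 : 0 < `|X| + 1 + t by rewrite ltr_wpDr.
have := inv0 _ (divr_gt0 eta0 tX0); apply: filterS2 yk => k [_ h] ke.
by apply: le_trans h _; rewrite lerD2l -ler_pdivlMr// ltW.
Qed.

End OneParameter.

(** * Regularity and uniqueness of one-parameter groups *)

Section LieAlgebraOfSubgroup.
Variables (R : realType) (G : lieGroupType R).
Local Notation n := (@lie_dim R G).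
Local Notation E := 'rV[R]_n.
Local Notation c1 := (@chart1 R G).
Local Notation e0 := (c1 1%g).
Implicit Types (x y z : G) (u v X Y : E) (K : set G) (c d : R -> G).

Lemma lie_algebra_tangent K X : lie_algebra K X -> tangent K X.
Proof.
move=> [c [c0 [e [e0 Hc sm DX]]]] eps ep0.
have dc : derivable (c1 \o c) (0 : R^o) 1.
  by have [_ /(_ 1)[+ _]] := sm 1%N; apply; rewrite inE /= normr0.
have dX : (fun h : R => h^-1 *: ((c1 \o c) (h *: (1 : R^o) + 0) - (c1 \o c) 0)) @ 0^' --> X.
  by rewrite -DX; exact: dc.
have X0 : 0 < `|X| + eps by rewrite ltr_wpDl.
have : \forall h \near 0^', `|X - h^-1 *: phi (c h)| < eps.
  move/cvgrPdist_lt: dX => /(_ _ ep0); apply: filterS => h.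
  by rewrite /= addr0 c0 [h *: _]mulr1.
move=> /nbhs_ballP[d /= d0 Hd].
pose h := Num.min (Num.min (d / 2) (e / 2)) (Num.min (eps / 2) (eps / 2 / (`|X| + eps))).
have h0 : 0 < h by rewrite !lt_min !divr_gt0.
have hd : h < d.
  have : h <= d / 2 by rewrite /h !ge_min lexx.
  by lra.
have he : h < e.
  have : h <= e / 2 by rewrite /h !ge_min lexx ?orbT.
  by lra.
have hp : h < eps.
  have : h <= eps / 2 by rewrite /h !ge_min lexx ?orbT.
  by lra.
have hX : h * (`|X| + eps) < eps.
  have : h <= eps / 2 / (`|X| + eps) by rewrite /h !ge_min lexx ?orbT.
  by rewrite ler_pdivlMr//; lra.
have [kc dch] : K (c h) /\ chart_dom c1 (c h) by apply: Hc; rewrite gtr0_norm.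
have ph : `|X - h^-1 *: phi (c h)| < eps.
  apply: Hd; last exact: lt0r_neq0.
  by rewrite -ball_normE /ball_ /= sub0r normrN gtr0_norm.
exists (c h), h^-1; split=> //; rewrite ?invr_gt0 ?invrK//; last by rewrite distrC.
split=> //; apply: le_lt_trans hX.
have -> : phi (c h) = h *: (h^-1 *: phi (c h)) by rewrite scalerA divff ?scale1r// lt0r_neq0.
rewrite normrZ gtr0_norm// ler_wpM2l ?ltW//.
by rewrite -[h^-1 *: _](subKr X) (le_lt_trans (ler_normB _ _))// ltrD2l.
Qed.

Lemma velocity_is_derive c X : c 0 = 1%g -> velocity c X ->
  is_derive (0 : R^o) 1 (c1 \o c : R^o -> E) X.
Proof.
move=> c0 vc.
suff H : (fun h : R => h^-1 *: ((c1 \o c) (h *: (1 : R^o) + 0) - (c1 \o c) 0)) @ 0^' --> X.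
  by apply: DeriveDef; [apply/cvg_ex; exists X|exact: cvg_lim].
apply/cvgrPdist_le => e ep0; have [d d0 Hd] := vc e ep0.
near=> h.
have h0 : h != 0 by near: h; exact: nbhs_dnbhs_neq.
have hd : `|h| < d by near: h; exact: dnbhs0_lt.
have [_ H] := Hd h hd; rewrite /= addr0 c0 [h *: _]mulr1 -/(phi (c h)).
have -> : X - h^-1 *: phi (c h) = - (h^-1 *: (phi (c h) - h *: X)).
  by apply/rowP => j; rewrite !mxE; field.
by rewrite normrN normrZ normfV ler_pdivrMl ?normr_gt0// mulrC.
Unshelve. all: by end_near. Qed.

Let F2 := frame_pair (frame_rV R n) (frame_rV R n).
Local Notation M := (mul_map c1 c1 c1).

(** The left-invariant vector field with value [X] at 1, read in the chart [c1]. *)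
Definition left_field X (u : E) : E := 'D_((0, X) : E * E) M (u, e0).

Lemma mul_dom_e0 u : chart_codom c1 u -> mul_dom c1 c1 c1 (u, e0).
Proof.
move=> cu; split=> //; first exact: codom1.
by rewrite /= (mapK (@dom1 R G)) mulg1; exact: chart_inv_dom.
Qed.

Lemma left_field_Ck k X : Ck k (chart_codom c1) (left_field X).
Proof.
have C := @mul_map_Ck R G k.+1 _ _ _ (@atlas1 R G) (@atlas1 R G) (@atlas1 R G).
have O := @mul_dom_open R G c1 c1 c1.
have [_ /(_ ((0, X) : E * E))[_ C']] := C.
apply: (Ck_comp F2 O (@chart_codom_open _ _ _ c1) mul_dom_e0 C').
apply: Ck_pair; [exact: chart_codom_open|exact: Ck_id|exact: Ck_cst].
Qed.

Lemma one_param_is_derive c X (d : R) : one_param c -> velocity c X ->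
  (forall t, `|t| < d -> chart_dom c1 (c t)) -> forall t : R^o, `|t| < d ->
  is_derive t 1 (c1 \o c : R^o -> E) (left_field X (c1 (c t))).
Proof.
move=> cD vc Hd t td.
have c0 := one_param0 cD.
have C := @mul_map_Ck R G 1 _ _ _ (@atlas1 R G) (@atlas1 R G) (@atlas1 R G).
have O := @mul_dom_open R G c1 c1 c1.
have dt := Hd t td.
have d0 : 0 < d by exact: le_lt_trans td.
have v0 := velocity_is_derive c0 vc.
have K : is_derive (0 : R^o) 1 (fun _ : R^o => c1 (c t)) 0 by exact: is_derive_cst.
have [dp ep] := is_derive_pair K v0.
have Ut : mul_dom c1 c1 c1 ((fun z : R^o => (c1 (c t), (c1 \o c) z)) 0).
  by rewrite /= c0; apply: mul_dom_e0; exact: chart_codom_map.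
have := C1_chain F2 O C Ut dp; rewrite ep /= c0 -/(left_field X _) => H.
have : is_derive (0 : R^o) 1 ((c1 \o c : R^o -> E) \o shift t) (left_field X (c1 (c t))).
  apply: near_eq_is_derive H.
  near=> s; rewrite /= /mul_map /= (mapK dt) mapK; last first.
    apply: Hd; near: s; have := @nbhs0_lt R R^o _ d0; exact.
  by rewrite addrC cD.
move=> [d1 d2]; rewrite /derivable /= in d1; rewrite /derive /= in d2.
have EE : (fun h : R => h^-1 *: (c1 (c (h *: (1 : R^o) + 0 + t)) - c1 (c (0 + t)))) =
  (fun h : R => h^-1 *: (c1 (c (h *: (1 : R^o) + t)) - c1 (c t))).
  by apply/funext => h; rewrite addr0 add0r.
by split; rewrite /derivable /derive /= -EE.
Unshelve. all: by end_near. Qed.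

(** Bootstrap: [c] is an integral curve of the smooth field [left_field X], so each order of
    differentiability of [c] yields the next. *)
Lemma one_param_smooth c X : one_param c -> velocity c X -> exists e : R,
  [/\ 0 < e, forall t, `|t| < e -> chart_dom c1 (c t),
      smooth [set t : R^o | `|t| < e] (c1 \o c) & 'D_1 (c1 \o c : R^o -> E) 0 = X].
Proof.
move=> cD vc; have [d d0 Hd] := vc 1 ltr01.
have Hd' t : `|t| < d -> chart_dom c1 (c t) by move=> /Hd[].
exists d; split=> //; last first.
  by have [_ ->] := velocity_is_derive (one_param0 cD) vc.
set I := [set t : R^o | _].
have oI : open I.
  apply: (@open_comp _ _ (fun t : R^o => `|t|) [set x | x < d]); last exact: open_lt.
  by move=> t _; exact: norm_continuous.
have dc := one_param_is_derive cD vc Hd'.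
have diffc (t : R^o) : I t -> differentiable (c1 \o c : R^o -> E) t.
  by move=> /dc[+ _] => /derivable1_diffP.
have cc : {in I, continuous (c1 \o c : R^o -> E)}.
  by move=> t; rewrite inE => /diffc /differentiable_continuous.
elim=> [|k IH]; first by split.
split=> // v; split; first by move=> t; rewrite inE => /diffc; exact: diff_derivable.
apply: (@Ck_ext _ _ _ _ _ (fun t => v *: left_field X (c1 (c t)))) => //.
  move=> t It; have [_ <-] := dc t It; rewrite !deriveE; [|exact: diffc|exact: diffc].
  by rewrite -linearZ /= [v *: (1 : R^o)]mulr1.
apply: (@Ck_linear_comp _ _ _ _ _ _ (fun u : E => v *: u)) => //.
  split; first by move=> a u w; rewrite scalerDr !scalerA mulrC.
  by exists (`|v| + 1); [rewrite ltr_wpDl|move=> u; rewrite normrZ ler_wpM2r// lerDl].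
apply: (Ck_comp (frame_rV R n) (@chart_codom_open _ _ _ c1) oI) (left_field_Ck k X) IH.
by move=> t /Hd'; exact: chart_codom_map.
Qed.

Lemma lie_algebraP K X : subgroup K -> compact K -> lie_algebra K X <->
  exists c, [/\ one_param c, forall t, K (c t) & velocity c X].
Proof.
move=> sK cK; split; first by move=> /lie_algebra_tangent; exact: tangent_exp.
move=> [c [cD Kc vc]]; exists c; split; first exact: one_param0.
have [e [e0 He sm DX]] := one_param_smooth cD vc.
by exists e; split=> // t /He dt; split.
Qed.

Lemma lie_algebra_tangentP K X : subgroup K -> compact K -> lie_algebra K X <-> tangent K X.
Proof.
move=> sK cK; split; first exact: lie_algebra_tangent.
by move=> /(tangent_exp sK cK) H; apply/lie_algebraP.
Qed.

Lemma telescope_le (V : normedModType R) (a : nat -> V) (b : R) N :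
  (forall j, (j < N)%N -> `|a j.+1 - a j| <= b) -> `|a N - a 0%N| <= N%:R * b.
Proof.
elim: N => [|N IH] H; first by rewrite subrr normr0 mul0r.
have -> : a N.+1 - a 0%N = (a N.+1 - a N) + (a N - a 0%N) by rewrite addrA subrK.
rewrite (le_trans (ler_normD _ _))// -natr1 mulrDl mul1r addrC lerD//; last exact: H.
by apply: IH => j jN; apply: H; exact: ltnW.
Qed.

Lemma velocity_near1 c X r : 0 < r -> velocity c X ->
  exists2 d, 0 < d & forall t, `|t| < d -> near1 r (c t).
Proof.
move=> r0 vc; have [d d0 Hd] := vc 1 ltr01.
have X1 : 0 < `|X| + 1 by rewrite ltr_wpDl.
exists (Num.min d (r / (`|X| + 1))); first by rewrite lt_min d0 divr_gt0.
move=> t; rewrite lt_min ltr_pdivlMr// => /andP[t1 t2]; have [dt ht] := Hd t t1.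
split=> //; apply: le_lt_trans t2; rewrite -[phi _](subrK (t *: X)).
by rewrite (le_trans (ler_normD _ _))// normrZ; lra.
Qed.

(** In the chart, [w s = c s * d (- s)] has increments of smaller order than the time step,
    uniformly near 0. Cutting a short time interval into many pieces gives [w t = 1] for small [t];
    divisibility of [t] extends this to all times. *)
Lemma one_param_unique c d X : one_param c -> one_param d -> velocity c X ->
  velocity d X -> forall t, c t = d t.
Proof.
move=> cD dD vc vd.
suff [r r0 H] : exists2 r, 0 < r & forall t, `|t| < r -> c t = d t.
  move=> t; set N := (Num.truncn (`|t| / r)).+1.
  have N0 : 0 < N%:R :> R by rewrite ltr0n.
  have tN : t = N%:R * (t / N%:R) by field; exact: lt0r_neq0.
  rewrite tN !one_paramX// H// normrM normfV (gtr0_norm N0) ltr_pdivrMr// -ltr_pdivrMl//.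
  by rewrite mulrC truncnS_gt.
have [r r0 Hr] := @phi_mul_strict R G _ ltr01.
have r40 : 0 < r / 4 by rewrite divr_gt0.
have [dc dc0 Hc] := velocity_near1 r40 vc; have [dd dd0 Hd] := velocity_near1 r40 vd.
exists (Num.min dc dd); first by rewrite lt_min dc0.
pose w s := (c s * d (- s))%g.
have w0 : w 0 = 1%g by rewrite /w oppr0 !one_param0// mulg1.
have near_r x : near1 (r / 4) x -> near1 r x by apply: near1_le; lra.
(* c(t+s) d(-t-s) = c(t) w(s) d(-t), where phi (w s) = o(s) *)
have wo eta : 0 < eta -> exists2 e, 0 < e & forall s, `|s| < e ->
    near1 (r / 4) (w s) /\ `|phi (w s)| <= eta * `|s|.
  move=> eta0; pose ep := Num.min 1 (eta / (4 + `|X|)).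
  have X4 : 0 < 4 + `|X| by rewrite ltr_pwDl.
  have ep0 : 0 < ep by rewrite lt_min ltr01 divr_gt0.
  have [r2 r20 H2] := @phi_mul_est R G _ ep0.
  have [e1 e10 He1] := vc _ ep0; have [e2 e20 He2] := vd _ ep0.
  have [e3 e30 He3] := velocity_near1 r20 vc; have [e4 e40 He4] := velocity_near1 r20 vd.
  exists (Num.min (Num.min (Num.min e1 e2) (Num.min e3 e4)) (r / 4 / eta)).
    by rewrite !lt_min e10 e20 e30 e40 !divr_gt0.
  move=> s; rewrite !lt_min => /andP[/andP[/andP[s1 s2] /andP[s3 s4]] s5].
  have [_ h1] := He1 s s1; have := He2 (- s); rewrite normrN => /(_ s2)[_ h2].
  have n3 := He3 s s3; have := He4 (- s); rewrite normrN => /(_ s4) n4.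
  have [dw hw] := H2 _ _ n3 n4.
  have pd : `|phi (d (- s))| <= `|s| * (`|X| + 1).
    rewrite -[phi _](subrK (- s *: X)) (le_trans (ler_normD _ _))//.
    rewrite normrZ normrN mulrDr mulr1 addrC lerD2l (le_trans h2)//.
    by rewrite ler_piMl// ge_min lexx.
  have pw : `|phi (w s)| <= eta * `|s|.
    have -> : phi (w s) = (phi (w s) - (phi (c s) + phi (d (- s)))) +
        ((phi (c s) - s *: X) + (phi (d (- s)) - - s *: X)).
      by rvring.
    have h3 : ep * `|phi (d (- s))| <= ep * (`|s| * (`|X| + 1)) by rewrite ler_wpM2l// ltW.
    apply: le_trans (ler_normD _ _) _.
    have := ler_normD (phi (c s) - s *: X) (phi (d (- s)) - - s *: X).
    have h4 : ep * (4 + `|X|) * `|s| <= eta * `|s|.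
      by rewrite ler_wpM2r// -ler_pdivlMr// ge_min lexx orbT.
    have := mulr_ge0 (ltW ep0) (normr_ge0 s).
    by rewrite /w in hw *; lra.
  split=> //; split=> //; apply: le_lt_trans pw _.
  by rewrite mulrC -ltr_pdivlMr.
move=> t; rewrite lt_min => /andP[tc td].
have step eta : 0 < eta -> exists2 e, 0 < e & forall s t, `|s| < e -> `|t| < dc -> `|t| < dd ->
    `|phi (w (t + s)) - phi (w t)| <= 4 * eta * `|s|.
  move=> eta0; have [e e_0 He] := wo eta eta0; exists e => // s {tc td}t se tc td.
  have [nw pw] := He s se; have nc := Hc t tc.
  have nd : near1 (r / 4) (d (- t)) by apply: Hd; rewrite normrN.
  have [dcw _ h1] := Hr (c t) (c t) (w s) 1%g (near_r _ nc) (near_r _ nc) (near_r _ nw) (near1_1 G r0).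
  rewrite mulg1 phi1 subr0 subrr normr0 !add0r mul1r in h1.
  have h2 : `|phi (c t * w s)%g - phi (c t)| <= 2 * `|phi (w s)|.
    rewrite -[_ - phi (c t)](subrK (phi (w s))) (le_trans (ler_normD _ _))//; lra.
  have ncw : near1 r (c t * w s)%g.
    split=> //; rewrite -[phi _](subrK (phi (c t))) (le_lt_trans (ler_normD _ _))//.
    by have [_ ?] := nw; have [_ ?] := nc; lra.
  have [_ _ h3] := Hr _ _ _ _ ncw (near_r _ nc) (near_r _ nd) (near_r _ nd).
  rewrite subrr normr0 !addr0 mul1r in h3.
  have -> : w (t + s) = (c t * w s * d (- t))%g.
    by rewrite /w opprD [- t - s]addrC cD dD !mulgA.
  rewrite -/(w t) in h3.
  have h4 := ler_normD (phi (c t * w s * d (- t))%g - phi (w t) - (phi (c t * w s)%g - phi (c t)))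
     (phi (c t * w s)%g - phi (c t)).
  by rewrite subrK in h4; lra.
have pw0 : phi (w t) = 0.
  apply/eqP; rewrite -normr_le0; apply/ler_addgt0Pr => e ep0; rewrite add0r.
  have t1 : 0 < 4 * (`|t| + 1) by rewrite mulr_gt0// ltr_wpDl.
  (* With this tolerance the increments add up to at most [e * (|t| / (|t| + 1))], which is at most
     [e]. *)
  have [del del0 Hdel] := step (e / (4 * (`|t| + 1))) (divr_gt0 ep0 t1).
  set N := (Num.truncn (`|t| / del)).+1.
  have N0 : 0 < N%:R :> R by rewrite ltr0n.
  have sN : `|t / N%:R| < del.
    rewrite normrM normfV (gtr0_norm N0) ltr_pdivrMr// -ltr_pdivrMl//.
    by rewrite mulrC truncnS_gt.
  have := @telescope_le _ (fun j => phi (w (j%:R * (t / N%:R)))) (4 * (e / (4 * (`|t| + 1))) * `|t / N%:R|) N.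
  rewrite mul0r w0 phi1 subr0.
  have -> : N%:R * (t / N%:R) = t by field; exact: lt0r_neq0.
  have -> : N%:R * (4 * (e / (4 * (`|t| + 1))) * `|t / N%:R|) = e * (`|t| / (`|t| + 1)).
    rewrite normrM normfV (gtr0_norm N0); field.
    by rewrite lt0r_neq0 ?ltr_wpDl//= lt0r_neq0.
  move=> h; apply: le_trans (h _) _ => [j jN|]; last first.
    by rewrite -[leRHS]mulr1 (ler_wpM2l (ltW ep0))// ler_pdivrMr ?mul1r ?ltr_wpDl// lerDl.
  rewrite -natr1 mulrDl mul1r.
  have jt : `|j%:R * (t / N%:R)| <= `|t|.
    rewrite mulrCA normrM ler_piMr// normrM normfV ger0_norm// gtr0_norm//.
    by rewrite ler_pdivrMr// mul1r ler_nat ltnW.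
  by apply: Hdel => //; exact: le_lt_trans jt _.
have dw : chart_dom c1 (w t).
  have nc := Hc t tc; have nd : near1 (r / 4) (d (- t)) by apply: Hd; rewrite normrN.
  by have [] := Hr _ _ _ _ (near_r _ nc) (near_r _ nc) (near_r _ nd) (near_r _ nd).
have : w t = 1%g by apply: phi_inj => //; [exact: dom1|rewrite phi1].
by rewrite /w one_paramN// => /divg1_eq.
Qed.

End LieAlgebraOfSubgroup.

(** * The adjoint representation *)

Section StrictDerivatives.
Variable R : realType.
Implicit Types V W Z : normedModType R.

Lemma sdiff_comp V W Z (f : V -> W) (g : Z -> V) x L L' : linear_bounded L ->
  linear_bounded L' -> sdiff f (g x) L -> sdiff g x L' ->
  sdiff (f \o g) x (L \o L').
Proof.
move=> lL lL' sf sg e e0; have [_ [C C0 LC]] := lL; have [_ [C' C'0 LC']] := lL'.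
have D0 : 0 < C' + 1 + C by rewrite !addr_gt0.
pose ep := Num.min 1 (e / (C' + 1 + C)).
have ep0 : 0 < ep by rewrite lt_min ltr01 divr_gt0.
have [d d0 Hd] := sf ep ep0; have [d' d'0 Hd'] := sg ep ep0.
have lip y z : `|y - x| < d' -> `|z - x| < d' -> `|g y - g z| <= (C' + 1) * `|y - z|.
  move=> h1 h2; rewrite -[g y - g z](subrK (L' (y - z))) (le_trans (ler_normD _ _))//.
  have := Hd' y z h1 h2; have : ep * `|y - z| <= 1 * `|y - z|.
    by rewrite ler_wpM2r// ge_min lexx.
  by have := LC' (y - z); lra.
have C10 : 0 < C' + 1 by rewrite addr_gt0.
exists (Num.min d' (d / (C' + 1))); first by rewrite lt_min d'0 divr_gt0.
move=> y z; rewrite !lt_min !ltr_pdivlMr// => /andP[y1 y2] /andP[z1 z2].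
have xx : `|x - x| < d' by rewrite subrr normr0.
have gy : `|g y - g x| < d by apply: le_lt_trans (lip y x y1 xx) _; rewrite mulrC.
have gz : `|g z - g x| < d by apply: le_lt_trans (lip z x z1 xx) _; rewrite mulrC.
have h1 := Hd _ _ gy gz; have h2 := Hd' _ _ y1 z1.
have -> : (f \o g) y - (f \o g) z - (L \o L') (y - z) =
  (f (g y) - f (g z) - L (g y - g z)) + L (g y - g z - L' (y - z)).
  by rewrite (linear_boundedB (g y - g z) (L' (y - z)) lL) addrA subrK.
apply: le_trans (ler_normD _ _) _.
have h3 : ep * `|g y - g z| <= ep * ((C' + 1) * `|y - z|).
  by rewrite ler_wpM2l ?lip// ltW.
have h4 := le_trans (LC _) (ler_wpM2l (ltW C0) h2).
have h5 : ep * (C' + 1 + C) * `|y - z| <= e * `|y - z|.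
  by rewrite ler_wpM2r// -ler_pdivlMr// ge_min lexx orbT.
by move: h1 h3 h4 h5; rewrite /=; lra.
Qed.

Lemma sdiff_ext V W (f g : V -> W) x L : (\forall y \near x, f y = g y) ->
  sdiff f x L -> sdiff g x L.
Proof.
move=> /nbhs_ballP[r /= r0 H] sf e e0; have [d d0 Hd] := sf e e0.
exists (Num.min d r); first by rewrite lt_min d0.
move=> y z; rewrite !lt_min => /andP[y1 y2] /andP[z1 z2].
rewrite -!H; first exact: Hd.
  by rewrite -ball_normE /ball_ /= distrC.
by rewrite -ball_normE /ball_ /= distrC.
Qed.

Lemma sdiff_derive V W (f : V -> W) x L v : linear_bounded L -> sdiff f x L ->
  'D_v f x = L v.
Proof.
move=> lL sf; have [_ /=] := sdiff_is_derive (g := id) (v := v) lL sf (@derivable_id _ _ x v).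
by rewrite derive_id.
Qed.

Lemma linear_bounded_comp V W Z (L : V -> W) (L' : Z -> V) : linear_bounded L ->
  linear_bounded L' -> linear_bounded (L \o L').
Proof.
move=> lL [a' [C' C'0 h']]; have [a [C C0 h]] := lL; split.
  by move=> b u v; rewrite /= a' a.
exists (C * C'); first by rewrite mulr_gt0.
by move=> v; rewrite /= -mulrA (le_trans (h _))// (ler_wpM2l (ltW C0)).
Qed.

Lemma pairl_linear_bounded V W : linear_bounded (fun u : V => (u, 0) : V * W).
Proof.
split; first by move=> a u v; apply/pair_equal_spec; rewrite /= scaler0 addr0.
by exists 1 => // v; rewrite mul1r; apply: pair_norm_le; rewrite //= normr0.
Qed.

Lemma pairr_linear_bounded V W : linear_bounded (fun u : W => (0, u) : V * W).
Proof.
split; first by move=> a u v; apply/pair_equal_spec; rewrite /= scaler0 addr0.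
by exists 1 => // v; rewrite mul1r; apply: pair_norm_le; rewrite //= normr0.
Qed.

Lemma pairl_sdiff V W (w : W) x : sdiff (fun u : V => (u, w)) x (fun u => (u, 0)).
Proof.
move=> e e0; exists 1 => // y z _ _.
rewrite (_ : _ - _ - _ = 0) ?normr0 ?mulr_ge0// ?ltW//.
by apply/pair_equal_spec; rewrite /= !subrr.
Qed.

Lemma pairr_sdiff V W (w : V) x : sdiff (fun u : W => (w, u)) x (fun u => (0, u)).
Proof.
move=> e e0; exists 1 => // y z _ _.
rewrite (_ : _ - _ - _ = 0) ?normr0 ?mulr_ge0// ?ltW//.
by apply/pair_equal_spec; rewrite /= !subrr.
Qed.

Lemma pairr_continuous V W (w : V) x : {for x, continuous (fun u : W => (w, u))}.
Proof.
apply: (Ck_continuous (k := 0) (U := setT)) => //; apply: Ck_pair; first exact: openT.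
  exact: Ck_cst.
exact: Ck_id.
Qed.

Lemma pairl_continuous V W (w : W) x : {for x, continuous (fun u : V => (u, w))}.
Proof.
apply: (Ck_continuous (k := 0) (U := setT)) => //; apply: Ck_pair; first exact: openT.
  exact: Ck_id.
exact: Ck_cst.
Qed.

Lemma open_setI_comp (T T' : topologicalType) (A : set T) (B : set T') (f : T -> T') :
  open A -> open B -> (forall x, A x -> {for x, continuous f}) ->
  open (A `&` f @^-1` B).
Proof.
move=> oA oB cf; rewrite openE => x [Ax Bfx]; apply: filterI.
  exact: open_nbhs_nbhs.
exact: (cf x Ax) (open_nbhs_nbhs (conj oB Bfx)).
Qed.

End StrictDerivatives.

Section Adjoint.
Variables (R : realType) (G : lieGroupType R).
Local Notation n := (@lie_dim R G).
Local Notation E := 'rV[R]_n.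
Local Notation c1 := (@chart1 R G).
Local Notation e0 := (c1 1%g).
Local Notation M := (mul_map c1 c1 c1).
Local Notation inv1 := (inv_map c1 c1).
Implicit Types (x y z : G) (u v X Y : E) (K : set G) (c d : R -> G).
Let F1 := frame_rV R n.
Let F2 := frame_pair F1 F1.

Definition Ad x Y : E := 'D_Y (fun v => c1 (x * chart_inv c1 v * x^-1)%g : E) e0.

(** For [x] far from 1 the intermediate products leave the chart at 1: conjugation is factored as
    left multiplication into a chart at [x], followed by right multiplication with [x^-1], which
    comes back to the chart at 1. *)
Lemma conj_sdiff x : linear_bounded (Ad x) /\
  sdiff (fun v => c1 (x * chart_inv c1 v * x^-1)%g) e0 (Ad x).
Proof.
pose cx := chart_at x; pose cy := chart_at (x^-1)%g.
have dx : chart_dom cx x by exact: chart_at_dom.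
have dy : chart_dom cy (x^-1)%g by exact: chart_at_dom.
have ax : atlas cx by exact: chart_at_atlas.
have ay : atlas cy by exact: chart_at_atlas.
have CA := @mul_map_Ck R G 1 _ _ _ ax (@atlas1 R G) ax.
have CB := @mul_map_Ck R G 1 _ _ _ ax ay (@atlas1 R G).
have UA : mul_dom cx c1 cx (cx x, e0).
  split; [exact: chart_codom_map|exact: codom1|].
  by rewrite /= (mapK dx) (mapK (@dom1 R G)) mulg1.
have UB : mul_dom cx cy c1 (cx x, cy x^-1%g).
  split; [exact: chart_codom_map|exact: chart_codom_map|].
  by rewrite /= (mapK dx) (mapK dy) mulgV; exact: dom1.
have [lA sA] := C1_sdiff F2 (@mul_dom_open R G _ _ _) CA UA.
have [lB sB] := C1_sdiff F2 (@mul_dom_open R G _ _ _) CB UB.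
have s1 := sdiff_comp lA (pairr_linear_bounded _ _) sA (@pairr_sdiff _ _ _ (cx x) e0).
have l1 := linear_bounded_comp lA (pairr_linear_bounded _ _).
have l2 := linear_bounded_comp lB (pairl_linear_bounded _ _).
have Ex : (mul_map cx c1 cx \o (fun u => (cx x, u))) e0 = cx x.
  by rewrite /= /mul_map /= (mapK dx) (mapK (@dom1 R G)) mulg1.
have s2 : sdiff (mul_map cx cy c1 \o (fun u => (u, cy x^-1%g)))
    ((mul_map cx c1 cx \o (fun u => (cx x, u))) e0)
    (derive (mul_map cx cy c1) (cx x, cy x^-1%g) \o (fun u => (u, 0))).
  by rewrite Ex; exact: (sdiff_comp lB (pairl_linear_bounded _ _) sB (@pairl_sdiff _ _ _ _ _)).
have s3 := sdiff_comp l2 l1 s2 s1; have l3 := linear_bounded_comp l2 l1.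
have s4 : sdiff (fun v => c1 (x * chart_inv c1 v * x^-1)%g) e0
  ((derive (mul_map cx cy c1) (cx x, cy x^-1%g) \o (fun u => (u, 0))) \o
   (derive (mul_map cx c1 cx) (cx x, e0) \o (fun u => (0, u)))).
  apply: sdiff_ext s3.
  have cp := @pairr_continuous _ E E (cx x) e0.
  have : nbhs e0 ((fun v : E => (cx x, v)) @^-1` mul_dom cx c1 cx) :=
    cp _ (open_nbhs_nbhs (conj (@mul_dom_open R G cx c1 cx) UA)).
  apply: filterS => v [cu cv d]; rewrite /= /mul_map /= (mapK dy) (mapK d).
  by rewrite (mapK dx).
have EA : Ad x = (derive (mul_map cx cy c1) (cx x, cy x^-1%g) \o (fun u => (u, 0))) \o
   (derive (mul_map cx c1 cx) (cx x, e0) \o (fun u => (0, u))).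
  by apply/funext => Y; rewrite /Ad (sdiff_derive _ l3 s4).
by rewrite EA.
Qed.

Lemma Ad_linear x : linear_bounded (Ad x). Proof. by have [] := conj_sdiff x. Qed.

Lemma is_derive_velocity c X : c 0 = 1%g -> (exists2 d, 0 < d & forall t, `|t| < d -> chart_dom c1 (c t)) ->
  is_derive (0 : R^o) 1 (c1 \o c : R^o -> E) X -> velocity c X.
Proof.
move=> c0 [d d0 Hd] [dc DX] eps ep0.
have dX : (fun h : R => h^-1 *: ((c1 \o c) (h *: (1 : R^o) + 0) - (c1 \o c) 0)) @ 0^' --> X.
  by rewrite -DX; exact: dc.
have : \forall h \near 0^', `|X - h^-1 *: phi (c h)| <= eps.
  move/cvgrPdist_le: dX => /(_ _ ep0); apply: filterS => h.
  by rewrite /= addr0 c0 [h *: _]mulr1.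
move=> /nbhs_ballP[d' /= d'0 Hd'].
exists (Num.min d d'); first by rewrite lt_min d0.
move=> t; rewrite lt_min => /andP[t1 t2]; split; first exact: Hd.
have [->|tN] := eqVneq t 0; first by rewrite c0 phi1 scale0r subrr !normr0 mulr0.
have := Hd' t; rewrite -ball_normE /ball_ /= sub0r normrN => /(_ t2 tN).
have -> : phi (c t) - t *: X = - (t *: (X - t^-1 *: phi (c t))).
  by apply/rowP => j; rewrite !mxE; field.
by rewrite normrN normrZ mulrC => h; rewrite ler_wpM2r.
Qed.

Lemma velocity_unique c X Y : one_param c -> velocity c X -> velocity c Y -> X = Y.
Proof.
move=> cD vX vY; have c0 := one_param0 cD.
by have [_ <-] := velocity_is_derive c0 vX; have [_ <-] := velocity_is_derive c0 vY.
Qed.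

Lemma conj_one_param c x : one_param c -> one_param (fun t => x * c t * x^-1)%g.
Proof. by move=> cD s t; rewrite cD !mulgA mulgVK. Qed.

Lemma one_param_continuous0 c X : one_param c -> velocity c X -> {for (0 : R), continuous c}.
Proof.
move=> cD vc A; rewrite one_param0// => /nbhs_near1[r r0 HA].
have [d d0 Hd] := velocity_near1 r0 vc; apply/nbhs_ballP; exists d => // t.
by rewrite -ball_normE /ball_ /= sub0r normrN => /Hd; exact: HA.
Qed.

Lemma Ad_velocity c x Y : one_param c -> velocity c Y ->
  velocity (fun t => x * c t * x^-1)%g (Ad x Y).
Proof.
move=> cD vc; have c0 := one_param0 cD.
have [d1 e1] := velocity_is_derive c0 vc.
have [lA sA] := conj_sdiff x.
have sA' : sdiff (fun v => c1 (x * chart_inv c1 v * x^-1)%g) ((c1 \o c : R^o -> E) 0) (Ad x).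
  by rewrite /= c0.
have H := sdiff_is_derive lA sA' d1; rewrite e1 in H.
have [d d0 Hd] := vc 1 ltr01.
apply: is_derive_velocity; first by rewrite c0 mulg1 mulgV.
  have cc : {for (0 : R), continuous (fun t => x * c t * x^-1)%g}.
    apply: continuous_mulg; last exact: cst_continuous.
    apply: continuous_mulg; first exact: cst_continuous.
    exact: one_param_continuous0 vc.
  have := cc (chart_dom c1); rewrite c0 mulg1 mulgV => /(_ (dom_nbhs (@dom1 R G))).
  move=> /nbhs_ballP[r /= r0 Hr]; exists r => // t tr; apply: Hr.
  by rewrite -ball_normE /ball_ /= sub0r normrN.
apply: near_eq_is_derive H; apply/nbhs_ballP; exists d => // t.
rewrite -ball_normE /ball_ /= sub0r normrN => /Hd[dt _].
by rewrite mapK.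
Qed.

Lemma subgroupT : subgroup [set: G]. Proof. by []. Qed.

(** The exponential map, from [tangent_exp] with [K] all of [G]: the point with coordinates
    [s^-1 *: X] is a tangent witness for [X] when [s] is large. *)
Lemma exp_exists X : compact [set: G] -> exists c, one_param c /\ velocity c X.
Proof.
move=> cG; suff /(tangent_exp subgroupT cG)[c [? _ ?]] : tangent [set: G] X by exists c.
move=> eps ep0; have [r r0 Hr] := @phi_surj R G.
have X0 : 0 < `|X| + 1 by rewrite ltr_wpDl.
(* The three summands enforce, in this order, [s^-1 < eps], membership of [s^-1 *: X] in the image
   of the chart, and [near1 eps]. *)
pose s := (eps / 2)^-1 + (`|X| + 1) / r + (`|X| + 1) / eps.
have e20 : 0 < eps / 2 by rewrite divr_gt0.
have s0 : 0 < s by rewrite !addr_gt0// ?invr_gt0// divr_gt0.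
have p1 : 0 < (`|X| + 1) / r by rewrite divr_gt0.
have p2 : 0 < (`|X| + 1) / eps by rewrite divr_gt0.
have p3 : 0 < (eps / 2)^-1 by rewrite invr_gt0.
have nX : `|s^-1 *: X| = s^-1 * `|X| by rewrite normrZ gtr0_norm// invr_gt0.
have [|x [dx px]] := Hr (s^-1 *: X).
  rewrite nX ltr_pdivrMl// -ltr_pdivrMr//.
  have : `|X| / r < (`|X| + 1) / r by rewrite ltr_pM2r ?invr_gt0// ltrDl.
  by rewrite /s; lra.
exists x, s; split=> //; last by rewrite px scalerA divff ?lt0r_neq0// scale1r subrr normr0.
  have : s^-1 <= eps / 2 by rewrite -[leRHS]invrK lef_pV2 ?posrE//; rewrite /s; lra.
  by lra.
split=> //; rewrite px nX ltr_pdivrMl// -ltr_pdivrMr//.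
have : `|X| / eps < (`|X| + 1) / eps by rewrite ltr_pM2r ?invr_gt0// ltrDl.
by rewrite /s; lra.
Qed.

Hypothesis cG : compact [set: G].

(** Both sides are the velocity of the same conjugate of a one-parameter group with velocity [Z],
    and velocities are unique. *)
Lemma AdM x y Z : Ad (x * y)%g Z = Ad x (Ad y Z).
Proof.
have [c [cD vc]] := exp_exists Z cG.
have h1 := Ad_velocity y cD vc; have cD1 := conj_one_param y cD.
have h2 := Ad_velocity x cD1 h1; have h3 := Ad_velocity (x * y)%g cD vc.
apply: (velocity_unique (conj_one_param (x * y)%g cD) h3).
have <- : (fun t => x * (y * c t * y^-1) * x^-1)%g = (fun t => x * y * c t * (x * y)^-1)%g.
  by apply/funext => t; rewrite invgM !mulgA.
exact: h2.
Qed.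

Lemma Ad1 Z : Ad 1%g Z = Z.
Proof.
have [c [cD vc]] := exp_exists Z cG.
have := Ad_velocity 1%g cD vc; under eq_fun do rewrite invg1 mulg1 mul1g.
by move=> h; exact: velocity_unique h vc.
Qed.

Lemma AdVK x Z : Ad x^-1%g (Ad x Z) = Z.
Proof. by rewrite -AdM mulVg Ad1. Qed.

Lemma Ad_fixed_commute c x Z : one_param c -> velocity c Z -> Ad x Z = Z ->
  forall t, (x * c t * x^-1 = c t)%g.
Proof.
move=> cD vc AZ; apply: (one_param_unique (X := Z)) => //; first exact: conj_one_param.
by rewrite -[X in velocity _ X]AZ; exact: Ad_velocity.
Qed.

Lemma commute_Ad_fixed c x Z : one_param c -> velocity c Z ->
  (forall t, commute x (c t)) -> Ad x Z = Z.
Proof.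
move=> cD vc H; have := Ad_velocity x cD vc.
under eq_fun do rewrite H mulgK.
by move=> h; exact: velocity_unique h vc.
Qed.

Definition conj_map (p : E * E) : E :=
  c1 (chart_inv c1 p.1 * chart_inv c1 p.2 * (chart_inv c1 p.1)^-1)%g.

Lemma conj_map_Ck : exists W : set (E * E), [/\ open W, W (e0, e0) &
  forall k, Ck k W conj_map].
Proof.
pose W1 := mul_dom c1 c1 c1 `&` (@fst E E) @^-1` (inv_dom c1 c1).
have oW1 : open W1.
  apply: open_setI_comp; [exact: mul_dom_open|exact: inv_dom_open|].
  by move=> p _; exact: cvg_fst.
pose q (p : E * E) := (M p, inv1 p.1).
have Cq k : Ck k W1 q.
  apply: Ck_pair => //.
    by apply: Ck_mono (mul_map_Ck k (@atlas1 R G) (@atlas1 R G) (@atlas1 R G)) => p [].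
  apply: (Ck_comp F1 (@inv_dom_open R G c1 c1) oW1 (f := inv1) (g := @fst E E)).
  - by move=> p [].
  - by apply: inv_map_Ck; exact: atlas1.
  - apply: Ck_bounded_linear => //; split; first by [].
    by exists 1 => // v; rewrite mul1r ler_fst.
pose W := W1 `&` q @^-1` (mul_dom c1 c1 c1).
have oW : open W.
  apply: (@open_setI_comp _ _ W1 (mul_dom c1 c1 c1) q oW1 (@mul_dom_open R G c1 c1 c1)).
  by move=> p Wp; apply: (Ck_continuous (Cq 0%N)).
have qe : q (e0, e0) = (e0, e0).
  by rewrite /q /mul_map /inv_map /= (mapK (@dom1 R G)) mulg1 invg1.
exists W; split=> //.
  split; last by rewrite /= qe; exact: mul_dom11.
  split; first exact: mul_dom11.
  split=> /=; first exact: codom1.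
  by rewrite (mapK (@dom1 R G)) invg1; exact: dom1.
move=> k; apply: (@Ck_ext _ _ _ _ _ (fun p => M (q p))) => //; last first.
  apply: (Ck_comp F2 (@mul_dom_open R G c1 c1 c1) oW (f := M) (g := q)).
  - by move=> p [].
  - by apply: mul_map_Ck; exact: atlas1.
  - by apply: Ck_mono (Cq k) => p [].
move=> p [[[h1 h2 h3] [h4 h5]] _].
by rewrite /q /conj_map {1}/mul_map /= /mul_map /inv_map (mapK h3) (mapK h5).
Qed.

(** [Ad] at the point with chart coordinate [u] is the derivative of conjugation in its second
    variable; joint smoothness of conjugation makes this smooth in [u]. *)
Lemma Ad_chart_Ck Y : exists U : set E, [/\ open U, U e0 &
  forall k, Ck k U (fun u => Ad (chart_inv c1 u) Y)].
Proof.
have [W [oW W0 CW]] := conj_map_Ck.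
pose U := (fun u : E => (u, e0)) @^-1` W.
have oU : open U.
  by apply: open_comp => // u _; exact: pairl_continuous.
exists U; split=> // k.
have [_ /(_ ((0, Y) : E * E))[_ C]] := CW k.+1.
apply: (@Ck_ext _ _ _ _ _ (fun u => 'D_((0, Y) : E * E) conj_map (u, e0))) => //; last first.
  apply: (Ck_comp F2 oW oU (f := derive conj_map ^~ ((0, Y) : E * E)) (g := fun u => (u, e0))) => //.
  by apply: Ck_pair => //; [exact: Ck_id|exact: Ck_cst].
move=> u Wu.
have I : is_derive e0 Y (@id E) Y by apply: is_derive_id.
have Ku : is_derive e0 Y (fun _ : E => u) 0 by apply: is_derive_cst.
have [dp ep] := is_derive_pair Ku I.
have [_] := @C1_chain _ _ _ _ F2 W conj_map (fun v : E => (u, v)) e0 Y oW (CW 1%N) Wu dp.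
by rewrite ep => <-.
Qed.

Lemma Ad_chart_sdiff Y : linear_bounded (fun X => lie_bracket X Y) /\
  sdiff (fun u => Ad (chart_inv c1 u) Y) e0 (fun X => lie_bracket X Y).
Proof.
have [U [oU U0 CU]] := Ad_chart_Ck Y.
exact: (C1_sdiff F1 oU (CU 1%N) U0).
Qed.

Lemma Ad_is_derive0 c X Y : one_param c -> velocity c X ->
  is_derive (0 : R^o) 1 (fun t : R^o => Ad (c t) Y) (lie_bracket X Y).
Proof.
move=> cD vc; have c0 := one_param0 cD.
have [d1 e1] := velocity_is_derive c0 vc.
have [lA sA] := Ad_chart_sdiff Y.
have sA' : sdiff (fun u => Ad (chart_inv c1 u) Y) ((c1 \o c : R^o -> E) 0) (fun X => lie_bracket X Y).
  by rewrite /= c0.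
have := sdiff_is_derive lA sA' d1; rewrite e1; apply: near_eq_is_derive.
have [d d0 Hd] := vc 1 ltr01.
apply/nbhs_ballP; exists d => // t.
rewrite -ball_normE /ball_ /= sub0r normrN => /Hd[dt _].
by rewrite mapK.
Qed.

(** The derivative at 0 is transported by the identity [Ad (c (t + h)) = Ad (c t) \o Ad (c h)]. *)
Lemma Ad_is_derive c X Y t : one_param c -> velocity c X ->
  is_derive (t : R^o) 1 (fun t : R^o => Ad (c t) Y) (Ad (c t) (lie_bracket X Y)).
Proof.
move=> cD vc; have [d1 e1] := Ad_is_derive0 Y cD vc.
have [] := is_derive_linear_comp (Ad_linear (c t)) d1; rewrite e1.
rewrite /derivable /derive /= => d2 e2.
have EE : (fun h : R => h^-1 *: (Ad (c t) (Ad (c (h *: (1 : R^o) + 0)) Y) - Ad (c t) (Ad (c 0) Y))) =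
  (fun h : R => h^-1 *: (Ad (c (h *: (1 : R^o) + t)) Y - Ad (c t) Y)).
  by apply/funext => h; rewrite addr0 -!AdM -!cD addr0 [t + _]addrC.
by split; rewrite /derivable /derive /= -EE.
Qed.

Lemma lie_bracket_linearl Y : linear_bounded (fun X => lie_bracket X Y).
Proof. by have [] := Ad_chart_sdiff Y. Qed.

Lemma lie_bracket_linearr X a Y Z :
  lie_bracket X (a *: Y + Z) = a *: lie_bracket X Y + lie_bracket X Z.
Proof.
have [c [cD vc]] := exp_exists X cG.
have [_ <-] := Ad_is_derive0 (a *: Y + Z) cD vc.
have [dp ep] := is_derive_pair (Ad_is_derive0 Y cD vc) (Ad_is_derive0 Z cD vc).
have lL : linear_bounded (fun p : E * E => a *: p.1 + p.2).
  split=> [b u v|].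
    by rewrite /= !scalerDr !scalerA [a * b]mulrC addrACA.
  exists (`|a| + 1); first by rewrite ltr_wpDl.
  move=> v; rewrite (le_trans (ler_normD _ _))// normrZ mulrDl mul1r lerD ?ler_snd//.
  by rewrite ler_wpM2l// ler_fst.
have [_] := is_derive_linear_comp lL dp; rewrite ep /= => <-.
have -> // : (fun t : R^o => Ad (c t) (a *: Y + Z)) = (fun t => a *: Ad (c t) Y + Ad (c t) Z).
by apply/funext => t; rewrite (Ad_linear _).1.
Qed.

Lemma Ad_continuous Y x : {for x, continuous (Ad ^~ Y)}.
Proof.
have c1c : {for (1%g : G), continuous (Ad ^~ Y)}.
  have [U [oU U0 CU]] := Ad_chart_Ck Y.
  have cu := Ck_continuous (CU 0%N) U0.
  have : {for (1%g : G), continuous ((fun u => Ad (chart_inv c1 u) Y) \o c1)}.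
    by apply: (@continuous_comp _ _ _ c1); [apply: cont_map; exact: dom1|].
  rewrite /continuous_at /prop_for /= (mapK (@dom1 R G)); apply: cvg_trans.
  apply: near_eq_cvg; apply: filterS (dom_nbhs (@dom1 R G)) => y dy.
  by rewrite /= mapK.
have cx : {for x, continuous (fun y => Ad (x^-1 * y)%g Y)}.
  apply: (@continuous_comp _ _ _ (fun y => (x^-1 * y)%g) (Ad ^~ Y)).
    by apply: continuous_mulg; [exact: cst_continuous|exact: cvg_id].
  by rewrite mulVg.
have <- : Ad x \o (fun y => Ad (x^-1 * y)%g Y) = Ad ^~ Y.
  by apply/funext => y; rewrite /= -AdM mulVKg.
apply: (@continuous_comp _ _ _ (fun y => Ad (x^-1 * y)%g Y) (Ad x) x cx).
exact: linear_bounded_continuous (Ad_linear x) _.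
Qed.

End Adjoint.

(** * Subspaces of a finite-dimensional space *)

Section FiniteDimension.
Variables (R : realType) (n : nat).
Local Notation E := 'rV[R]_n.
Implicit Types (k : {vspace E}).

Lemma linear_rV_le (W : normedModType R) (L : E -> W) v :
  (forall a u v, L (a *: u + v) = a *: L u + L v) ->
  `|L v| <= (\sum_(i < n) `|L (delta_mx 0 i)|) * `|v|.
Proof.
move=> lin; have L0 : L 0 = 0.
  have := lin (-1) 0 0; rewrite scaler0 addr0 scaleN1r => /eqP.
  by rewrite addNr => /eqP.
have Ls (I : Type) (r : seq I) (f : I -> R) (g : I -> E) :
    L (\sum_(i <- r) f i *: g i) = \sum_(i <- r) f i *: L (g i).
  by elim: r => [|i r IH]; rewrite ?big_nil// !big_cons lin IH.
rewrite [in leLHS](row_sum_delta v) Ls (le_trans (ler_norm_sum _ _ _))//.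
rewrite mulr_suml; apply: ler_sum => i _.
by rewrite normrZ mulrC ler_wpM2l// ler_mx_entry.
Qed.

Lemma linear_bounded_rV (W : normedModType R) (L : E -> W) :
  (forall a u v, L (a *: u + v) = a *: L u + L v) -> linear_bounded L.
Proof.
move=> lin; split=> //; exists (1 + \sum_(i < n) `|L (delta_mx 0 i)|).
  by rewrite ltr_wpDr// sumr_ge0.
by move=> v; rewrite mulrDl mul1r ler_wpDl// linear_rV_le.
Qed.

(** A subspace of maximal dimension among those inside [S] exhausts [S], as a vector left out would
    enlarge it. *)
Lemma vspace_of_linear_set (S : set E) : S 0 ->
  (forall a u v, S u -> S v -> S (a *: u + v)) -> exists k, [set` k] = S.
Proof.
move=> S0 lin.
pose P d := `[< exists k, [set` k] `<=` S /\ \dim k = d >].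
have exP : exists d, P d.
  exists 0%N; apply/asboolP; exists 0%VS; split; last exact: dimv0.
  by move=> u /=; rewrite memv0 => /eqP ->.
have ubP d : P d -> (d <= \dim {:E})%N.
  by move=> /asboolP[k [_ <-]]; apply: dimvS; exact: subvf.
case: (ex_maxnP exP ubP) => d /asboolP[k [kS dk]] dmax.
exists k; apply/seteqP; split=> // u Su /=; apply: contrapT => /negP uk.
have : (\dim (k + <[u]>) <= d)%N.
  apply: dmax; apply/asboolP; exists (k + <[u]>)%VS; split=> //.
  move=> v /= /memv_addP[w wk [x /vlineP[a ->] ->]].
  by rewrite addrC; apply: lin => //; exact: kS.
rewrite -dk leqNgt => /negP; apply.
rewrite ltnNge; apply/negP => le.
have : (k == k + <[u]>)%VS by rewrite eqEdim addvSl le.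
move=> /eqP kk; move: uk; rewrite kk => /negP; apply.
by rewrite (subvP (addvSr k <[u]>)) ?memv_line.
Qed.

(** A linear map with kernel [k]: membership in [k] becomes the vanishing of a norm, accessible to
    limits and differential inequalities. *)
Definition coproj k (u : E) : E := u - projv k u.

Lemma coproj_linear_bounded k : linear_bounded (coproj k).
Proof.
apply: linear_bounded_rV => a u v.
by rewrite /coproj linearD linearZ /= scalerBr opprD addrACA.
Qed.

Lemma coproj_eq0 k u : (coproj k u == 0) = (u \in k).
Proof.
apply/idP/idP => [|uk]; last by rewrite /coproj projv_id ?subrr.
by rewrite subr_eq0 => /eqP ->; exact: memv_proj.
Qed.

Lemma vspace_approx k X : (forall e, 0 < e -> exists2 Y, Y \in k & `|X - Y| <= e) -> X \in k.
Proof.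
move=> H; have lq := coproj_linear_bounded k; have [_ [C C0 qC]] := lq.
rewrite -coproj_eq0 -normr_le0; apply/ler_addgt0Pr => e e0; rewrite add0r.
have [Y Yk XY] := H _ (divr_gt0 e0 C0).
have qY : coproj k Y = 0 by apply/eqP; rewrite coproj_eq0.
rewrite -[coproj k X]subr0 -qY -linear_boundedB// (le_trans (qC _))//.
by rewrite mulrC -ler_pdivlMr.
Qed.

Lemma vspace_closed k : closed [set` k].
Proof.
have -> : [set` k] = (fun u => `|coproj k u|) @^-1` [set x | x <= 0].
  by apply/seteqP; split=> u /=; rewrite -coproj_eq0 normr_le0.
apply: preimage_closed; last exact: closed_le.
move=> u _; apply: (@continuous_comp _ _ _ (coproj k) (fun u => `|u|)).
  exact: linear_bounded_continuous (coproj_linear_bounded k) u.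
exact: norm_continuous.
Qed.

Lemma mean_value_le (f : R^o -> E) (f' : R -> E) (K s : R) :
  (forall t, `|t| <= `|s| -> is_derive (t : R^o) 1 f (f' t) /\ `|f' t| <= K) ->
  `|f s - f 0| <= K * `|s|.
Proof.
move=> H; have K0 : 0 <= K.
  by have := H 0; rewrite normr0 => /(_ (normr_ge0 s))[_]; exact: le_trans.
apply: rV_norm_le; first by rewrite mulr_ge0.
move=> j; rewrite !mxE.
have := @mean_step R R^o (fun t : R^o => f t 0 j) (0 : R^o) (1 : R^o) 0 K s.
rewrite mulr0 subr0 !add0r [s *: _]mulr1; apply=> t ts.
rewrite !add0r [t *: _]mulr1 subr0; have [[d1 e1] fK] := H t ts.
have d1' := (derivable_mxP _ _ _).1 d1 0 j; split=> //.
have -> : 'D_1 (fun t : R^o => f t 0 j) t = f' t 0 j by rewrite -e1 derive_mx// mxE.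
exact: le_trans (ler_mx_entry _ _ _) fK.
Qed.

End FiniteDimension.

(** * The Lie algebra of a compact subgroup is a subalgebra *)

Section SubgroupLieAlgebra.
Variables (R : realType) (G : lieGroupType R).
Local Notation n := (@lie_dim R G).
Local Notation E := 'rV[R]_n.
Local Notation c1 := (@chart1 R G).
Local Notation e0 := (c1 1%g).
Implicit Types (x y z : G) (u v X Y : E) (K : set G) (c d : R -> G).

Lemma velocityZ c X a : velocity c X -> velocity (fun t => c (a * t)) (a *: X).
Proof.
move=> vc eps ep0; have a1 : 0 < `|a| + 1 by rewrite ltr_wpDl.
have [d d0 Hd] := vc _ (divr_gt0 ep0 a1).
exists (d / (`|a| + 1)); first by rewrite divr_gt0.
move=> t; rewrite ltr_pdivlMr// => td.
have [|dt ht] := Hd (a * t).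
  by rewrite normrM mulrC (le_lt_trans _ td)// ler_wpM2l// lerDl.
split=> //; rewrite scalerA [t * a]mulrC (le_trans ht)// normrM mulrA ler_wpM2r//.
by rewrite -mulrA -[leRHS]mulr1 (ler_wpM2l (ltW ep0))// mulrC ler_pdivrMr// mul1r lerDl.
Qed.

Variable K : set G.
Hypotheses (sK : subgroup K) (cK : compact K).

Lemma lie_algebraZ a X : lie_algebra K X -> lie_algebra K (a *: X).
Proof.
move=> /(lie_algebraP _ sK cK)[c [cD Kc vc]]; apply/lie_algebraP => //.
exists (fun t => c (a * t)); split; first by move=> s t; rewrite mulrDr cD.
  by move=> t; exact: Kc.
exact: velocityZ.
Qed.

(** The points [c h * d h] have coordinates [h *: (X + Y)] up to o(h). They need not form a
    one-parameter group, but they provide a tangent sequence. *)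
Lemma lie_algebraD X Y : lie_algebra K X -> lie_algebra K Y -> lie_algebra K (X + Y).
Proof.
move=> /(lie_algebraP _ sK cK)[c [cD Kc vc]] /(lie_algebraP _ sK cK)[d [dD Kd vd]].
apply/lie_algebra_tangentP => // eps ep0.
have Y1 : 0 < `|Y| + 2 by rewrite ltr_wpDl.
pose ep := Num.min (eps / 4) (eps / 4 / (`|Y| + 2)).
have e40 : 0 < eps / 4 by rewrite divr_gt0.
have ep'0 : 0 < ep by rewrite lt_min e40 divr_gt0.
have m0 : 0 < Num.min 1 ep by rewrite lt_min ltr01.
have [r r0 Hr] := @phi_mul_est R G _ ep'0.
have [e1 e10 He1] := vc _ m0; have [e2 e20 He2] := vd _ m0.
have [e3 e30 He3] := velocity_near1 r0 vc; have [e4 e40' He4] := velocity_near1 r0 vd.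
have XY1 : 0 < `|X + Y| + eps by rewrite ltr_wpDl.
pose h := Num.min (Num.min (Num.min e1 e2) (Num.min e3 e4)) (Num.min eps (eps / (`|X + Y| + eps))) / 2.
set h' := Num.min _ _ in h.
have h'0 : 0 < h' by rewrite !lt_min e10 e20 e30 e40' ep0 divr_gt0.
have h0 : 0 < h by rewrite divr_gt0.
have hh' : h < h' by rewrite /h; lra.
have := hh'; rewrite !lt_min => /andP[/andP[/andP[h1 h2] /andP[h3 h4]] /andP[h5 h6]].
have nh : `|h| = h by rewrite gtr0_norm.
have h1' : `|h| < e1 by rewrite nh.
have h2' : `|h| < e2 by rewrite nh.
have h3' : `|h| < e3 by rewrite nh.
have h4' : `|h| < e4 by rewrite nh.
have [_ p1] := He1 h h1'.
have [_ p2] := He2 h h2'.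
have n3 := He3 h h3'.
have n4 := He4 h h4'.
rewrite nh in p1 p2.
have [dx px] := Hr _ _ n3 n4.
have pd : `|phi (d h)| <= h * (`|Y| + 1).
  rewrite -[phi _](subrK (h *: Y)) (le_trans (ler_normD _ _))// normrZ nh.
  rewrite mulrDr mulr1 addrC lerD2l (le_trans p2)//.
  by rewrite -[leRHS]mul1r (ler_wpM2r (ltW h0))// ge_min lexx.
have key : `|phi (c h * d h)%g - h *: (X + Y)| <= h * (3 * eps / 4).
  have -> : phi (c h * d h)%g - h *: (X + Y) = (phi (c h * d h)%g - (phi (c h) + phi (d h)))
     + ((phi (c h) - h *: X) + (phi (d h) - h *: Y)) by rvring.
  have q1 : Num.min 1 ep * h <= eps / 4 * h.
    by rewrite (ler_wpM2r (ltW h0))// !ge_min lexx !orbT.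
  have q2 : ep * `|phi (d h)| <= ep * (h * (`|Y| + 1)) by rewrite ler_wpM2l// ltW.
  have q3 : ep * (`|Y| + 2) * h <= eps / 4 * h.
    by rewrite (ler_wpM2r (ltW h0))// -ler_pdivlMr// ge_min lexx orbT.
  have q4 : 0 <= ep * h by rewrite mulr_ge0// ltW.
  apply: le_trans (ler_normD _ _) _.
  have := ler_normD (phi (c h) - h *: X) (phi (d h) - h *: Y); lra.
exists (c h * d h)%g, h^-1; split; rewrite ?invr_gt0 ?invrK//.
- exact: subgroupM.
- split=> //; rewrite -[phi _](subrK (h *: (X + Y))) (le_lt_trans (ler_normD _ _))//.
  rewrite normrZ nh; rewrite ltr_pdivlMr// in h6.
  have : h * (3 * eps / 4) <= h * eps by rewrite (ler_wpM2l (ltW h0))//; lra.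
  by lra.
- have -> : h^-1 *: phi (c h * d h)%g - (X + Y) = h^-1 *: (phi (c h * d h)%g - h *: (X + Y)).
    by apply/rowP => j; rewrite !mxE; field; exact: lt0r_neq0.
  by rewrite normrZ gtr0_norm ?invr_gt0// ltr_pdivrMl// (le_lt_trans key)// ltr_pM2l//; lra.
Qed.

Lemma lie_algebra0 : lie_algebra K 0.
Proof.
apply/lie_algebraP => //; exists (fun=> 1%g); split; first by move=> s t; rewrite mulg1.
  by move=> _; exact: sK.1.
move=> eps ep0; exists 1 => // t _; split; first exact: dom1.
by rewrite phi1 scaler0 subrr normr0 mulr_ge0// ltW.
Qed.

Lemma lie_vspace_ex : exists k : {vspace E}, [set` k] = lie_algebra K.
Proof.
apply: vspace_of_linear_set; first exact: lie_algebra0.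
by move=> a u v hu hv; apply: lie_algebraD => //; exact: lie_algebraZ.
Qed.

Hypothesis cG : compact [set: G].

Lemma lie_algebra_Ad x X : (forall y, K y -> K (x * y * x^-1)%g) -> lie_algebra K X ->
  lie_algebra K (Ad x X).
Proof.
move=> nx /(lie_algebraP _ sK cK)[c [cD Kc vc]]; apply/lie_algebraP => //.
exists (fun t => x * c t * x^-1)%g; split; first exact: conj_one_param.
  by move=> t; exact: nx.
exact: Ad_velocity.
Qed.

(** The bracket is the limit of the difference quotients of [Ad (c t) Y] at 0. These lie in the Lie
    algebra, which is a subspace and therefore closed. *)
Lemma lie_algebra_bracket X Y : lie_algebra K X -> lie_algebra K Y ->
  lie_algebra K (lie_bracket X Y).
Proof.
move=> /(lie_algebraP _ sK cK)[c [cD Kc vc]] KY.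
have [k kE] := lie_vspace_ex; have kP Z : Z \in k <-> lie_algebra K Z by rewrite -kE.
apply/kP; apply: vspace_approx => e ep0.
have [dA eA] := Ad_is_derive0 Y cD vc.
have dA' : (fun h : R => h^-1 *: (Ad (c (h *: (1 : R^o) + 0)) Y - Ad (c 0) Y)) @ 0^' --> lie_bracket X Y.
  by rewrite -eA; exact: dA.
move/cvgrPdist_le: dA' => /(_ _ ep0) H.
have [h] := @filter_ex _ (0 : R)^' _ _ H; rewrite addr0 (one_param0 cD) (Ad1 cG).
move=> hZ.
have KA : lie_algebra K (Ad (c (h *: (1 : R^o))) Y).
  apply: (@lie_algebra_Ad (c (h *: (1 : R^o))) Y _ KY) => y Ky.
  exact: (subgroupM sK (subgroupM sK (Kc _) Ky) (subgroupV sK (Kc _))).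
have KD := lie_algebraD KA (lie_algebraZ (-1) KY); rewrite scaleN1r in KD.
have KZ := lie_algebraZ h^-1 KD.
by exists (h^-1 *: (Ad (c (h *: (1 : R^o))) Y - Y)); [apply/kP|].
Qed.

End SubgroupLieAlgebra.

(** * Comparison of compact subgroups and invariance of subalgebras *)

Section SubgroupComparison.
Variables (R : realType) (G : lieGroupType R).
Local Notation n := (@lie_dim R G).
Local Notation E := 'rV[R]_n.
Local Notation c1 := (@chart1 R G).
Implicit Types (x y z : G) (u v X Y : E) (K H Z : set G) (c d : R -> G).

Lemma compact_lie_closed K : compact K -> closed K.
Proof. by apply: compact_closed; exact: (@lie_hausdorff R G). Qed.

(* [y] is a point of the coset [Z x] which is nearest to 1 up to a factor 2. *)
Lemma almost_nearest H Z x : subgroup Z -> compact Z -> subgroup H -> Z `<=` H ->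
  H x -> ~ Z x -> chart_dom c1 x -> exists y, [/\ H y, chart_dom c1 y,
    0 < `|phi y|, `|phi y| <= 2 * `|phi x| &
    forall z, Z z -> chart_dom c1 (z^-1 * y)%g -> `|phi y| <= 2 * `|phi (z^-1 * y)%g|].
Proof.
move=> sZ cZ sH ZH Hx nZx dx.
pose A := [set t : R | exists z, [/\ Z z, chart_dom c1 (z^-1 * x)%g & t = `|phi (z^-1 * x)%g|]].
have Ax : A `|phi x| by exists 1%g; rewrite invg1 mul1g; split=> //; exact: sZ.1.
(* [Z] is closed and does not contain [x], so the coset keeps a positive distance from 1; only then
   is there room for a factor 2 above the infimum. *)
have [r r0 Hr] : exists2 r, 0 < r & forall w, near1 r w -> ~ Z (x * w^-1)%g.
  have oZ : open (~` Z) by apply: closed_openC; exact: compact_lie_closed.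
  have cf : {for (1%g : G), continuous (fun w => x * w^-1)%g}.
    apply: continuous_mulg; first exact: cst_continuous.
    by apply: continuous_invg; exact: cvg_id.
  have : nbhs (1%g : G) ((fun w => x * w^-1)%g @^-1` (~` Z)).
    by apply: cf; rewrite invg1 mulg1; exact: open_nbhs_nbhs.
  by move=> /nbhs_near1[r r0 Hr]; exists r.
have lbA t : A t -> r <= t.
  move=> [z [Zz dz ->]]; rewrite leNgt; apply/negP => lt.
  have := Hr _ (conj dz lt); apply.
  by rewrite invgM invgK mulgA mulgV mul1g.
have A0 : A !=set0 by exists `|phi x|.
have hA : has_inf A by split=> //; exists r => t; exact: lbA.
have i0 : 0 < inf A by apply: lt_le_trans r0 _; apply: lb_le_inf => // t; exact: lbA.
have ix : inf A <= `|phi x| by apply: ge_inf => //; exact: hA.2.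
have [t [z0 [Zz0 dz0 ->]] tlt] := inf_adherent i0 hA.
exists (z0^-1 * x)%g; split=> //.
- by apply: subgroupM => //; apply: subgroupV => //; exact: ZH.
- by apply: lt_le_trans r0 _; apply: lbA; exists z0.
- by lra.
- move=> z Zz dz; have : inf A <= `|phi (z^-1 * (z0^-1 * x))%g|.
    apply: ge_inf; first exact: hA.2.
    exists (z0 * z)%g; rewrite invgM -mulgA; split=> //; exact: subgroupM.
  by lra.
Qed.

(* Otherwise the almost nearest points of H \ Z tending to 1 have, after
   normalisation, a limit tangent to H but not to Z. *)
Lemma lie_algebra_le_open H Z : subgroup Z -> compact Z -> subgroup H -> compact H ->
  Z `<=` H -> lie_algebra H `<=` lie_algebra Z ->
  exists2 r, 0 < r & forall x, H x -> near1 r x -> Z x.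
Proof.
move=> sZ cZ sH cH ZH lHZ; apply: contrapT => no.
have bad r : 0 < r -> exists x, [/\ H x, ~ Z x & near1 r x].
  move=> r0; apply: contrapT => nb; apply: no; exists r => // x Hx nx.
  by apply: contrapT => nZ; apply: nb; exists x.
have /choice[y Hy] : forall k : nat, exists y, [/\ H y, chart_dom c1 y, 0 < `|phi y|,
    `|phi y| <= 2 * k.+1%:R^-1 &
    forall z, Z z -> chart_dom c1 (z^-1 * y)%g -> `|phi y| <= 2 * `|phi (z^-1 * y)%g|].
  move=> k; have k0 : 0 < k.+1%:R^-1 :> R by rewrite invr_gt0.
  have [x [Hx nZx nx]] := bad _ k0.
  have [y [Hy dy y0 yx yz]] := almost_nearest sZ cZ sH ZH Hx nZx nx.1.
  by exists y; split=> //; rewrite (le_trans yx)// ler_pM2l// ltW// nx.2.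
have [U UU ooU] := ultra_oo.
have PU : ProperFilter U by exact: ultra_proper.
have small e : 0 < e -> \forall k \near U, `|phi (y k)| < e.
  move=> e0; apply: ooU; have e20 : 0 < e / 2 by rewrite divr_gt0.
  have := near_infty_natSinv_lt (PosNum e20); apply: filterS => k /= ke.
  have [_ _ _ + _] := Hy k; move: ke; set i := _^-1; lra.
have [|X _ uX] := ultra_compact_lim (f := fun k => `|phi (y k)|^-1 *: phi (y k)) UU (@compact_norm_le R n 1).
  apply: filterE => k; have [_ _ y0 _ _] := Hy k.
  by rewrite /= normrZ gtr0_norm ?invr_gt0// mulVf// lt0r_neq0.
have close e : 0 < e -> \forall k \near U, `| `|phi (y k)|^-1 *: phi (y k) - X| < e.
  by move=> e0; move/cvgrPdist_lt: uX => /(_ _ e0); apply: filterS => k; rewrite distrC.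
have HX : lie_algebra H X.
  apply/lie_algebra_tangentP => // e e0.
  have [k [k1 k2]] := filter_ex (filterI (small e e0) (close e e0)).
  have [Hyk dyk y0 _ _] := Hy k.
  by exists (y k), `|phi (y k)|^-1; rewrite invr_gt0 invrK.
have /(lie_algebraP _ sZ cZ)[c [cD Zc vc]] := lHZ _ HX.
(* With relative error 1/16 for both [y k] and [c m], their coordinates differ by at most [m / 8],
   so [(c m)^-1 * y k] has size at most [m / 4]; almost-minimality demands at least [m / 2]. *)
have e0 : 0 < 16^-1 :> R by rewrite invr_gt0.
have [d d0 Hd] := vc _ e0.
have [r r0 Hr] := @phi_div_est R G _ ltr01.
have [d' d'0 Hd'] := velocity_near1 r0 vc.
have m0 : 0 < Num.min (Num.min d d') r by rewrite !lt_min d0 d'0.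
have [k [k1 k2]] := filter_ex (filterI (small _ m0) (close _ e0)).
have [_ dyk y0 _ yz] := Hy k.
move: k1; rewrite !lt_min => /andP[/andP[m1 m2] m3].
set m := `|phi (y k)| in y0 m1 m2 m3 k2 yz.
have nm : `|m| = m by rewrite gtr0_norm.
have [_ h1] : chart_dom c1 (c m) /\ `|phi (c m) - m *: X| <= 16^-1 * `|m| by apply: Hd; rewrite nm.
have h2 : near1 r (c m) by apply: Hd'; rewrite nm.
have [dz hz] := Hr _ _ h2 (conj dyk m3).
have := yz _ (Zc m) dz.
have h3 : `|phi (y k) - m *: X| <= 16^-1 * m.
  have -> : phi (y k) - m *: X = m *: (m^-1 *: phi (y k) - X).
    by rewrite scalerBr scalerA divff ?scale1r// lt0r_neq0.
  by rewrite normrZ nm mulrC ler_wpM2r// ltW.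
rewrite nm in h1.
have h4 : `|phi (y k) - phi (c m)| <= 8^-1 * m.
  have -> : phi (y k) - phi (c m) = (phi (y k) - m *: X) - (phi (c m) - m *: X) by rvring.
  by apply: le_trans (ler_normB _ _) _; lra.
have h5 : `|phi ((c m)^-1 * y k)%g| <= 2 * `|phi (y k) - phi (c m)|.
  rewrite -[phi _](subrK (phi (y k) - phi (c m))) (le_trans (ler_normD _ _))//.
  by lra.
by lra.
Qed.

(** [Z] is closed in [H], and open because it contains all points of [H] near 1 and is stable under
    translation by its elements. *)
Lemma connected_subgroup_le H Z : subgroup Z -> compact Z -> subgroup H -> compact H ->
  connected H -> Z `<=` H -> lie_algebra H `<=` lie_algebra Z -> H `<=` Z.
Proof.
move=> sZ cZ sH cH coH ZH lHZ.
have [r r0 Hr] := lie_algebra_le_open sZ cZ sH cH ZH lHZ.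
suff <- : Z = H by [].
apply: coH.
- by exists 1%g; exact: sZ.1.
- exists [set x | exists2 z, Z z & ((near1 r)^° (z^-1 * x)%g)].
    rewrite openE => x [z Zz nz].
    have cf : {for x, continuous (fun w => z^-1 * w)%g}.
      by apply: continuous_mulg; [exact: cst_continuous|exact: cvg_id].
    have N : nbhs x ((fun w => z^-1 * w)%g @^-1` (near1 r)°) :=
      cf _ (open_nbhs_nbhs (conj (@open_interior _ (near1 r)) nz)).
    by apply: filterS N => w nw; exists z.
  apply/seteqP; split=> x.
    move=> Zx; split; first exact: ZH.
    exists x => //; rewrite mulVg; apply: near1_nbhs r0.
  move=> [Hx [z Zz /nbhs_singleton nz]].
  rewrite -[x](mulVKg z); apply: subgroupM => //; apply: Hr => //.
  by apply: subgroupM => //; apply: subgroupV => //; exact: ZH.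
- exists Z; first exact: compact_lie_closed.
  by apply/seteqP; split=> [x Zx|x []//]; split=> //; exact: ZH.
Qed.

Hypothesis cG : compact [set: G].

Lemma Ad_bound : exists2 B, 0 < B & forall x W, `|Ad x W| <= B * `|W|.
Proof.
have /choice[m Hm] : forall i : 'I_n, exists m : R, forall x, `|Ad x (delta_mx 0 i)| <= m.
  move=> i.
  have [||y _ Hy] := @compact_EVT_max G R (fun x => `|Ad x (delta_mx 0 i)|) setT _ cG.
  - by exists 1%g.
  - apply: continuous_subspaceT => x.
    apply: (@continuous_comp _ _ _ (fun x => Ad x (delta_mx 0 i)) (fun u => `|u|)).
      exact: Ad_continuous.
    exact: norm_continuous.
  - by exists `|Ad y (delta_mx 0 i)| => x; apply: Hy; rewrite inE.
have m0 i : 0 <= m i by apply: le_trans (Hm i 1%g).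
exists (1 + \sum_i m i); first by rewrite ltr_wpDr// sumr_ge0.
move=> x W; rewrite (le_trans (linear_rV_le W (Ad_linear x).1))// ler_wpM2r//.
by rewrite ler_wpDl// ler_sum.
Qed.

(* Gronwall: the component of Ad(c t) W transversal to k satisfies a linear
   differential inequality, hence is O((C t)^N) for all N. *)
Lemma Ad_one_param_subalgebra (k : {vspace E}) c Y : lie_subalgebra k -> Y \in k ->
  one_param c -> velocity c Y -> forall t W, W \in k -> Ad (c t) W \in k.
Proof.
move=> subk Yk cD vc.
have lq := coproj_linear_bounded k; have [_ [Q Q0 HQ]] := lq.
have [B B0 HB] := Ad_bound.
have [_ [C C0 HC]] : linear_bounded (fun W => lie_bracket Y W).
  by apply: linear_bounded_rV => a u v; exact: lie_bracket_linearr.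
(* The derivative of [coproj k (Ad (c t) W)] is the same expression for [lie_bracket Y W], which is
   again in [k]. Hence the induction hypothesis is kept for all [W], and each use of the mean value
   inequality gains a factor [C * |t|]. *)
have bound N : forall t W, W \in k -> `|coproj k (Ad (c t) W)| <= Q * B * (C * `|t|) ^+ N * `|W|.
  elim: N => [|N IH] t W Wk.
    by rewrite expr0 mulr1 -mulrA (le_trans (HQ _))// ler_pM2l.
  have := @mean_value_le R n (fun t => coproj k (Ad (c t) W))
    (fun s => coproj k (Ad (c s) (lie_bracket Y W))) (Q * B * (C * `|t|) ^+ N * (C * `|W|)) t.
  rewrite one_param0// Ad1// (_ : coproj k W = 0) ?subr0; last by apply/eqP; rewrite coproj_eq0.
  move=> H; rewrite exprSr; apply: le_trans (H _) _; last by rewrite le_eqVlt; apply/orP; left; apply/eqP; ring.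
  move=> s st; have [d1 e1] := Ad_is_derive cG W s cD vc.
  split; first by have := is_derive_linear_comp lq d1; rewrite e1.
  apply: le_trans (IH s _ (subk _ _ Yk Wk)) _.
  have h1 : `|lie_bracket Y W| <= C * `|W| by exact: HC.
  apply: ler_pM => //; first by rewrite !mulr_ge0 ?exprn_ge0 ?mulr_ge0// ltW.
  rewrite ler_wpM2l ?mulr_ge0 ?(ltW Q0) ?(ltW B0)//.
  by apply: lerXn2r; rewrite ?nnegrE ?mulr_ge0 ?(ltW C0)// (ler_wpM2l (ltW C0)).
have local t W : C * `|t| <= 2^-1 -> W \in k -> Ad (c t) W \in k.
  move=> Ct Wk; rewrite -coproj_eq0 -normr_le0; apply/ler_addgt0Pr => e e0; rewrite add0r.
  have D0 : 0 < Q * B * `|W| + 1 by rewrite ltr_wpDl// !mulr_ge0// ltW.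
  have [N _ HN] := near_infty_natSinv_lt (PosNum (divr_gt0 e0 D0)).
  have := HN N (leqnn N); rewrite /= => {}HN.
  apply: le_trans (bound N t W Wk) _.
  have h1 : (C * `|t|) ^+ N <= N.+1%:R^-1.
    apply: (@le_trans _ _ (2^-1 ^+ N)).
      by apply: lerXn2r; rewrite ?nnegrE ?mulr_ge0 ?(ltW C0).
    by rewrite exprVn lef_pV2 ?posrE// -natrX ler_nat ltn_expl.
  have h2 : (C * `|t|) ^+ N <= e / (Q * B * `|W| + 1) by apply: le_trans h1 (ltW HN).
  rewrite mulrAC (le_trans (ler_wpM2l _ h2))// ?mulr_ge0 ?(ltW Q0) ?(ltW B0)//.
  rewrite mulrCA -[leRHS]mulr1 (ler_wpM2l (ltW e0))// ler_pdivrMr// mul1r lerDl//.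
move=> t W Wk.
have C20 : 0 < 2 * C by rewrite mulr_gt0.
set N := (Num.truncn (`|t| * (2 * C))).+1.
have N0 : 0 < N%:R :> R by rewrite ltr0n.
have tN : t = N%:R * (t / N%:R) by field; exact: lt0r_neq0.
have hN : C * `|t / N%:R| <= 2^-1.
  have := truncnS_gt (`|t| * (2 * C)); rewrite -/N => h.
  rewrite normrM normfV (gtr0_norm N0) mulrA ler_pdivrMr//.
  by lra.
rewrite tN one_paramX//; move: (t / N%:R) hN => s hs.
elim: (N) => [|j IH]; first by rewrite expg0 Ad1.
by rewrite expgS (AdM cG); exact: local hs IH.
Qed.

(** The stabiliser of [k] in [K] is a compact subgroup that contains every one-parameter group of
    [K], by [Ad_one_param_subalgebra]. It has the same Lie algebra as [K], hence is all of the
    connected group [K]. *)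
Lemma Ad_subgroup_subalgebra (k : {vspace E}) K : subgroup K -> compact K -> connected K ->
  lie_subalgebra k -> lie_algebra K `<=` [set` k] ->
  forall x W, K x -> W \in k -> Ad x W \in k.
Proof.
move=> sK cK coK subk Kk.
pose S x := forall W, W \in k -> Ad x W \in k.
(* Imposing the condition on [x^-1] as well makes stability under inverses immediate, in place of a
   dimension count. *)
pose Z := K `&` [set x | S x /\ S x^-1%g].
have sZ : subgroup Z.
  split; first by split; [exact: sK.1|rewrite /= invg1; split=> W; rewrite Ad1].
  move=> x y [Kx [Sx Sx']] [Ky [Sy Sy']]; split; first exact: sK.2.
  split=> W Wk.
    by rewrite AdM//; apply: Sx; exact: Sy'.
  by rewrite invgM invgK AdM//; apply: Sy; exact: Sx'.
have cZ : compact Z.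
  apply: (subclosed_compact _ cK); last by move=> x [].
  have clS (f : G -> G) : continuous f -> closed [set x | S (f x)].
    move=> cf; have -> : [set x | S (f x)] = \bigcap_(W in [set` k]) (fun x => Ad (f x) W) @^-1` [set` k].
      by apply/seteqP; split=> x.
    apply: closed_bigI => W _; apply: preimage_closed; last exact: vspace_closed.
    move=> x _; apply: (@continuous_comp _ _ _ f (fun y => Ad y W)); first exact: cf.
    exact: Ad_continuous.
  apply: closedI; first exact: compact_lie_closed.
  apply: closedI; first by apply: (clS id) => x; exact: cvg_id.
  by apply: (clS (fun x => x^-1%g)); exact: lie_inv_continuous.
have KZ : K `<=` Z.
  apply: (connected_subgroup_le sZ cZ sK cK coK); first by move=> x [].
  move=> X KX; have Xk := Kk _ KX; move: KX => /(lie_algebraP _ sK cK)[c [cD Kc vc]].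
  apply/lie_algebraP => //; exists c; split=> // t; split=> //=.
  by rewrite -one_paramN//; split=> W Wk; exact: (Ad_one_param_subalgebra subk Xk cD vc).
by move=> x W /KZ[_ [Sx _]]; exact: Sx.
Qed.

End SubgroupComparison.

(** * Fixed vectors of the adjoint action *)

Section FixedPoints.
Variables (R : realType) (G : lieGroupType R).
Local Notation n := (@lie_dim R G).
Local Notation E := 'rV[R]_n.
Local Notation c1 := (@chart1 R G).
Implicit Types (x y z : G) (u v X Y Z W : E) (K H : set G) (c d : R -> G).

(** The squared Euclidean norm: the norm of ['rV_n] is the maximum norm, for which the parallelogram
    identity fails. *)
Definition normsq (v : E) : R := \sum_j v 0 j ^+ 2.

Lemma normsq_ge0 v : 0 <= normsq v.
Proof. by apply: sumr_ge0 => j _; exact: sqr_ge0. Qed.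

Lemma norm_le_normsq v : `|v| ^+ 2 <= normsq v.
Proof.
rewrite -[leRHS]sqr_sqrtr ?normsq_ge0// ler_pXn2r ?nnegrE ?sqrtr_ge0//.
apply: rV_norm_le; first exact: sqrtr_ge0.
move=> j; rewrite -sqrtr_sqr ler_wsqrtr// /normsq (bigD1 j)//= lerDl.
by apply: sumr_ge0 => i _; exact: sqr_ge0.
Qed.

Lemma normsq_le v : normsq v <= n%:R * `|v| ^+ 2.
Proof.
rewrite -[n in n%:R]card_ord -sum1_card natr_sum mulr_suml; apply: ler_sum => j _.
by rewrite mul1r -real_normK ?num_real// lerXn2r ?nnegrE// ler_mx_entry.
Qed.

Lemma normsq_midpoint u v :
  normsq (2^-1 *: (u + v)) = 2^-1 * normsq u + 2^-1 * normsq v - 4^-1 * normsq (u - v).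
Proof.
rewrite /normsq !mulr_sumr -big_split -sumrB; apply: eq_bigr => j _ /=.
by rewrite !mxE; field.
Qed.

Lemma midpoint_bound (s t r b e : R) : s <= b -> t <= b -> e <= r ->
  2^-1 * s + 2^-1 * t - 4^-1 * r <= b - 4^-1 * e.
Proof. by lra. Qed.

Lemma normsq_continuous : continuous normsq.
Proof.
rewrite /normsq; elim: (index_enum _) => [|j s IH] v.
  by under eq_fun do rewrite big_nil; exact: cst_continuous.
under eq_fun do rewrite big_cons.
apply: (@continuousD _ _ _ (fun v : E => v 0 j ^+ 2)); last exact: IH.
apply: (@continuous_comp _ _ _ (fun v : E => v 0 j) (fun x : R => x ^+ 2)).
  exact: coord_continuous.
exact: exprn_continuous.
Qed.

Hypothesis cG : compact [set: G].

(* A minimiser of sup_K |Ad x Z|^2 on the invariant affine space X + a is unique,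
   by the parallelogram identity, hence fixed. *)
Lemma Ad_fixed_point (a : {vspace E}) K X : subgroup K ->
  (forall x W, K x -> W \in a -> Ad x W \in a) ->
  (forall x, K x -> Ad x X - X \in a) ->
  exists2 Z, Z - X \in a & forall x, K x -> Ad x Z = Z.
Proof.
move=> sK Ka KX; have [B B0 HB] := @Ad_bound R G cG.
pose P t Z := forall x, K x -> normsq (Ad x Z) <= t.
pose A := [set t | exists2 Z, Z - X \in a & P t Z].
have A0 : A !=set0.
  exists (n%:R * (B * `|X|) ^+ 2), X; first by rewrite subrr mem0v.
  move=> x Kx; apply: le_trans (normsq_le _) _; rewrite ler_wpM2l//.
  by rewrite lerXn2r ?nnegrE// mulr_ge0// ltW.
have lbA : lbound A 0.
  by move=> t [Z _ PZ]; apply: le_trans (PZ 1%g sK.1); exact: normsq_ge0.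
have hA : has_inf A by split=> //; exists 0.
set m := inf A.
have /choice[Zs HZs] : forall k : nat, exists Z, Z - X \in a /\ P (m + k.+1%:R^-1) Z.
  move=> k; have k0 : 0 < k.+1%:R^-1 :> R by rewrite invr_gt0.
  have [t [Z Za PZ] tlt] := inf_adherent k0 hA.
  by exists Z; split=> // x Kx; apply: le_trans (PZ x Kx) (ltW tlt).
have [U UU ooU] := ultra_oo.
have PU : ProperFilter U by exact: ultra_proper.
have m0 : 0 <= m by apply: lb_le_inf.
have [|Z _ ZsZ] := ultra_compact_lim (f := Zs) UU (@compact_norm_le R n (m + 1 + 1)).
  apply: filterE => k; have [_ /(_ 1%g sK.1)] := HZs k; rewrite Ad1// => h /=.
  have h2 := le_trans (norm_le_normsq (Zs k)) h.
  have h3 : k.+1%:R^-1 <= 1 :> R by rewrite invf_le1// ler1n.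
  move: h2 h3; set i := _^-1 => h2 h3; rewrite leNgt; apply/negP => h4.
  have : (m + 1 + 1) ^+ 2 < `|Zs k| ^+ 2 by rewrite ltr_pXn2r ?nnegrE//; lra.
  have := mulr_ge0 m0 m0; rewrite expr2; lra.
have ZX : Z - X \in a.
  apply: vspace_approx => e e0; move/cvgrPdist_le: ZsZ => /(_ _ e0) H.
  have [k hk] := filter_ex H; exists (Zs k - X); first by have [] := HZs k.
  by rewrite opprB addrA subrK.
have PmZ : P m Z.
  move=> x Kx; rewrite -[normsq _]ger0_norm ?normsq_ge0// -[normsq _]subr0.
  apply: (@lim_norm_le R R^o _ U (fun k => normsq (Ad x (Zs k)))) => //.
    apply: (@cvg_comp _ _ _ Zs (fun v => normsq (Ad x v)) U (nbhs Z)) => //.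
    apply: (@continuous_comp _ _ _ (Ad x) normsq).
      exact: linear_bounded_continuous (Ad_linear x) _.
    exact: normsq_continuous.
  move=> eta eta0; apply: ooU; have := near_infty_natSinv_lt (PosNum eta0).
  apply: filterS => k /= ke; rewrite subr0 ger0_norm ?normsq_ge0//.
  have [_ /(_ x Kx) h] := HZs k; move: h ke; set i := _^-1; lra.
exists Z => // y Ky; set D := Z - Ad y Z.
suff : D = 0 by move=> /eqP; rewrite subr_eq0 => /eqP.
have Pmy : P m (Ad y Z).
  by move=> x Kx; rewrite -AdM//; apply: PmZ; exact: subgroupM.
have Da : Ad y Z - Z \in a.
  have -> : Ad y Z - Z = (Ad y (Z - X) + (Ad y X - X)) - (Z - X).
    rewrite (linear_boundedB _ _ (Ad_linear y)); move: (Ad y Z) (Ad y X) => P1 P2.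
    by rvring.
  by rewrite rpredB// rpredD//; [exact: Ka|exact: KX].
(* The midpoint of [Z] and [Ad y Z] lowers the bound [m] by a quarter of [del]: the identity
   [D = Ad x^-1 (Ad x D)] gives [|Ad x D| >= |D| / B] for all [x] at once. As [m] is the infimum,
   [D] must vanish. *)
pose del := `|D| ^+ 2 / B ^+ 2.
have : A (m - 4^-1 * del).
  exists (2^-1 *: (Z + Ad y Z)).
    have -> : 2^-1 *: (Z + Ad y Z) - X = (Z - X) + 2^-1 *: (Ad y Z - Z).
      by apply/rowP => j; rewrite !mxE; field.
    by rewrite rpredD// rpredZ.
  move=> x Kx; have lx := Ad_linear x.
  have lxD u v : Ad x (u + v) = Ad x u + Ad x v by rewrite -[u in LHS]scale1r lx.1 scale1r.
  rewrite (linear_boundedZ _ _ lx) lxD.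
  rewrite normsq_midpoint -linear_boundedB//.
  have h1 := PmZ x Kx; have h2 := Pmy x Kx.
  have h3 : del <= normsq (Ad x D).
    apply: le_trans (norm_le_normsq _); rewrite ler_pdivrMr ?exprn_gt0//.
    rewrite mulrC -exprMn lerXn2r ?nnegrE ?mulr_ge0 ?(ltW B0)//.
    by rewrite -{1}(AdVK cG x D).
  exact: midpoint_bound.
move=> /(ge_inf hA.2); rewrite -/m => h.
have : del <= 0 by lra.
rewrite /del pmulr_lle0 ?invr_gt0 ?exprn_gt0// => h'.
by apply/eqP; rewrite -normr_eq0 -sqrf_eq0 eq_le h' sqr_ge0.
Qed.

Lemma lie_algebra_mono K H : K `<=` H -> lie_algebra K `<=` lie_algebra H.
Proof.
move=> KH X [c [c0 [e [e0 Hc sm DX]]]]; exists c; split=> //; exists e; split=> //.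
by move=> t /Hc[Kt dt]; split=> //; exact: KH.
Qed.

Lemma one_param_lie_algebra K c X : one_param c -> (forall t, K (c t)) -> velocity c X ->
  lie_algebra K X.
Proof.
move=> cD Kc vc; exists c; split; first exact: one_param0.
have [e [e0 He sm DX]] := one_param_smooth cD vc.
by exists e; split=> // t /He dt; split.
Qed.

Lemma commute_bracket0 c d X Y : one_param c -> velocity c X -> one_param d -> velocity d Y ->
  (forall s t, commute (c s) (d t)) -> lie_bracket X Y = 0.
Proof.
move=> cD vc dD vd H; have [_ <-] := Ad_is_derive0 Y cD vc.
rewrite (_ : (fun t : R^o => Ad (c t) Y) = cst Y) ?derive_cst//.
by apply/funext => t; apply: (commute_Ad_fixed dD vd) => s; exact: H.
Qed.

(** Otherwise [Z] together with a basis of the Lie algebra of [H] is a free family tangent to the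
    normaliser, which contains the one-parameter group of [Z]; this contradicts the equality of
    dimensions. *)
Lemma fixed_in_lie_algebra K H Z : subgroup K -> compact K -> subgroup H -> compact H ->
  H `<=` K -> subgroup_dim (normalizer K H) = subgroup_dim H ->
  lie_algebra K Z -> (forall x, H x -> Ad x Z = Z) -> lie_algebra H Z.
Proof.
move=> sK cK sH cH HK dimE KZ HZ.
have [k kE] := lie_vspace_ex sH cH; have kP W : W \in k <-> lie_algebra H W by rewrite -kE.
apply/kP; apply: contrapT => /negP Zk.
have NZ : lie_algebra (normalizer K H) Z.
  move: KZ => /(lie_algebraP _ sK cK)[c [cD Kc vc]].
  apply: (one_param_lie_algebra cD _ vc) => t; split=> //.
  have cx x : H x -> (x ^ c t)%g = x.
    move=> Hx; have := Ad_fixed_commute cD vc (HZ x Hx) t => E.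
    rewrite conjgE; apply: (@mulgI _ (c t)); rewrite mulgA mulgV mul1g.
    by rewrite -[in RHS]E mulgVK.
  by apply/seteqP; split=> [x [y Hy <-]|x Hx]; [rewrite cx|exists x; rewrite ?cx].
have HN : lie_algebra H `<=` lie_algebra (normalizer K H).
  apply: lie_algebra_mono => x Hx; split; first exact: HK.
  apply/seteqP; split=> [z [y Hy <-]|z Hz].
    rewrite conjgE; apply: subgroupM => //; first exact: subgroupV.
    exact: subgroupM.
  exists (z ^ x^-1)%g; last by rewrite -conjgM mulVg conjg1.
  rewrite conjgE invgK; apply: subgroupM => //; apply: subgroupM => //; exact: subgroupV.
have ub : (subgroup_dim H <= \dim k)%N.
  apply/bigmax_leqP => i /asboolP[s [fs Hs]].
  have : (\dim (span s) <= \dim k)%N.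
    by apply: dimvS; apply/span_subvP => v vs; apply/kP; exact: Hs.
  by move: fs; rewrite /free => /eqP ->; rewrite size_tuple.
have lb : (\dim k < subgroup_dim (normalizer K H))%N.
  have fr : free (Z :: vbasis k).
    by rewrite free_cons (span_basis (vbasisP k)) Zk (basis_free (vbasisP k)).
  have dn : (\dim k < n)%N.
    have : (\dim (span (Z :: vbasis k)) <= \dim {:E})%N by apply: dimvS; exact: subvf.
    move: fr; rewrite /free => /eqP ->; rewrite /= size_tuple.
    by rewrite dimvf /dim /= mul1n.
  have di : ((\dim k).+1 < n.+1)%N by [].
  apply: (@leq_bigmax_cond _ _ (fun i : 'I_n.+1 => nat_of_ord i) (Ordinal di)).
  apply/asboolP; exists [tuple of Z :: vbasis k]; split=> // v.
  rewrite inE => /orP[/eqP ->//|vk]; apply: HN; apply/kP; exact: vbasis_mem.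
by have := leq_trans lb (leq_trans (eq_leq dimE) ub); rewrite ltnn.
Qed.

End FixedPoints.

(** * Direct products *)

Section ProductsOfCurves.
Variables (R : realType) (G : lieGroupType R).
Local Notation n := (@lie_dim R G).
Local Notation E := 'rV[R]_n.
Local Notation c1 := (@chart1 R G).

Lemma phi_prod_est (I : Type) (s : seq I) eps : 0 < eps -> exists2 r : R, 0 < r &
  forall y : I -> G, (forall i, near1 r (y i)) ->
    chart_dom c1 (\prod_(i <- s) y i)%g /\
    `|phi (\prod_(i <- s) y i)%g - \sum_(i <- s) phi (y i)| <=
      eps * \sum_(i <- s) `|phi (y i)|.
Proof.
elim: s eps => [|i s IH] eps ep0.
  exists 1 => // y _; rewrite !big_nil phi1 subrr normr0 mulr0; split=> //; exact: dom1.
(* Peeling off one factor costs [e * |phi P|], at most [2 * e * T], on top of the error [e * T] of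
   the remaining product: [3 * e * T] in all. *)
pose e := Num.min 1 (eps / 3).
have e0 : 0 < e by rewrite lt_min ltr01 divr_gt0.
have e1 : e <= 1 by rewrite ge_min lexx.
have e3 : e <= eps / 3 by rewrite ge_min lexx orbT.
have [r r0 Hr] := IH e e0; have [r' r'0 Hr'] := @phi_mul_est R G e e0.
have s0 : 0 < 2 * (size s).+1%:R :> R by rewrite mulr_gt0.
exists (Num.min r (r' / (2 * (size s).+1%:R))); first by rewrite lt_min r0 divr_gt0.
move=> y ny.
have ny1 j : near1 r (y j) by apply: near1_le (ny j); rewrite ge_min lexx.
have [ds hs] := Hr y ny1; set P := (\prod_(j <- s) _)%g in ds hs; set S := \sum_(j <- s) phi _ in hs.
set T := \sum_(j <- s) _ in hs.
have T0 : 0 <= T by apply: sumr_ge0.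
have ST : `|S| <= T by exact: ler_norm_sum.
have PT : `|phi P| <= (1 + e) * T.
  rewrite -[phi P](subrK S) (le_trans (ler_normD _ _))//; lra.
have TB : T <= (size s)%:R * (r' / (2 * (size s).+1%:R)).
  apply: (@le_trans _ _ (\sum_(j <- s) (r' / (2 * (size s).+1%:R)))).
    by apply: ler_sum => j _; have [_ /ltW] := ny j; rewrite le_min => /andP[].
  by rewrite big_const_seq count_predT iter_addr_0 [leRHS]mulr_natl lexx.
have nP : near1 r' P.
  split=> //; apply: le_lt_trans PT _.
  have : (1 + e) * T <= 2 * T by rewrite ler_wpM2r//; lra.
  move=> h; apply: le_lt_trans h _; apply: le_lt_trans (ler_wpM2l _ TB) _ => //.
  have -> : 2 * ((size s)%:R * (r' / (2 * (size s).+1%:R))) = r' * ((size s)%:R / (size s).+1%:R).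
    by field; rewrite lt0r_neq0// ltr_wpDr.
  by rewrite -[ltRHS]mulr1 ltr_pM2l// ltr_pdivrMr// mul1r ltr_nat.
have nyi : near1 r' (y i).
  apply: near1_le (ny i); rewrite ge_min; apply/orP; right.
  rewrite ler_pdivrMr// -[leLHS]mulr1 (ler_wpM2l (ltW r'0))//.
  by rewrite -natrM ler1n muln_gt0.
have [d h] := Hr' _ _ nyi nP.
rewrite !big_cons -/P -/S -/T; split=> //.
have -> : phi (y i * P)%g - (phi (y i) + S) = (phi (y i * P)%g - (phi (y i) + phi P)) + (phi P - S).
  by move: (phi (y i * P)%g) (phi (y i)) (phi P) (S) => a b c f; rvring.
apply: le_trans (ler_normD _ _) _.
have h2 : e * `|phi P| <= e * (2 * T).
  rewrite (ler_wpM2l (ltW e0))// (le_trans PT)// ler_wpM2r//; lra.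
have h3 : e * T <= eps / 3 * T by rewrite ler_wpM2r.
have h4 : 0 <= eps * `|phi (y i)| by rewrite mulr_ge0// ltW.
by rewrite mulrDr; move: h h2 h3 h4 hs; lra.
Qed.

Lemma velocity_prod (I : finType) (c : I -> R -> G) (X : I -> E) :
  (forall i, velocity (c i) (X i)) ->
  velocity (fun t => \prod_i c i t)%g (\sum_i X i).
Proof.
move=> vc eps ep0.
pose B := \sum_i (`|X i| + 1).
have B0 : 0 <= B by apply: sumr_ge0 => i _; rewrite addr_ge0.
have B1 : 0 < B + 1 by rewrite ltr_wpDl.
have eB : 0 < eps / 2 / (B + 1) by rewrite !divr_gt0.
have [r r0 Hr] := phi_prod_est (index_enum I) eB.
pose e := Num.min 1 (eps / 2 / (#|I|.+1%:R)).
have e0 : 0 < e by rewrite lt_min ltr01 !divr_gt0.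
have [|i|d d0 Hd] := @finite_radius R I (fun i d => forall t, `|t| < d -> near1 r (c i t) /\
    `|phi (c i t) - t *: X i| <= e * `|t|).
- by move=> i d d' d'0 dd' H t td; apply: H; exact: lt_le_trans dd'.
- have [d1 d10 H1] := vc i e e0; have [d2 d20 H2] := velocity_near1 r0 (vc i).
  exists (Num.min d1 d2) => [|t]; first by rewrite lt_min d10.
  rewrite lt_min => /andP[t1 t2]; split; first exact: H2.
  by have [] := H1 t t1.
exists d => // t td.
have [dP hP] := Hr (fun i => c i t) (fun i => (Hd i t td).1); split=> //.
have S1 : `|\sum_i phi (c i t) - t *: \sum_i X i| <= eps / 2 * `|t|.
  rewrite scaler_sumr -sumrB (le_trans (ler_norm_sum _ _ _))//.
  apply: (@le_trans _ _ (\sum_(i : I) e * `|t|)).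
    by apply: ler_sum => i _; exact: (Hd i t td).2.
  rewrite -mulr_suml ler_wpM2r// sumr_const -[leLHS]mulr_natl.
  apply: (@le_trans _ _ (#|I|%:R * (eps / 2 / (#|I|.+1%:R)))).
    by apply: ler_wpM2l => //; rewrite ge_min lexx orbT.
  rewrite mulrCA -[leRHS]mulr1 ler_wpM2l ?divr_ge0 ?(ltW ep0)// ler_pdivrMr// mul1r ler_nat//.
have S2 : \sum_i `|phi (c i t)| <= B * `|t|.
  rewrite /B mulr_suml; apply: ler_sum => i _.
  rewrite -[phi _](subrK (t *: X i)) (le_trans (ler_normD _ _))// normrZ.
  have := (Hd i t td).2; have : e * `|t| <= 1 * `|t| by rewrite ler_wpM2r// ge_min lexx.
  by lra.
have S3 : eps / 2 / (B + 1) * (B * `|t|) <= eps / 2 * `|t|.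
  rewrite mulrA ler_wpM2r// -mulrA -[leRHS]mulr1 ler_wpM2l ?divr_ge0 ?(ltW ep0)//.
  by rewrite mulrC ler_pdivrMr// mul1r lerDl.
have S4 := ler_wpM2l (ltW eB) S2.
rewrite -[phi _](subrK (\sum_i phi (c i t))) -addrA (le_trans (ler_normD _ _))//.
by move: hP S1 S3 S4; lra.
Qed.

Lemma one_param_prod (I : finType) (c : I -> R -> G) : (forall i, one_param (c i)) ->
  (forall i j s t, commute (c i s) (c j t)) -> one_param (fun t => \prod_i c i t)%g.
Proof.
move=> cD H s t; rewrite -prodgM_commute; last by move=> i j _ _; exact: H.
by apply: eq_bigr => i _; exact: cD.
Qed.

End ProductsOfCurves.

(** * The Lie algebra of a product of subgroups *)

Section ProductSubgroups.
Variables (R : realType) (G : lieGroupType R) (p : nat) (Gs : 'I_p -> set G).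
Local Notation n := (@lie_dim R G).
Local Notation E := 'rV[R]_n.
Local Notation c1 := (@chart1 R G).
Hypotheses (cG : compact [set: G]) (sGs : forall i, subgroup (Gs i))
  (cGs : forall i, compact (Gs i)) (dp : direct_product Gs).

Lemma direct_product_eq1 (y : 'I_p -> G) : (forall i, Gs i (y i)) ->
  (\prod_i y i)%g = 1%g -> forall i, y i = 1%g.
Proof.
move=> Gy y1 i; have [_ /(_ 1%g)[k [_ kU]]] := dp.
have E1 : k = [ffun i => y i].
  apply: kU; split=> [j|]; first by rewrite ffunE.
  by apply: etrans (esym y1) _; apply: eq_bigr => j _; rewrite ffunE.
have E2 : k = [ffun=> 1%g].
  apply: kU; split=> [j|]; first by rewrite ffunE; exact: (sGs j).1.
  by rewrite big1// => j _; rewrite ffunE.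
by have /ffunP/(_ i) := etrans (esym E1) E2; rewrite !ffunE.
Qed.

Lemma prod_single (i : 'I_p) (x : G) : (\prod_j (if j == i then x else 1))%g = x.
Proof. by rewrite -big_mkcond big_pred1_eq. Qed.

(** The product of the one-parameter groups of the [Y i] is a one-parameter group with velocity 0,
    hence trivial; uniqueness of factorisations in [G] then makes each factor trivial. *)
Lemma lie_algebra_direct (Y : 'I_p -> E) : (forall i, lie_algebra (Gs i) (Y i)) ->
  \sum_i Y i = 0 -> forall i, Y i = 0.
Proof.
move=> LY Y0.
have /choice[c Hc] i : exists c, [/\ one_param c, forall t, Gs i (c t) & velocity c (Y i)].
  by apply/lie_algebraP.
have comm i j s t : commute (c i s) (c j t).
  have [_ Gi _] := Hc i; have [cD Gj _] := Hc j; have [->|ij] := eqVneq i j.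
    exact: one_param_commute.
  by have [H _] := dp; exact: (H i j).
have vc i : velocity (c i) (Y i) by have [] := Hc i.
have cD i : one_param (c i) by have [] := Hc i.
have v0 := velocity_prod vc; rewrite Y0 in v0.
have D0 := one_param_prod cD comm.
have D1 : one_param (fun _ : R => 1%g : G) by move=> s t; rewrite mulg1.
have v1 : velocity (fun _ : R => 1%g : G) 0.
  move=> eps ep0; exists 1 => // t _; split; first exact: dom1.
  by rewrite phi1 scaler0 subrr normr0 mulr_ge0// ltW.
have E1 := one_param_unique D0 D1 v0 v1.
move=> i; apply: (velocity_unique (cD i) (vc i)).
have -> : c i = fun=> 1%g.
  apply/funext => t; apply: (direct_product_eq1 (y := fun j => c j t)) => [j|]; last exact: E1.
  by have [] := Hc j.
exact: v1.
Qed.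

Variable Hs : 'I_p -> set G.
Hypotheses (sHs : forall i, subgroup (Hs i)) (cHs : forall i, compact (Hs i))
  (HG : forall i, Hs i `<=` Gs i).

Lemma product_set_subgroup : subgroup (product_set Hs).
Proof.
split.
  exists (fun=> 1%g); split; last by rewrite big1.
  by move=> i; exact: (sHs i).1.
move=> _ _ [h [Hh ->]] [k [Hk ->]].
have comm i j x y : i != j -> Hs i x -> Hs j y -> commute x y.
  by move=> ij Hx Hy; have [H _] := dp; apply: (H i j) => //; exact: HG.
exists (fun i => h i * (k i)^-1)%g; split; first by move=> i; exact: (sHs i).2.
apply: (@mulIg _ (\prod_i k i)%g); rewrite mulgVK.
have aux (s : seq 'I_p) : uniq s -> (\prod_(i <- s) (h i * (k i)^-1) * \prod_(i <- s) k i = \prod_(i <- s) h i)%g.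
  elim: s => [|i s IH] /=; first by rewrite !big_nil mulg1.
  move=> /andP[nis us]; rewrite !big_cons -(IH us).
  have c2 : commute (k i) (\prod_(j <- s) (h j * (k j)^-1))%g.
    rewrite big_seq; apply: commute_prod => j js.
    have ij : i != j by apply: contraNneq nis => ->.
    by apply: (comm i j) => //; exact: (sHs j).2.
  by rewrite -!mulgA; congr (_ * _)%g; rewrite (mulgA _ (k i)) -c2 !mulgA mulVg mul1g.
by rewrite aux// index_enum_uniq.
Qed.

(** Chosen factors of the points converge along an ultrafilter, each in its compact [Hs i], and the
    product of the limits is the limit. *)
Lemma product_set_compact : compact (product_set Hs).
Proof.
rewrite compact_ultra => F UF Fp.
have PF : ProperFilter F by exact: ultra_proper.
pose h (x : G) : 'I_p -> G := if pselect (product_set Hs x) is left e then sval (cid e) else (fun=> 1%g).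
have hP x : product_set Hs x -> (forall i, Hs i (h x i)) /\ x = (\prod_i h x i)%g.
  by move=> e; rewrite /h; case: pselect => // e'; exact: (svalP (cid e')).
have /choice[l Hl] i : exists l, Hs i l /\ h^~ i @ F --> l.
  have [|l Hl hl] := ultra_compact_lim (f := h^~ i) UF (@cHs i); last by exists l; split.
  by apply: filterS Fp => x /hP[].
exists (\prod_i l i)%g; split.
  by exists l; split=> // i; have [] := Hl i.
have lim (s : seq 'I_p) : (fun x => \prod_(i <- s) h x i)%g @ F --> (\prod_(i <- s) l i)%g.
  elim: s => [|i s IH]; first by under eq_fun do rewrite big_nil; rewrite big_nil; exact: cvg_cst.
  under eq_fun do rewrite big_cons; rewrite big_cons.
  by apply: cvg_mulg => //; have [] := Hl i.
have := lim (index_enum _); apply: cvg_trans.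
by apply: (@near_eq_cvg _ _ F _ (fun x => \prod_i h x i)%g id); apply: filterS Fp => x /hP[].
Qed.

Lemma sub_product_set i : Hs i `<=` product_set Hs.
Proof.
move=> x Hx; exists (fun j => if j == i then x else 1%g); rewrite prod_single; split=> // j.
by case: eqP => [->//|_]; exact: (sHs j).1.
Qed.

(* The components of a sequence tangent to [X], rescaled so that the largest of them
   and of the sequence itself stays of order 1, have limits [Y i] whose sum is
   [theta *: X]; directness of the sum excludes [theta = 0]. *)
Lemma lie_algebra_product_set X : lie_algebra (product_set Hs) X <->
  exists Y : 'I_p -> E, (forall i, lie_algebra (Hs i) (Y i)) /\ X = \sum_i Y i.
Proof.
have sP := product_set_subgroup; have cP := product_set_compact.
split; last first.
  move=> [Y [HY ->]]; elim/big_ind: _ => //.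
  - exact: lie_algebra0.
  - by move=> u v; exact: lie_algebraD.
  - by move=> i _; apply: lie_algebra_mono (HY i); exact: sub_product_set.
move=> /(lie_algebra_tangentP _ sP cP) tX.
have /choice[xs Hxs] : forall k : nat, exists x, exists r : R, [/\ product_set Hs x, 0 < r,
    r^-1 < k.+1%:R^-1, near1 k.+1%:R^-1 x & `|r *: phi x - X| < k.+1%:R^-1].
  by move=> k; apply: tX; rewrite invr_gt0.
have {Hxs} /choice[rs Hs'] := Hxs.
have /choice[y Hy] k : exists y : 'I_p -> G, (forall i, Hs i (y i)) /\ xs k = (\prod_i y i)%g.
  by have [[y [? ?]] _ _ _ _] := Hs' k; exists y.
have [U UU ooU] := ultra_oo.
have PU : ProperFilter U by exact: ultra_proper.
have inv0 (e : R) : 0 < e -> \forall k \near U, k.+1%:R^-1 < e.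
  move=> e0; apply: ooU; have := near_infty_natSinv_lt (PosNum e0).
  by apply: filterS.
have /choice[l Hl] i : exists l, Hs i l /\ y^~ i @ U --> l.
  have [|l Hl hl] := ultra_compact_lim (f := y^~ i) UU (@cHs i); last by exists l; split.
  by apply: filterE => k; have [] := Hy k.
have lim (s : seq 'I_p) : (fun k => \prod_(i <- s) y k i)%g @ U --> (\prod_(i <- s) l i)%g.
  elim: s => [|i s IH]; first by under eq_fun do rewrite big_nil; rewrite big_nil; exact: cvg_cst.
  under eq_fun do rewrite big_cons; rewrite big_cons.
  by apply: cvg_mulg => //; have [] := Hl i.
have x1 : xs @ U --> (1%g : G).
  move=> A /nbhs_near1[r r0 HA]; have := inv0 r r0; apply: filterS => k kr; apply: HA.
  by have [_ _ _ + _] := Hs' k; apply: near1_le; exact: ltW.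
have l1 : (\prod_i l i)%g = 1%g.
  apply: (@cvg_unique _ (@lie_hausdorff R G) (xs @ U)) => //.
  have := lim (index_enum _); apply: cvg_trans; apply: near_eq_cvg; apply: filterE => k.
  by have [_ ->] := Hy k.
have li i : l i = 1%g.
  by apply: direct_product_eq1 => // j; apply: HG; have [] := Hl j.
have yn r : 0 < r -> \forall k \near U, forall i, near1 r (y k i).
  move=> r0; apply: filter_forall => i; have [_ yl] := Hl i; rewrite li in yl.
  exact: yl _ (near1_nbhs G r0).
(* At this scale the norms of the rescaled components and the factor [(rs k)^-1 / S k] add up to
   exactly 1, so their limits cannot all vanish. *)
pose S k : R := \sum_i `|phi (y k i)| + (rs k)^-1.
have sum0 k : 0 <= \sum_i `|phi (y k i)| by apply: sumr_ge0.
have rk k : 0 < rs k by have [] := Hs' k.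
have rV k : 0 < (rs k)^-1 by rewrite invr_gt0.
have S0 k : 0 < S k by rewrite ltr_wpDl.
have phiS k i : `|phi (y k i)| <= S k.
  rewrite /S (bigD1 i)//= -addrA lerDl addr_ge0 ?(ltW (rV k))//; exact: sumr_ge0.
have Ssmall e : 0 < e -> \forall k \near U, S k < e.
  move=> e0; have p0 : 0 < 2 * p.+1%:R :> R by rewrite mulr_gt0.
  have e20 : 0 < e / 2 by rewrite divr_gt0.
  apply: filterS2 (yn _ (divr_gt0 e0 p0)) (inv0 _ e20) => k h1 h2.
  have [_ _ h3 _ _] := Hs' k.
  have : \sum_i `|phi (y k i)| <= \sum_(i < p) e / (2 * p.+1%:R).
    by apply: ler_sum => i _; apply: ltW; exact: (h1 i).2.
  rewrite sumr_const card_ord.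
  have : (e / (2 * p.+1%:R)) *+ p <= e / 2.
    rewrite -[leLHS]mulr_natl mulrCA ler_wpM2l ?(ltW e0)// ler_pdivrMr// mulrA mulVf// mul1r ler_nat//.
  by move: h2 h3; rewrite /S; set j := k.+1%:R^-1; set q := (rs k)^-1; set A := _ *+ p; move: A j q => A j q; lra.
have /choice[Y HYl] i : exists Y : E, (fun k => (S k)^-1 *: phi (y k i)) @ U --> Y.
  have [|Y _ hY] := ultra_compact_lim (f := fun k => (S k)^-1 *: phi (y k i)) UU (@compact_norm_le R n 1); last by exists Y; exact: hY.
  apply: filterE => k; rewrite /= normrZ gtr0_norm ?invr_gt0//.
  by rewrite ler_pdivrMl// mulr1.
have [|th _ hth] := ultra_compact_lim (f := fun k => (rs k)^-1 / S k : R) UU (@segment_compact R 0 1).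
  apply: filterE => k; rewrite /= in_itv /= divr_ge0 ?(ltW (rV k)) ?(ltW (S0 k))//=.
  by rewrite ler_pdivrMr// mul1r lerDr.
have HY i : lie_algebra (Hs i) (Y i).
  apply/lie_algebra_tangentP => // e e0.
  have h : \forall k \near U, `|(S k)^-1 *: phi (y k i) - Y i| < e.
    by move/cvgrPdist_lt: (HYl i) => /(_ _ e0); apply: filterS => k; rewrite distrC.
  have [k [[k1 k2] k3]] := filter_ex (filterI (filterI (Ssmall e e0) (yn e e0)) h).
  exists (y k i), (S k)^-1; split=> //; rewrite ?invr_gt0 ?invrK//.
  by have [] := Hy k.
have sumY : (fun k => \sum_i (S k)^-1 *: phi (y k i)) @ U --> \sum_i Y i.
  elim: (index_enum _) => [|i s IH].
    by under eq_fun do rewrite big_nil; rewrite big_nil; exact: cvg_cst.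
  under eq_fun do rewrite big_cons; rewrite big_cons.
  by apply: cvgD.
have thX : \sum_i Y i = th *: X.
  apply/eqP; rewrite -subr_eq0 -normr_le0; apply: (lim_norm_le _ sumY) => eta eta0.
  rewrite add0r; have e30 : 0 < eta / 3 by rewrite divr_gt0.
  have [r r0 Hr] := @phi_prod_est R G _ (index_enum 'I_p) _ e30.
  have X1 : 0 < 3 * (`|X| + 1) by rewrite mulr_gt0// ltr_wpDl.
  have h1 : \forall k \near U, `|(rs k)^-1 / S k - th| <= eta / (3 * (`|X| + 1)).
    by move/cvgrPdist_le: hth => /(_ _ (divr_gt0 eta0 X1)); apply: filterS => k; rewrite distrC.
  apply: filterS2 (filterI h1 (yn r r0)) (inv0 _ e30) => k [k1 k2] k3.
  have [_ _ _ _ k4] := Hs' k; have [_ xE] := Hy k.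
  have [_ k5] := Hr (y k) k2; rewrite -xE in k5.
  rewrite -scaler_sumr.
  have -> : (S k)^-1 *: (\sum_i phi (y k i)) - th *: X =
     - ((S k)^-1 *: (phi (xs k) - \sum_i phi (y k i))) +
     (((rs k)^-1 / S k) *: (rs k *: phi (xs k) - X) + ((rs k)^-1 / S k - th) *: X).
    apply/rowP => j; rewrite !mxE; move: (rk k) (S0 k) => a b.
    by field; rewrite !lt0r_neq0.
  have q0 : 0 <= (rs k)^-1 / S k by rewrite divr_ge0 ?(ltW (rV k)) ?(ltW (S0 k)).
  have q1 : (rs k)^-1 / S k <= 1 by rewrite ler_pdivrMr// mul1r lerDr.
  have n1 : `|(S k)^-1 *: (phi (xs k) - \sum_i phi (y k i))| <= eta / 3.
    rewrite normrZ gtr0_norm ?invr_gt0// ler_pdivrMl// mulrC (le_trans k5)//.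
    by rewrite (ler_wpM2l (ltW e30))// lerDl ltW.
  have n2 : `|((rs k)^-1 / S k) *: (rs k *: phi (xs k) - X)| <= eta / 3.
    rewrite normrZ ger0_norm// (le_trans _ (ltW (lt_trans k4 k3)))// ler_piMl//.
  have n3 : `|((rs k)^-1 / S k - th) *: X| <= eta / 3.
    rewrite normrZ (le_trans (ler_wpM2r _ k1))//.
    have -> : eta / (3 * (`|X| + 1)) * `|X| = eta / 3 * (`|X| / (`|X| + 1)).
      by field; rewrite lt0r_neq0// ltr_wpDl.
    rewrite -[leRHS]mulr1 (ler_wpM2l (ltW e30))// ler_pdivrMr ?ltr_wpDl//.
    by rewrite mul1r lerDl.
  apply: le_trans (ler_normD _ _) _; rewrite normrN.
  have := ler_normD (((rs k)^-1 / S k) *: (rs k *: phi (xs k) - X)) (((rs k)^-1 / S k - th) *: X).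
  by move: n1 n2 n3; lra.
have [th0|thN] := eqVneq th 0.
  rewrite th0 scale0r in thX.
  have YG i : lie_algebra (Gs i) (Y i) by apply: lie_algebra_mono (HY i); exact: HG.
  have Y0 := lie_algebra_direct YG thX.
  exfalso; have p0 : 0 < 2 * p.+1%:R :> R by rewrite mulr_gt0.
  have h1 : \forall k \near U, forall i, `|(S k)^-1 *: phi (y k i)| < (2 * p.+1%:R)^-1.
    apply: filter_forall => i; have ip : 0 < (2 * p.+1%:R)^-1 :> R by rewrite invr_gt0.
    move/cvgrPdist_lt: (HYl i) => /(_ _ ip); apply: filterS => k.
    by rewrite Y0 sub0r normrN.
  have h2 : \forall k \near U, `|(rs k)^-1 / S k| < 2^-1.
    have ip : 0 < 2^-1 :> R by rewrite invr_gt0.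
    move/cvgrPdist_lt: hth => /(_ _ ip); apply: filterS => k.
    by rewrite th0 sub0r normrN.
  have [k [k1 k2]] := filter_ex (filterI h1 h2).
  have : 1 = \sum_i `|(S k)^-1 *: phi (y k i)| + `|(rs k)^-1 / S k|.
    under eq_bigr do rewrite normrZ (gtr0_norm (_ : 0 < (S k)^-1)) ?invr_gt0//.
    rewrite -mulr_sumr (gtr0_norm (divr_gt0 (rV k) (S0 k))) [_ / S k]mulrC -mulrDr.
    by rewrite mulVf// lt0r_neq0.
  have : \sum_i `|(S k)^-1 *: phi (y k i)| <= \sum_(i < p) (2 * p.+1%:R)^-1.
    by apply: ler_sum => i _; apply: ltW; exact: k1.
  rewrite sumr_const card_ord.
  have : (2 * p.+1%:R)^-1 *+ p <= 2^-1 :> R.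
    rewrite -[leLHS]mulr_natl invfM mulrCA -[leRHS]mulr1 ler_wpM2l// ler_pdivrMr// mul1r ler_nat//.
  by move: k2; set A := _ *+ p; set q := `|(rs k)^-1 / S k|; move: A q => A q; lra.
exists (fun i => th^-1 *: Y i); split; first by move=> i; exact: lie_algebraZ.
by rewrite -scaler_sumr thX scalerA mulVf// scale1r.
Qed.

End ProductSubgroups.

(** * Intermediate subalgebras of a product *)

Section IntermediateSubalgebras.
Variables (R : realType) (G : lieGroupType R) (p : nat) (Gs Hs : 'I_p -> set G).
Local Notation n := (@lie_dim R G).
Local Notation E := 'rV[R]_n.
Hypotheses (cG : compact [set: G])
  (cGs : forall i, compact_connected_subgroup (Gs i))
  (cHs : forall i, compact_connected_subgroup (Hs i))
  (dp : direct_product Gs) (HG : forall i, Hs i `<` Gs i)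
  (dimN : forall i, subgroup_dim (normalizer (Gs i) (Hs i)) = subgroup_dim (Hs i)).
Variables (b t : 'I_p -> {vspace E}).
Hypotheses (bE : forall i, [set` b i] = lie_algebra (Hs i))
  (tE : forall i, [set` t i] = lie_algebra (Gs i)).

Let sGs i : subgroup (Gs i). Proof. by have [] := cGs i. Qed.
Let sHs i : subgroup (Hs i). Proof. by have [] := cHs i. Qed.
Let kGs i : compact (Gs i). Proof. by have [] := cGs i. Qed.
Let kHs i : compact (Hs i). Proof. by have [] := cHs i. Qed.
Let HsG i : Hs i `<=` Gs i. Proof. by have [] := HG i. Qed.

Let bP i X : X \in b i <-> lie_algebra (Hs i) X. Proof. by rewrite -bE. Qed.
Let tP i X : X \in t i <-> lie_algebra (Gs i) X. Proof. by rewrite -tE. Qed.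

Lemma lie_bt i : (b i <= t i)%VS.
Proof. by apply/subvP => X /bP HX; apply/tP; exact: lie_algebra_mono HX. Qed.

Lemma lie_bt_neq i : b i != t i.
Proof.
apply/eqP => bt; have [_ nGH] := HG i; apply: nGH.
have [_ _ _ coG] := cGs i.
apply: (connected_subgroup_le (@sHs i) (@kHs i) (@sGs i) (@kGs i) coG (@HsG i)).
by move=> X /tP; rewrite -bt => /bP.
Qed.

Lemma lie_b_subalgebra i : lie_subalgebra (b i).
Proof. by move=> X Y /bP HX /bP HY; apply/bP; exact: (lie_algebra_bracket (@sHs i) (@kHs i) cG). Qed.

Lemma lie_t_subalgebra i : lie_subalgebra (t i).
Proof. by move=> X Y /tP HX /tP HY; apply/tP; exact: (lie_algebra_bracket (@sGs i) (@kGs i) cG). Qed.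

Lemma lie_decomposition X : exists Y : 'I_p -> E, (forall i, Y i \in t i) /\ X = \sum_i Y i.
Proof.
have GT : product_set Gs = [set: G].
  apply/seteqP; split=> // x _; have [_ /(_ x)[k [[kG ->] _]]] := dp.
  by exists k.
have [c [cD vc]] := exp_exists X cG.
have LX : lie_algebra (product_set Gs) X by rewrite GT; exact: (one_param_lie_algebra cD).
have [Y [HY XY]] := (lie_algebra_product_set sGs kGs dp sGs kGs (fun i => @subset_refl _ (Gs i)) X).1 LX.
by exists Y; split=> // i; apply/tP.
Qed.

Lemma lie_setT X : lie_algebra [set: G] X.
Proof.
have [c [cD vc]] := exp_exists X cG; exact: (one_param_lie_algebra cD).
Qed.

Lemma lie_decomposition_unique (Y Z : 'I_p -> E) : (forall i, Y i \in t i) ->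
  (forall i, Z i \in t i) -> \sum_i Y i = \sum_i Z i -> forall i, Y i = Z i.
Proof.
move=> HY HZ YZ i; apply/eqP; rewrite -subr_eq0; apply/eqP.
apply: (lie_algebra_direct sGs kGs dp (Y := fun i => Y i - Z i)) => [j|].
  by apply/tP; exact: rpredB.
by rewrite sumrB YZ subrr.
Qed.

Lemma lie_productP X : lie_algebra (product_set Hs) X <->
  exists Y : 'I_p -> E, (forall i, Y i \in b i) /\ X = \sum_i Y i.
Proof.
rewrite (lie_algebra_product_set sGs kGs dp sHs kHs HsG).
by split=> -[Y [HY ->]]; exists Y; split=> // i; apply/bP.
Qed.

Lemma lie_bracket_t0 i j X Y : i != j -> X \in t i -> Y \in t j -> lie_bracket X Y = 0.
Proof.
move=> ij /tP /(lie_algebraP _ (@sGs i) (@kGs i))[c [cD Gc vc]].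
move=> /tP /(lie_algebraP _ (@sGs j) (@kGs j))[d [dD Gd vd]].
by apply: (commute_bracket0 cD vc dD vd) => s u; have [H _] := dp; exact: (H i j).
Qed.

Lemma Ad_t_fixed i j x Y : i != j -> Gs i x -> Y \in t j -> Ad x Y = Y.
Proof.
move=> ij Gx /tP /(lie_algebraP _ (@sGs j) (@kGs j))[d [dD Gd vd]].
by apply: (commute_Ad_fixed dD vd) => s; have [H _] := dp; exact: (H i j).
Qed.

Lemma linear_sum_mem (L : E -> E) (k : {vspace E}) (Y : 'I_p -> E) : linear_bounded L ->
  (forall j, L (Y j) \in k) -> L (\sum_j Y j) \in k.
Proof.
move=> lL H; apply: (big_ind (fun u => L u \in k)) => //.
- by have := linear_boundedB 0 0 lL; rewrite !subrr => ->; exact: mem0v.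
- by move=> u v hu hv; have := lL.1 1 u v; rewrite !scale1r => ->; exact: memvD.
Qed.

Lemma bracket_sum_mem (k : {vspace E}) (X Y : 'I_p -> E) :
  (forall i j, lie_bracket (X i) (Y j) \in k) -> lie_bracket (\sum_i X i) (\sum_j Y j) \in k.
Proof.
move=> H; apply: (linear_sum_mem (L := fun W => lie_bracket W (\sum_j Y j))).
  exact: lie_bracket_linearl.
move=> i; apply: (linear_sum_mem (L := lie_bracket (X i))) => //.
by apply: linear_bounded_rV => a u v; exact: lie_bracket_linearr.
Qed.

Local Notation P := (intermediate_subalgebra [set: G] (product_set Hs)).

Lemma intermediate_b k i : P k -> (b i <= k)%VS.
Proof.
move=> [_ [Hk _] _]; apply/subvP => X /bP HX; apply: Hk.
by apply: lie_algebra_mono HX; exact: sub_product_set.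
Qed.

Lemma intermediate_component k (Y : 'I_p -> E) : P k -> (forall i, Y i \in t i) ->
  \sum_i Y i \in k -> forall i, Y i \in k.
Proof.
move=> Pk HY Xk i; have [subk _ _] := Pk.
(* Working in [k :&: t i] rather than in [k] keeps the fixed point in [t i], where
   [fixed_in_lie_algebra] applies. *)
have Ka x W : Hs i x -> W \in (k :&: t i)%VS -> Ad x W \in (k :&: t i)%VS.
  move=> Hx; rewrite !memv_cap => /andP[Wk Wt]; apply/andP; split.
    have [_ _ _ coH] := cHs i.
    apply: (Ad_subgroup_subalgebra cG (@sHs i) (@kHs i) coH subk _ Hx Wk).
    by move=> Z /bP; exact/subvP/intermediate_b.
  apply/tP; apply: (lie_algebra_Ad (@sGs i) (@kGs i)); last exact/tP.
  move=> y Gy; have Gx := HsG Hx; apply: subgroupM => //; last exact: subgroupV.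
  exact: subgroupM.
have KX x : Hs i x -> Ad x (Y i) - Y i \in (k :&: t i)%VS.
  move=> Hx; have Gx := HsG Hx; rewrite memv_cap; apply/andP; split; last first.
    rewrite rpredB//; apply/tP; apply: (lie_algebra_Ad (@sGs i) (@kGs i)); last exact/tP.
    by move=> y Gy; apply: subgroupM => //; [exact: subgroupM|exact: subgroupV].
  have Adk : Ad x (\sum_j Y j) \in k.
    have [_ _ _ coH] := cHs i.
    apply: (Ad_subgroup_subalgebra cG (@sHs i) (@kHs i) coH subk _ Hx Xk).
    by move=> Z /bP; exact/subvP/intermediate_b.
  have -> : Ad x (Y i) - Y i = Ad x (\sum_j Y j) - \sum_j Y j.
    rewrite (bigD1 i)//= -[Y i in RHS]scale1r (Ad_linear x).1 !scale1r.
    have -> : Ad x (\sum_(j < p | j != i) Y j) = \sum_(j < p | j != i) Y j.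
      elim/big_ind: _ => [|u v hu hv|j ji].
      - by have := linear_boundedB 0 0 (Ad_linear x); rewrite !subrr.
      - by rewrite -[u in LHS]scale1r (Ad_linear x).1 scale1r hu hv.
      - by apply: (@Ad_t_fixed i j) => //; rewrite eq_sym.
    by rewrite opprD addrACA subrr addr0.
  exact: rpredB.
have [Z ZY fixZ] := Ad_fixed_point cG (@sHs i) Ka KX.
move: ZY; rewrite memv_cap => /andP[ZYk ZYt].
have Zt : Z \in t i by rewrite -(subrK (Y i) Z) rpredD.
have Zb : Z \in b i.
  apply/bP; apply: (fixed_in_lie_algebra (@sGs i) (@kGs i) (@sHs i) (@kHs i) (@HsG i)) => //.
  exact/tP.
have Zk : Z \in k by apply: (subvP (intermediate_b i Pk)).
by rewrite -(subKr Z (Y i)) rpredB.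
Qed.

Definition component (i : 'I_p) (k : {vspace E}) : {vspace E} := (k :&: t i)%VS.

Lemma component_le k l : P k -> P l ->
  (k <= l)%VS <-> (forall i, (component i k <= component i l)%VS).
Proof.
move=> Pk Pl; split=> [kl i|H]; first by rewrite capvS.
apply/subvP => X Xk; have [Y [HY XY]] := lie_decomposition X.
rewrite XY in Xk *; apply: memv_suml => i _.
have : Y i \in component i k by rewrite memv_cap HY (intermediate_component Pk HY Xk).
by move/(subvP (H i)); rewrite memv_cap => /andP[].
Qed.

Lemma component_mem k i : P k -> [\/ intermediate_subalgebra (Gs i) (Hs i) (component i k),
  component i k = b i | component i k = t i].
Proof.
move=> Pk; have [->|kb] := eqVneq (component i k) (b i); first by constructor 2.
have [->|kt] := eqVneq (component i k) (t i); first by constructor 3.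
constructor 1; have [subk _ _] := Pk.
have bk : (b i <= component i k)%VS by rewrite subv_cap (intermediate_b i Pk) lie_bt.
have tk : (component i k <= t i)%VS by exact: capvSr.
split.
- move=> X Y; rewrite !memv_cap => /andP[Xk Xt] /andP[Yk Yt].
  by rewrite subk//= lie_t_subalgebra.
- rewrite -bE; split; first exact/subvP.
  by move=> /subvP kb'; move: kb; rewrite eqEsubv kb' bk.
- rewrite -tE; split; first exact/subvP.
  by move=> /subvP tk'; move: kt; rewrite eqEsubv tk tk'.
Qed.

Lemma component_proper k : P k ->
  (exists i, component i k <> b i) /\ (exists i, component i k <> t i).
Proof.
move=> Pk; have [_ [_ nH] [_ nT]] := Pk; split; apply: contrapT => no.
- have H i : component i k = b i by apply: contrapT => h; apply: no; exists i.
  apply: nH => X Xk; have [Y [HY XY]] := lie_decomposition X.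
  apply/lie_productP; exists Y; split=> // i.
  by rewrite -H memv_cap HY (intermediate_component Pk HY)// -XY.
- have H i : component i k = t i by apply: contrapT => h; apply: no; exists i.
  apply: nT => X _; have [Y [HY ->]] := lie_decomposition X.
  apply: memv_suml => i _; have : Y i \in component i k by rewrite H.
  by rewrite memv_cap => /andP[].
Qed.

(** The sum of the [v i] is a subalgebra since brackets between different factors vanish, and its
    components are the [v i] because the sum of the [t i] is direct. *)
Lemma component_surj (v : 'I_p -> {vspace E}) :
  (forall i, [\/ intermediate_subalgebra (Gs i) (Hs i) (v i), v i = b i | v i = t i]) ->
  (exists i, v i <> b i) -> (exists i, v i <> t i) ->
  exists k, P k /\ forall i, component i k = v i.
Proof.
move=> Hv [ib vb] [it vt].
have vsub i : lie_subalgebra (v i).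
  by case: (Hv i) => [[]//|->|->]; [exact: lie_b_subalgebra|exact: lie_t_subalgebra].
have bv i : (b i <= v i)%VS.
  case: (Hv i) => [[_ [h _] _]|->|->]; [|exact: subvv|exact: lie_bt].
  by apply/subvP => X /bP; exact: h.
have tv i : (v i <= t i)%VS.
  case: (Hv i) => [[_ _ [h _]]|->|->]; [|exact: lie_bt|exact: subvv].
  by apply/subvP => X Xv; apply/tP; exact: h.
pose k := (\sum_i v i)%VS.
have vk i : (v i <= k)%VS by exact: sumv_sup.
have ck i : component i k = v i.
  apply/eqP; rewrite eqEsubv subv_cap vk tv !andbT.
  apply/subvP => X; rewrite memv_cap => /andP[/memv_sumP[u uv Xu] Xt].
  have /(_ i) : forall j, u j = (if j == i then X else 0).
    apply: lie_decomposition_unique => [j|j|].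
    - by apply: (subvP (tv j)); exact: uv.
    - by case: eqP => [->//|_]; exact: mem0v.
    - by rewrite -Xu -big_mkcond big_pred1_eq.
  by rewrite eqxx => <-; exact: uv.
exists k; split=> //; split.
- move=> X Y /memv_sumP[u uv ->] /memv_sumP[w wv ->].
  apply: bracket_sum_mem => i j; have [<-|ij] := eqVneq i j.
    by apply: (subvP (vk i)); apply: vsub; [exact: uv|exact: wv].
  rewrite (lie_bracket_t0 ij) ?mem0v//; [apply: (subvP (tv i))|apply: (subvP (tv j))].
    exact: uv.
  exact: wv.
- split.
    move=> X /lie_productP[Y [HY ->]]; apply: memv_suml => i _.
    by apply: (subvP (vk i)); apply: (subvP (bv i)).
  move=> H; apply: vb; apply/eqP; rewrite eqEsubv bv andbT; apply/subvP => X Xv.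
  have /H /lie_productP[Y [HY XY]] : X \in k by apply: (subvP (vk ib)).
  have /(_ ib) : forall j, Y j = (if j == ib then X else 0).
    apply: lie_decomposition_unique => [j|j|].
    - exact: (subvP (lie_bt j)).
    - by case: eqP => [->|_]; [exact: (subvP (tv ib))|exact: mem0v].
    - by rewrite -XY -big_mkcond big_pred1_eq.
  by rewrite eqxx => <-.
- split; first by move=> X _; exact: lie_setT.
  move=> H; apply: vt; apply/eqP; rewrite eqEsubv tv /=; apply/subvP => X Xt.
  by rewrite -ck memv_cap Xt andbT; apply: H; exact: lie_setT.
Qed.

End IntermediateSubalgebras.

(** * Measures of finite support and joins *)

Section FiniteMass.
Variables (R : realType) (V : choiceType).
Implicit Types (x y : V -> R) (A B : set V) (s : {fset V}).

Definition finite_mass x : Prop :=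
  (forall v, 0 <= x v) /\ exists s, forall v, v \notin s -> x v = 0.

(** A finitely supported sum over the whole type, because the supports of nearby points of an order
    complex need not lie in one finite set. *)
Definition mass A x : R := \sum_(v \in [set: V]) (if `[<A v>] then x v else 0).

Lemma massE A x s : (forall v, v \notin s -> x v = 0) ->
  mass A x = \sum_(v <- s) (if `[<A v>] then x v else 0).
Proof. by move=> x0; apply: fsbigTE => v /x0 ->; case: ifP. Qed.

Lemma mass_setTE x s : (forall v, v \notin s -> x v = 0) ->
  mass setT x = \sum_(v <- s) x v.
Proof. by move=> /massE ->; apply: eq_bigr => v _; rewrite asboolT. Qed.

Lemma le_mass A B x : finite_mass x -> (forall v, x v != 0 -> A v -> B v) ->
  mass A x <= mass B x.
Proof.
move=> [x0 [s sx]] AB; rewrite !(massE _ sx); apply: ler_sum => v _.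
case: asboolP => [Av|_]; last by case: ifP.
by have [->|/AB/(_ Av) Bv] := eqVneq (x v) 0; [rewrite if_same|rewrite asboolT].
Qed.

Lemma eq_mass A B x : finite_mass x -> (forall v, x v != 0 -> A v <-> B v) ->
  mass A x = mass B x.
Proof. by move=> Fx AB; apply/le_anti/andP; split; apply: le_mass => // v /AB[]. Qed.

Lemma mass_set0 A x : finite_mass x -> (forall v, x v != 0 -> ~ A v) -> mass A x = 0.
Proof.
move=> [x0 [s sx]] AB; rewrite (massE _ sx); apply: big1 => v _.
by case: asboolP => // Av; apply: contrapT => /eqP/AB.
Qed.

Lemma mass_ge0 A x : finite_mass x -> 0 <= mass A x.
Proof. by move=> [x0 [s sx]]; rewrite (massE _ sx); apply: sumr_ge0 => v _; case: ifP. Qed.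

Lemma mass_setU A B x : finite_mass x -> (forall v, x v != 0 -> A v -> ~ B v) ->
  mass (A `|` B) x = mass A x + mass B x.
Proof.
move=> [x0 [s sx]] AB; rewrite !(massE _ sx) -big_split; apply: eq_bigr => v _ /=.
have [->|/AB xv] := eqVneq (x v) 0; first by rewrite !if_same addr0.
case: (asboolP (A v)) => [Av|nA].
  by rewrite (asboolT (or_introl Av)) asboolF ?addr0//; exact: xv.
case: (asboolP (B v)) => [Bv|nB]; first by rewrite (asboolT (or_intror Bv)) add0r.
by rewrite asboolF ?addr0// => -[].
Qed.

Lemma mass_setC A x : finite_mass x -> mass A x + mass (~` A) x = mass setT x.
Proof. by move=> Fx; rewrite -mass_setU ?setUv// => v _ Av. Qed.

Lemma mass_set1 v x : finite_mass x -> mass [set v] x = x v.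
Proof.
move=> [x0 [s sx]]; have sx' u : u \notin (v |` s)%fset -> x u = 0.
  by rewrite !inE negb_or => /andP[_ /sx].
rewrite (massE _ sx') (big_fsetD1 v) ?fset1U1//= asboolT// big_seq big1 ?addr0// => u.
by rewrite !inE => /andP[/eqP uv _]; rewrite asboolF.
Qed.

Lemma finite_massD x y : finite_mass x -> finite_mass y -> finite_mass (fun v => x v + y v).
Proof.
move=> [x0 [s sx]] [y0 [u uy]]; split=> [v|]; first by rewrite addr_ge0.
by exists (s `|` u)%fset => v; rewrite !inE negb_or => /andP[/sx -> /uy ->]; rewrite addr0.
Qed.

Lemma massD A x y : finite_mass x -> finite_mass y ->
  mass A (fun v => x v + y v) = mass A x + mass A y.
Proof.
move=> [x0 [s sx]] [y0 [u uy]].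
have sx' v : v \notin (s `|` u)%fset -> x v = 0 by rewrite !inE negb_or => /andP[/sx].
have uy' v : v \notin (s `|` u)%fset -> y v = 0 by rewrite !inE negb_or => /andP[_ /uy].
rewrite (massE _ sx') (massE _ uy') (@massE A (fun v => x v + y v) (s `|` u)%fset) -?big_split => [|v vs].
  by apply: eq_bigr => v _ /=; case: ifP; rewrite ?addr0.
by rewrite sx' ?uy' ?addr0.
Qed.

Lemma finite_massZ c x : 0 <= c -> finite_mass x -> finite_mass (fun v => c * x v).
Proof.
move=> c0 [x0 [s sx]]; split=> [v|]; first by rewrite mulr_ge0.
by exists s => v /sx ->; rewrite mulr0.
Qed.

Lemma massZ A c x : finite_mass x -> mass A (fun v => c * x v) = c * mass A x.
Proof.
move=> [x0 [s sx]]; rewrite (massE _ sx) (@massE A (fun v => c * x v) s) => [|v /sx ->]; last by rewrite mulr0.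
by rewrite mulr_sumr; apply: eq_bigr => v _; case: ifP; rewrite ?mulr0.
Qed.

Definition point_mass (c : R) (u v : V) : R := if v == u then c else 0.

Lemma finite_point_mass c u : 0 <= c -> finite_mass (point_mass c u).
Proof.
move=> c0; rewrite /point_mass; split=> [v|]; first by case: ifP.
by exists [fset u]%fset => v; rewrite inE => /negPf ->.
Qed.

Lemma mass_point A c u : mass A (point_mass c u) = if `[<A u>] then c else 0.
Proof.
rewrite (@massE A _ [fset u]%fset) ?big_seq_fset1 /point_mass ?eqxx// => v.
by rewrite inE => /negPf ->.
Qed.

(* Scheffe's lemma: the masses of [A] and of its complement are lower semicontinuous. *)
Lemma mass_cvg (T : Type) (F : set_system T) (x : T -> V -> R) x0 : Filter F ->
  finite_mass x0 -> (\near F, finite_mass (x F)) ->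
  (forall v, x t v @[t --> F] --> x0 v) ->
  mass setT (x t) @[t --> F] --> mass setT x0 ->
  forall A, mass A (x t) @[t --> F] --> mass A x0.
Proof.
move=> FF Fx0 Fx cx cm A; have [x00 [s sx]] := Fx0.
(* The mass carried by the fixed support [s] of the limit: a finite sum, hence convergent, and a
   lower bound for the mass of [B]. *)
pose l B t := \sum_(v <- s) (if `[<B v>] then x t v else 0).
have cl B : l B t @[t --> F] --> mass B x0.
  rewrite (massE _ sx); apply: cvg_big => [|v _]; first exact: add_continuous.
  by case: ifP => _; [exact: cx|exact: cvg_cst].
have ll B t : finite_mass (x t) -> l B t <= mass B (x t).
  move=> [xt0 [u ux]]; have ux' v : v \notin (s `|` u)%fset -> x t v = 0.
    by rewrite !inE negb_or => /andP[_ /ux].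
  pose y v := if v \in s then x t v else 0.
  have ys v : v \notin s -> y v = 0 by rewrite /y => /negPf ->.
  have yu v : v \notin (s `|` u)%fset -> y v = 0 by rewrite !inE negb_or => /andP[/ys].
  have -> : l B t = mass B y by rewrite (massE _ ys); apply: eq_big_seq => v; rewrite /y => ->.
  rewrite (massE _ ux') (massE _ yu); apply: ler_sum => v _; case: ifP => // _.
  by rewrite /y; case: ifP.
apply: (@squeeze_cvgr _ _ _ _ (l A) (fun t => mass setT (x t) - l (~` A) t)) => //.
  near=> t; have Ft : finite_mass (x t) by near: t.
  by rewrite ll// lerBrDr -(mass_setC A Ft) lerD2l ll.
rewrite -(addrK (mass (~` A) x0) (mass A x0)) mass_setC//; exact: cvgB.
Unshelve. all: by end_near. Qed.

End FiniteMass.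

(** * Continuity and homotopy equivalence in coordinate spaces *)

Section CoordinateSubspaces.
Variable R : realType.

Lemma ptws_within_cvg (U : choiceType) (D : set {ptws U -> R}) (x : {ptws U -> R}) (u : U) :
  y u @[y --> within D (nbhs x)] --> x u.
Proof.
have H : (fun f : {ptws U -> R} => f u) @ nbhs x --> x u by exact: (@proj_continuous U (fun=> R) u x).
apply: cvg_trans H; apply: cvg_app.
by have := @cvg_within {ptws U -> R} (nbhs x) (nbhs_filter x) D; exact.
Qed.

Lemma ptws_within_continuous (U W : choiceType) (D : set {ptws U -> R})
    (f : {ptws U -> R} -> {ptws W -> R}) :
  (forall x, D x -> forall w, f y w @[y --> within D (nbhs x)] --> f x w) ->
  {within D, continuous f}.
Proof.
move=> H; apply/subspace_continuousP => x Dx.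
have FF : Filter (f @ within D (nbhs x)) by typeclasses eauto.
apply: ((@pointwise_cvgP (discrete_topology W) R _ (f x) FF).2).
exact: H.
Qed.

Lemma bij_homotopy_equivalent (A B : coord_subspace R)
    (f : {ptws coords A -> R} -> {ptws coords B -> R})
    (g : {ptws coords B -> R} -> {ptws coords A -> R}) :
  {within points A, continuous f} -> (forall x, points A x -> points B (f x)) ->
  {within points B, continuous g} -> (forall y, points B y -> points A (g y)) ->
  (forall x, points A x -> g (f x) = x) -> (forall y, points B y -> f (g y) = y) ->
  homotopy_equivalent A B.
Proof.
move=> cf fAB cg gBA fK gK; exists f, g; split=> //.
- exists fst; split=> //= [|x Ax]; last by rewrite fK.
  by apply: continuous_subspaceT => -[x t]; exact: cvg_fst.
- exists fst; split=> //= [|x Ax]; last by rewrite gK.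
  by apply: continuous_subspaceT => -[x t]; exact: cvg_fst.
Qed.

End CoordinateSubspaces.

(** * Cones and iterated joins *)

Section Cones.
Variable R : realType.
Implicit Types A B : coord_subspace R.

(** The slice of height [c] of the cone over [A]. The second alternative supplies the apex even if
    [A] is empty, which absorbs both the convention for empty factors and the degenerate ends of a
    join. *)
Definition cone A (c : R) : set (coords A -> R) :=
  [set z | (exists2 x, points A x & z = fun v => c * x v) \/ (c = 0 /\ z = cst 0)].

Lemma cone1 A : @cone A 1 = points A.
Proof.
apply/seteqP; split=> [z [[x Ax ->]|[/eqP]]|z Az]; last 1 first.
- by left; exists z => //; apply/funext => v; rewrite mul1r.
- by rewrite (_ : (fun v => _) = x)//; apply/funext => v; rewrite mul1r.
- by rewrite oner_eq0.
Qed.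

Lemma cone0 A z : @cone A 0 z -> z = cst 0.
Proof. by case=> [[x _ ->]|[]//]; apply/funext => v; rewrite mul0r. Qed.

Lemma coneZ A (c d : R) z : @cone A c z -> @cone A (d * c) (fun v => d * z v).
Proof.
case=> [[x Ax ->]|[-> ->]]; [left|right].
  by exists x => //; apply/funext => v; rewrite mulrA.
by split; [rewrite mulr0|apply/funext => v; rewrite mulr0].
Qed.

Definition glue (V W : Type) (z : V -> R) (y : W -> R) (l : R) : (V + W + unit)%type -> R :=
  fun i => match i with inl (inl v) => z v | inl (inr w) => y w | inr _ => l end.

Lemma cone_glue A B a l z y : 0 <= a -> 0 <= l -> @cone A a z -> @cone B l y ->
  @cone (join A B) (a + l) (glue z y l).
Proof.
move=> a0 l0 Az By; have [al|al] := eqVneq (a + l) 0.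
  right; have [/eqP a00 /eqP l00] : a == 0 /\ l == 0.
    by move/eqP: al; rewrite paddr_eq0// => /andP.
  subst a l; rewrite (cone0 Az) (cone0 By) addr0; split=> //.
  by apply/funext => -[[]|].
case: Az => [[x Ax ->]|[a00 ->]]; case: By => [[x' Bx ->]|[l00 ->]]; left.
- exists (join_point x x' (l / (a + l))).
    left; left; exists x, x', (l / (a + l)); split=> //.
    by rewrite divr_ge0 ?addr_ge0//= ler_pdivrMr ?mul1r ?lerDr// lt0r al addr_ge0.
  by apply/funext => -[[v|w]|[]] /=; field.
- exists (join_point x (cst 0) 0); first by left; right; exists x.
  by apply/funext => -[[v|w]|[]] /=; rewrite l00 ?addr0 ?subr0 ?mul1r ?mul0r ?mulr0.
- exists (join_point (cst 0) x' 1); first by right; exists x'.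
  by apply/funext => -[[v|w]|[]] /=; rewrite a00 ?add0r ?subrr ?mul0r ?mulr0 ?mul1r ?mulr1.
- by rewrite a00 l00 addr0 eqxx in al.
Qed.

Lemma cone_join_inv A B c w : 0 <= c -> @cone (join A B) c w ->
  [/\ 0 <= w (inr tt) <= c, @cone A (c - w (inr tt)) (fun v => w (inl (inl v))) &
      @cone B (w (inr tt)) (fun v => w (inl (inr v)))].
Proof.
move=> c0 [[_ [[[x [y [l [Ax By /andP[l0 l1] ->]]]]|[x Ax ->]]|[y By ->]] ->]|[-> ->]] /=.
- split; first by rewrite mulr_ge0//= ler_piMr.
    by left; exists x => //; apply/funext => v; ring.
  by left; exists y => //; apply/funext => v; ring.
- rewrite mulr0 lexx c0; split=> //; last by right; split=> //; apply/funext => v; rewrite !mulr0.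
  by left; exists x => //; apply/funext => v; ring.
- rewrite mulr1 lexx c0 subrr; split=> //; last by left; exists y => //; apply/funext => v; rewrite mul1r.
  by right; split=> //; apply/funext => v; rewrite /= mulr0 mulr0.
- by rewrite lexx subr0; split=> //; right.
Qed.

Section IteratedJoin.
Variables (S : coord_subspace R) (V : choiceType) (I : eqType) (K : I -> set {fset V}).

Definition joins (s : seq I) : coord_subspace R :=
  foldr (@join R) S [seq realization R (K i) | i <- s].

(** Homogeneous coordinates of an iterated join: [n i] is the height of the part of index [i] and
    [m] that of [S]. The join parameter at each stage is the total height of all later factors. *)
Fixpoint join_coords (s : seq I) (z : I -> V -> R) (y : coords S -> R) (n : I -> R) (m : R) :
    coords (joins s) -> R :=
  if s is i :: s' then glue (z i) (@join_coords s' z y n m) (\sum_(j <- s') n j + m) else y.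
Arguments join_coords s z y n m _ : clear implicits.

Fixpoint join_part (s : seq I) : (coords (joins s) -> R) -> I -> V -> R :=
  match s with
  | [::] => fun _ _ _ => 0
  | i :: s' => fun w j => if j == i then fun v => w (inl (inl v))
                          else @join_part s' (fun u => w (inl (inr u))) j
  end.

Fixpoint join_rest (s : seq I) : (coords (joins s) -> R) -> coords S -> R :=
  match s with
  | [::] => id
  | i :: s' => fun w => @join_rest s' (fun u => w (inl (inr u)))
  end.

(** Heights are successive differences of the join parameters, starting from the total height [c];
    the value 0 for an index outside [s] is a default. *)
Fixpoint part_size (s : seq I) : R -> (coords (joins s) -> R) -> I -> R :=
  match s with
  | [::] => fun _ _ _ => 0
  | i :: s' => fun c w j => if j == i then c - w (inr tt)
                            else @part_size s' (w (inr tt)) (fun u => w (inl (inr u))) j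
  end.

Fixpoint rest_size (s : seq I) : R -> (coords (joins s) -> R) -> R :=
  match s with
  | [::] => fun c _ => c
  | i :: s' => fun c w => @rest_size s' (w (inr tt)) (fun u => w (inl (inr u)))
  end.

Lemma eq_join_coords s z z' y n n' m : {in s, z =1 z'} -> {in s, n =1 n'} ->
  join_coords s z y n m = join_coords s z' y n' m.
Proof.
elim: s => //= i s IH zz nn; rewrite zz ?mem_head// IH.
- by congr glue; congr (_ + _); apply: eq_big_seq => j js; apply: nn; rewrite inE js orbT.
- by move=> j js; apply: zz; rewrite inE js orbT.
- by move=> j js; apply: nn; rewrite inE js orbT.
Qed.

Lemma cone_join_coords s z y n m : (forall i, 0 <= n i) -> 0 <= m ->
  {in s, forall i, @cone (realization R (K i)) (n i) (z i)} -> @cone S m y ->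
  @cone (joins s) (\sum_(i <- s) n i + m) (join_coords s z y n m).
Proof.
move=> n0 m0; elim: s => [|i s IH] Hz Hy /=; first by rewrite big_nil add0r.
rewrite big_cons -addrA; apply: cone_glue => //.
- by rewrite addr_ge0// sumr_ge0.
- by apply: Hz; rewrite mem_head.
- by apply: IH => // j js; apply: Hz; rewrite inE js orbT.
Qed.

Lemma cone_joins_inv s c w : uniq s -> 0 <= c -> @cone (joins s) c w ->
  [/\ {in s, forall i, 0 <= part_size c w i /\
        @cone (realization R (K i)) (part_size c w i) (join_part w i)},
      0 <= rest_size c w /\ @cone S (rest_size c w) (join_rest w),
      \sum_(i <- s) part_size c w i + rest_size c w = c &
      join_coords s (join_part w) (join_rest w) (part_size c w) (rest_size c w) = w].
Proof.
elim: s c w => [|i s IH] c w /=; first by rewrite big_nil add0r; split.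
move=> /andP[is_ us] c0 /(cone_join_inv c0)[/andP[l0 lc] Az /(IH _ _ us l0)[Hz Hy Hs Hw]].
have ji j : j \in s -> (j == i) = false by move=> js; apply/eqP => ji; rewrite -ji js in is_.
split=> //.
- move=> j; rewrite inE; case: eqP => [->|_ js] /=; last exact: Hz.
  by rewrite subr_ge0.
- rewrite big_cons eqxx -addrA -[RHS](subrK (w (inr tt))); congr (_ + _).
  rewrite -[RHS]Hs; congr (_ + _); apply: eq_big_seq => j /ji -> //.
- rewrite eqxx (@eq_join_coords s _ (join_part (fun u => w (inl (inr u)))) _ _
    (part_size (w (inr tt)) (fun u => w (inl (inr u))))).
  + rewrite Hw (eq_big_seq (part_size (w (inr tt)) (fun u => w (inl (inr u))))) ?Hs.
      by apply/funext => -[[]|[]].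
    by move=> j /ji ->.
  + by move=> j /ji ->.
  + by move=> j /ji ->.
Qed.

Lemma join_partK s z y n m i : i \in s -> join_part (join_coords s z y n m) i = z i.
Proof.
by elim: s => //= j s IH; rewrite inE; case: eqP => [->//|_ /= /IH <-].
Qed.

Lemma join_restK s z y n m : join_rest (join_coords s z y n m) = y.
Proof. by elim: s. Qed.

Lemma part_sizeK s z y n m i : i \in s ->
  part_size (\sum_(j <- s) n j + m) (join_coords s z y n m) i = n i.
Proof.
elim: s => //= j s IH; rewrite inE; case: eqP => [-> _|_ /= /IH //].
by rewrite big_cons; ring.
Qed.

Section Limits.
Variables (T : Type) (F : set_system T).
Hypothesis FF : Filter F.

Lemma join_coords_cvg s (z : T -> I -> V -> R) y n m z0 y0 n0 m0 :
  (forall i v, z t i v @[t --> F] --> z0 i v) -> (forall u, y t u @[t --> F] --> y0 u) ->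
  (forall i, n t i @[t --> F] --> n0 i) -> m t @[t --> F] --> m0 ->
  forall u, join_coords s (z t) (y t) (n t) (m t) u @[t --> F] --> join_coords s z0 y0 n0 m0 u.
Proof.
move=> cz cy cn cm; elim: s => [|i s IH] //= -[[v|u]|[]] /=; [exact: cz|exact: IH|].
apply: cvgD => //; apply: cvg_big => [|j _]; [exact: add_continuous|exact: cn].
Qed.

Variables (s : seq I) (w : T -> coords (joins s) -> R) (w0 : coords (joins s) -> R).
Hypothesis cw : forall u, w t u @[t --> F] --> w0 u.

Lemma join_part_cvg i v : join_part (w t) i v @[t --> F] --> join_part w0 i v.
Proof.
elim: s w w0 cw => [|j s' IH] w' w1 cw' /=; first exact: cvg_cst.
by case: eqP => _; [exact: cw'|apply: IH => u; exact: cw'].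
Qed.

Lemma join_rest_cvg u : join_rest (w t) u @[t --> F] --> join_rest w0 u.
Proof.
elim: s w w0 cw => [|j s' IH] w' w1 cw' /=; first exact: cw'.
by apply: IH => u'; exact: cw'.
Qed.

Lemma part_size_cvg (c : T -> R) c0 i : c t @[t --> F] --> c0 ->
  part_size (c t) (w t) i @[t --> F] --> part_size c0 w0 i.
Proof.
elim: s w w0 cw c c0 => [|j s' IH] w' w1 cw' c c0 cc /=; first exact: cvg_cst.
by case: eqP => _; [apply: cvgB; [exact: cc|exact: cw']|apply: IH => [u|]; exact: cw'].
Qed.

End Limits.
End IteratedJoin.

(** Scaling turns probability measures on chains into measures of mass [c]. The chain may be empty
    here, unlike a simplex, which accounts for the apex. *)
Lemma cone_order_complexP (V : choiceType) (le : rel V) (P : set V) c z : 0 <= c ->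
  @cone (realization R (order_complex le P)) c z <->
  [/\ finite_mass z, mass setT z = c & exists s : {fset V},
      [/\ {in s, forall v, P v}, {in s &, forall v w, le v w || le w v} &
          forall v, v \notin s -> z v = 0]].
Proof.
move=> c0; split=> [[[x [s [_ sP sle] [x0 xs x1]] ->]|[-> ->]]|].
- have Fx : finite_mass x by split=> //; exists s.
  split; first exact: finite_massZ.
    by rewrite massZ// (mass_setTE xs) x1 mulr1.
  by exists s; split=> // v /xs ->; rewrite mulr0.
- have Fx : finite_mass (cst 0 : V -> R) by split=> //; exists fset0.
  by split=> //; [apply: mass_set0 => // v; rewrite eqxx|exists fset0].
move=> [Fz zc [s [sP sle sz]]]; have [c00|cn0] := eqVneq c 0.
  right; split=> //; apply/funext => v; apply/eqP; rewrite eq_le Fz.1 andbT.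
  by rewrite -(mass_set1 v Fz) -[leRHS]c00 -zc; apply: le_mass.
left; exists (fun v => c^-1 * z v); last by apply/funext => v; rewrite mulVKf.
exists s; split=> //; first by apply: contra_neq cn0 => s0; rewrite -zc (mass_setTE sz) s0 big_nil.
- by move=> v; rewrite mulr_ge0 ?invr_ge0// Fz.1.
- by move=> v /sz ->; rewrite mulr0.
- by rewrite -mulr_sumr -(mass_setTE sz) zc mulVf.
Qed.

Lemma cone_sphereP d c y : 0 <= c -> @cone (sphere R d) c y <-> \sum_(i < d.+1) y i ^+ 2 = c ^+ 2.
Proof.
move=> c0; split=> [[[x Sx ->]|[-> ->]]|yc].
- by under eq_bigr do rewrite exprMn; rewrite -mulr_sumr Sx mulr1.
- by transitivity (0 : R); [apply: big1 => i _; rewrite /cst|]; rewrite expr0n.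
have [c00|cn0] := eqVneq c 0.
  right; split=> //; apply/funext => i; apply/eqP; rewrite -sqrf_eq0; apply/eqP.
  by move: i (erefl true); apply: psumr_eq0P => [i _|]; rewrite ?sqr_ge0// yc c00 expr0n.
left; exists (fun v => c^-1 * y v); last by apply/funext => v; rewrite mulVKf.
by rewrite /=; under eq_bigr do rewrite exprMn; rewrite -mulr_sumr yc -exprMn mulVf// expr1n.
Qed.

End Cones.

(** * Order complexes of products of intervals *)

(** Used both with [le] and with its converse, to find greatest and least elements. Comparability of
    an element of [s] with itself gives the reflexivity of [r] there. *)
Lemma chain_max (V : eqType) (r : rel V) (s : seq V) (D : set V) : transitive r ->
  {in s &, forall v w, r v w || r w v} -> (exists2 v, v \in s & D v) ->
  exists v, [/\ v \in s, D v & {in s, forall u, D u -> r u v}].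
Proof.
move=> tr; elim: s => [_ []//|a s IH rs [v vs Dv]].
have rs' : {in s &, forall v w, r v w || r w v}.
  by move=> u w us ws; apply: rs; rewrite inE ?us ?ws orbT.
have raa : r a a by have := rs a a; rewrite mem_head orbb => ->.
case: (pselect (exists2 v, v \in s & D v)) => [/(IH rs')[m [ms Dm mM]]|no].
  have ms' : m \in a :: s by rewrite inE ms orbT.
  case: (pselect (D a)) => [Da|nDa]; last first.
    by exists m; split=> // u; rewrite inE => /orP[/eqP -> /nDa|/mM].
  have /orP[am|ma] := rs a m (mem_head _ _) ms'.
    by exists m; split=> // u; rewrite inE => /orP[/eqP ->|/mM].
  exists a; split=> //; first exact: mem_head.
  by move=> u; rewrite inE => /orP[/eqP ->//|/mM H /H um]; exact: tr um ma.
move: vs; rewrite inE => /orP[/eqP va|vs]; last by case: no; exists v.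
exists v; split=> //; rewrite va ?mem_head// => u; rewrite inE => /orP[/eqP ->//|us Du].
by case: no; exists u.
Qed.

(** * Measures on chains and their marginals *)

Section Couplings.
Variables (R : realType) (V : choiceType) (le : rel V) (p : nat).
Hypotheses (leVV : reflexive le) (leV_anti : antisymmetric le) (leV_trans : transitive le).
Local Notation I := 'I_p.+1.
Variables (P : set V) (pr : I -> V -> V).
Hypothesis pr_le : forall k l, P k -> P l -> le k l <-> forall i, le (pr i k) (pr i l).
Implicit Types (x : V -> R) (m : I -> V -> R) (s : {fset V}).

Definition chain s : Prop := {in s &, forall v w, le v w || le w v}.

Definition marginal i x : V -> R := fun v => mass [set k | pr i k = v] x.

Lemma finite_marginal i x : finite_mass x -> finite_mass (marginal i x).
Proof.
move=> Fx; split=> [v|]; first exact: mass_ge0.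
have [_ [s sx]] := Fx; exists [fset pr i k | k in s]%fset => v vs.
apply: mass_set0 => // k xk kv; move: vs; rewrite -kv => /negP; apply.
by apply: in_imfset; apply: contraR xk => /sx /= ->.
Qed.

Lemma mass_marginal i x A : finite_mass x ->
  mass A (marginal i x) = mass [set k | A (pr i k)] x.
Proof.
move=> [x0 [s sx]]; set s' := [fset pr i k | k in s]%fset.
have ms v : v \notin s' -> marginal i x v = 0.
  move=> vs; apply: mass_set0 => // [|k xk kv]; first by split=> //; exists s.
  move: vs; rewrite -kv => /negP; apply.
  by apply: in_imfset; apply: contraR xk => /sx /= ->.
rewrite (massE _ ms) (massE _ sx).
transitivity (\sum_(v <- s') \sum_(k <- s) if `[<A v /\ pr i k = v>] then x k else 0).
  apply: eq_bigr => v _; rewrite /marginal (massE _ sx); case: asboolP => Av.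
    apply: eq_bigr => k _; congr (if _ then _ else _).
    by apply: asbool_equiv_eq; split=> // -[].
  by rewrite big1// => k _; rewrite asboolF// => -[].
rewrite exchange_big; apply: eq_big_seq => k ks /=.
have ks' : pr i k \in s' by apply: in_imfset.
rewrite (big_fsetD1 _ ks') /= big_seq big1 ?addr0 => [|v].
  by congr (if _ then _ else _); apply: asbool_equiv_eq; split=> [[]|].
by rewrite !inE => /andP[/eqP vk _]; rewrite asboolF// => -[_ /esym].
Qed.

(** On a chain the [A i] are initial segments for [r], hence nested, and their union has the largest
    of their masses. *)
Lemma bigmax_mass (r : rel V) x s (A : I -> set V) : finite_mass x ->
  (forall v, v \notin s -> x v = 0) -> transitive r ->
  {in s &, forall v w, r v w || r w v} ->
  (forall i v w, v \in s -> w \in s -> r v w -> A i w -> A i v) ->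
  \big[Order.max/0]_i mass (A i) x = mass [set v | exists i, A i v] x.
Proof.
move=> Fx sx rt rs HA; apply/le_anti/andP; split.
  apply: bigmax_le => [|i _]; first exact: mass_ge0.
  by apply: le_mass => // v _ Av; exists i.
have sx' v : x v != 0 -> v \in s by apply: contraR => /sx ->.
case: (pselect (exists2 v, v \in s & exists i, A i v)) => [/(chain_max rt rs)|no].
  move=> [v [vs [j Ajv] vm]]; apply: le_trans (le_bigmax_cond _ _ (erefl : xpredT j)) => /=.
  by apply: le_mass => // u /sx' us Au; apply: HA (vm u us Au) Ajv.
rewrite mass_set0// => [|v /sx' vs Av]; last by apply: no; exists v.
exact: bigmax_ge_id.
Qed.

Definition low (m : V -> R) v : R := mass [set u | le u v /\ u <> v] m.
(** On a chain through [v], the condition [~ le u v] says that [u] is strictly above [v]; so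
    [M - upp] is the mass up to and including [v]. *)
Definition upp (m : V -> R) v : R := mass [set u | ~ le u v] m.

(* A measure carried by a chain is the image of Lebesgue measure on [0, M[ under
   monotone maps; the atom at [k] is the intersection over [i] of the intervals
   [low, M - upp[ on which the [i]-th component of this map is [pr i k]. *)
Definition couple (M : R) m k : R :=
  if `[<P k>] then Order.max 0 (M - \big[Order.max/0]_i low (m i) (pr i k)
                                  - \big[Order.max/0]_i upp (m i) (pr i k)) else 0.

(** [U] and [W] collect what lies strictly below [k], respectively not below [k], in some
    coordinate. If [k] is an atom, they partition the other atoms and the formula returns the mass
    of [k]. Otherwise they cover all atoms, the difference is at most 0 and the maximum with 0 takes
    over. *)
Lemma couple_marginal x s k : finite_mass x -> (forall v, v \notin s -> x v = 0) ->
  {in s, forall v, P v} -> chain s ->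
  couple (mass setT x) (fun i => marginal i x) k = x k.
Proof.
move=> Fx sx sP sle; rewrite /couple; case: asboolP => [Pk|nP]; last first.
  by rewrite sx//; apply/negP => /sP.
have sx' v : x v != 0 -> v \in s by apply: contraR => /sx ->.
pose U := [set l | exists i, le (pr i l) (pr i k) /\ pr i l <> pr i k].
pose W := [set l | exists i, ~ le (pr i l) (pr i k)].
have -> : \big[Order.max/0]_i low (marginal i x) (pr i k) = mass U x.
  under eq_bigr do rewrite /low mass_marginal//=.
  apply: (bigmax_mass Fx sx leV_trans sle) => i v w vs ws.
  move=> /(pr_le (sP _ vs) (sP _ ws))/(_ i) vw [wk nwk].
  split; first exact: leV_trans vw wk.
  by move=> vk; apply: nwk; apply: leV_anti; rewrite wk -vk.
have -> : \big[Order.max/0]_i upp (marginal i x) (pr i k) = mass W x.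
  under eq_bigr do rewrite /upp mass_marginal//=.
  apply: (bigmax_mass (r := fun v w => le w v) Fx sx) => [a b c ba ac|v w vs ws|].
  - exact: leV_trans ac ba.
  - by rewrite orbC; exact: sle.
  move=> i v w vs ws /(pr_le (sP _ ws) (sP _ vs))/(_ i) wv nwk vk.
  by apply: nwk; exact: leV_trans wv vk.
have -> : mass setT x - mass U x = mass (~` U) x by rewrite -(mass_setC U Fx) addrC addKr.
have UW l : x l != 0 -> l <> k -> ~ U l -> W l.
  move=> /sx' ls lk nU; apply: contrapT => nW; apply: lk.
  have H i : pr i l = pr i k.
    apply: contrapT => nlk; apply: nU; exists i; split=> //.
    by apply: contrapT => nle; apply: nW; exists i.
  have Pl := sP _ ls; apply: leV_anti; apply/andP; split.
    by apply/(pr_le Pl Pk) => i; rewrite H.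
  by apply/(pr_le Pk Pl) => i; rewrite H.
have [xk|xk] := eqVneq (x k) 0.
  rewrite xk; apply/max_idPl; rewrite subr_le0; apply: le_mass => // l xl.
  by apply: UW => // lk; rewrite lk xk eqxx in xl.
have WU l : x l != 0 -> W l -> ~ U l.
  move=> /sx' ls [i nlk] [j [lkj nlkj]].
  have /orP[] := sle l k ls (sx' _ xk); move/pr_le => H.
    by apply: nlk; apply: H => //; exact: sP.
  by apply: nlkj; apply: leV_anti; rewrite lkj H//; exact: sP.
have -> : mass (~` U) x = x k + mass W x.
  rewrite -(mass_set1 k Fx) -mass_setU// => [|v _ -> [i]]; last by apply.
  apply: eq_mass => // v xv; split=> [nU|[-> [i []]//|/(WU _ xv)//]].
  by have [->|/eqP vk] := eqVneq v k; [left|right; exact: UW].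
by rewrite addrK; apply/max_idPr; exact: Fx.1.
Qed.

Section Existence.
Variables (L : I -> set V) (b t : I -> V).
Hypothesis pr_surj : forall v : I -> V, (forall i, L i (v i)) ->
  (exists i, v i <> b i) -> (exists i, v i <> t i) -> exists k, P k /\ forall i, pr i k = v i.

(* The north-west corner rule. *)
Lemma coupling_exists m (s : I -> {fset V}) M : (forall i v, 0 <= m i v) ->
  (forall i v, (v \in s i) = (m i v != 0)) -> (forall i v, v \in s i -> L i v) ->
  (forall i, chain (s i)) -> (forall i, mass setT (m i) = M) ->
  (exists i, m i (b i) = 0) -> (exists i, m i (t i) = 0) ->
  exists x u, [/\ finite_mass x /\ forall v, v \notin u -> x v = 0, {in u, forall v, P v},
    chain u, forall i v, marginal i x v = m i v & forall i k, k \in u -> pr i k \in s i].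
Proof.
(* Induction on the number of atoms of all marginals. Each round strips the same weight [w], the
   least among the weights of the lowest atoms [v i], and so removes at least one atom; [w] is
   placed at the element with components [v i], which is below everything placed later. *)
have [N] := ubnP (\sum_i #|` s i|)%N.
elim: N m s M => // N IH m s M sN m0 sm sL sle mM [ib mb] [it mt].
have Fm i : finite_mass (m i) by split=> //; exists (s i) => v; rewrite sm negbK => /eqP.
have M0 : 0 <= M by rewrite -(mM ord0) mass_ge0.
have [M00|Mn0] := eqVneq M 0.
  exists (fun=> 0), fset0; split=> //.
  - by split=> //; split=> //; exists fset0.
  - move=> i v; rewrite /marginal mass_set0 => [|//|u]; last by rewrite eqxx.
      apply/esym/le_anti; rewrite m0 andbT -M00 -(mM i) -[leLHS](mass_set1 v (Fm i)).
      exact: le_mass.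
    by split=> //; exists fset0.
have /choice[v vP] : forall i, exists v, v \in s i /\ {in s i, forall u, le v u}.
  move=> i; have [v [vs _ vm]] : exists v, [/\ v \in s i, setT v &
      {in s i, forall u, setT u -> le v u}].
    apply: (@chain_max _ (fun u w => le w u) (s i) setT) => [a c d ca ad|u w us ws|].
    - exact: leV_trans ad ca.
    - by rewrite orbC; exact: (sle i).
    have [s0|[u us]] := fset_0Vmem (s i); last by exists u.
    case/eqP: Mn0; rewrite -(mM i) mass_set0// => u; by rewrite -sm s0 inE.
  by exists v; split=> // u us; exact: vm.
have [i0 _ i0m] : exists2 i, true & forall j, m i (v i) <= m j (v j).
  by case: (@Order.TotalTheory.arg_minP _ _ _ (ord0 : I) xpredT (fun i => m i (v i))) => // i _ H;
    exists i => // j; exact: H.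
pose w := m i0 (v i0).
have w0 : 0 < w by rewrite lt0r m0 andbT -sm (vP i0).1.
pose m' i u := m i u - point_mass w (v i) u.
pose s' i := [fset u in s i | m' i u != 0]%fset.
have m'0 i u : 0 <= m' i u.
  by rewrite /m' /point_mass; case: eqP => [->|_]; rewrite ?subr0// subr_ge0; exact: i0m.
have s's i u : u \in s' i -> u \in s i by rewrite !inE => /andP[].
have s'm i u : (u \in s' i) = (m' i u != 0).
  rewrite !inE /= sm; have [mu|//] := eqVneq (m i u) 0; rewrite /m' mu /point_mass.
  case: (u =P v i) => [uv|_]; last by rewrite subrr eqxx.
  by have := (vP i).1; rewrite sm -uv mu eqxx.
have Fm' i : finite_mass (m' i).
  by split=> //; exists (s' i) => u; rewrite s'm negbK => /eqP.
have m'M i : mass setT (m' i) = M - w.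
  rewrite -(mM i) (_ : m i = fun u => m' i u + point_mass w (v i) u).
    rewrite massD//; last exact/finite_point_mass/ltW.
    by rewrite mass_point asboolT// addrK.
  by apply/funext => u; rewrite /m' subrK.
have ss' i : (#|` s' i| <= #|` s i|)%N by apply: fsubset_leq_card; apply/fsubsetP => u; exact: s's.
have s'N : (\sum_i #|` s' i| < N)%N.
  rewrite -ltnS; apply: leq_trans sN; rewrite ltnS (bigD1 i0)//= [X in (_ < X)%N](bigD1 i0)//=.
  rewrite -addSn leq_add ?leq_sum//.
  rewrite (cardfsD1 (v i0) (s i0)) (vP i0).1 add1n ltnS fsubset_leq_card//.
  apply/fsubsetP => u us'; rewrite !inE s's// andbT; apply: contraTneq us' => ->.
  by rewrite s'm negbK /m' /point_mass eqxx subrr.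
have le0 i u : m i u = 0 -> m' i u = 0.
  by move=> mu; apply/eqP/negPn; rewrite -s'm; apply/negP => /s's; rewrite sm mu eqxx.
have [x [u [[Fx ux] uP ule xm us]]] : exists x u,
    [/\ finite_mass x /\ forall v, v \notin u -> x v = 0, {in u, forall v, P v},
    chain u, forall i v, marginal i x v = m' i v & forall i k, k \in u -> pr i k \in s' i].
  apply: (IH m' s' (M - w)) => //.
  - by move=> i u /s's; exact: sL.
  - by move=> i a c /s's as_ /s's cs; exact: (sle i).
  - by exists ib; exact: le0.
  - by exists it; exact: le0.
(* No mass sits on [b] at the index [ib] and none on [t] at [it], so the lowest atoms form neither
   of the two excluded tuples. *)
have [k [Pk kv]] : exists k, P k /\ forall i, pr i k = v i.
  apply: pr_surj => [i||]; first exact: sL (vP i).1.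
  - by exists ib => vb; have := (vP ib).1; rewrite vb sm mb eqxx.
  - by exists it => vt; have := (vP it).1; rewrite vt sm mt eqxx.
have kl l : l \in u -> le k l.
  by move=> lu; apply/(pr_le Pk (uP _ lu)) => i; rewrite kv; apply: (vP i).2; exact/s's/us.
have Fk : finite_mass (point_mass w k) by exact/finite_point_mass/ltW.
exists (fun l => x l + point_mass w k l), (k |` u)%fset; split.
- split=> [|l]; first exact: finite_massD.
  by rewrite !inE negb_or /point_mass => /andP[/negPf -> /ux ->]; rewrite addr0.
- by move=> l; rewrite !inE => /orP[/eqP ->|/uP].
- move=> a c; rewrite !inE => /orP[/eqP ->|au] /orP[/eqP ->|cu].
  + by rewrite leVV.
  + by rewrite kl.
  + by rewrite kl// orbT.
  + exact: ule.
- move=> i l; rewrite /marginal massD// mass_point [X in X + _]xm /= kv /m' /point_mass.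
  by case: (l =P v i) => [->|lv]; [rewrite asboolT// subrK|rewrite asboolF ?subr0 ?addr0// => /esym].
- move=> i l; rewrite !inE => /orP[/eqP ->|/us /s's //].
  by rewrite kv; exact: (vP i).1.
Qed.

End Existence.
End Couplings.

Lemma bigmax_eq (R : realType) (I : finType) (F : I -> R) a i : 0 <= a ->
  (forall j, F j <= a) -> F i = a -> \big[Order.max/0]_j F j = a.
Proof.
move=> a0 Fa Fi; apply/le_anti/andP; split; first exact: bigmax_le.
by rewrite -Fi; exact: (le_bigmax_cond _ _ (erefl : xpredT i)).
Qed.

Lemma bigmaxZ (R : realType) (I : finType) (F : I -> R) a : 0 <= a ->
  \big[Order.max/0]_j (a * F j) = a * \big[Order.max/0]_j F j.
Proof.
move=> a0; rewrite (big_morph ( *%R a) (op1 := Order.max) (id1 := 0)) ?mulr0// => x y.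
exact: maxr_pMr.
Qed.

Lemma bigmax_attained (R : realType) (I : finType) (F : I -> R) i : 0 <= F i ->
  exists j, \big[Order.max/0]_j F j = F j.
Proof.
move=> Fi; case: (@Order.TotalTheory.arg_maxP _ _ _ i xpredT F) => // j _ H.
exists j; apply: (bigmax_eq (i := j)) => // [|k]; last exact: H.
exact: le_trans Fi (H i _).
Qed.

Lemma cvg_maxr (R : realType) (T : Type) (F : set_system T) (f g : T -> R) (a b : R) : Filter F ->
  f u @[u --> F] --> a -> g u @[u --> F] --> b -> Order.max (f u) (g u) @[u --> F] --> Order.max a b.
Proof.
move=> FF cf cg; rewrite maxr_absE; under eq_fun do rewrite maxr_absE.
by apply: cvgM; [apply: cvgD; [exact: cvgD|apply: cvg_norm; exact: cvgB]|exact: cvg_cst].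
Qed.

(** * The order complex of a product of intervals without its extremes *)

Section ProductPoset.
Variables (R : realType) (V : choiceType) (le : rel V) (q : nat).
Hypotheses (leVV : reflexive le) (leV_anti : antisymmetric le) (leV_trans : transitive le).
Local Notation I := 'I_q.+2.
Variables (P : set V) (Q : I -> set V) (b t : I -> V) (pr : I -> V -> V).
Hypotheses (bt : forall i, b i <> t i) (le_bt : forall i, le (b i) (t i))
  (Q_strict : forall i v, Q i v -> [/\ le (b i) v, le v (t i), v <> b i & v <> t i]).
Hypotheses
  (pr_mem : forall k i, P k -> [\/ Q i (pr i k), pr i k = b i | pr i k = t i])
  (pr_le : forall k l, P k -> P l -> le k l <-> forall i, le (pr i k) (pr i l))
  (pr_surj : forall v : I -> V, (forall i, [\/ Q i (v i), v i = b i | v i = t i]) ->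
    (exists i, v i <> b i) -> (exists i, v i <> t i) -> exists k, P k /\ forall i, pr i k = v i)
  (pr_proper : forall k, P k -> (exists i, pr i k <> b i) /\ (exists i, pr i k <> t i)).
Implicit Types (x : V -> R) (z : I -> V -> R) (c : I -> R) (y : 'I_q.+1 -> R).

Local Notation marg := (marginal pr).
Local Notation X := (realization R (order_complex le P)).
Local Notation D i := (realization R (order_complex le (Q i))).

Definition inner_part x i v : R := if `[<Q i v>] then marg i x v else 0.
Definition inner_size x i : R := mass [set k | Q i (pr i k)] x.
Definition bias x i : R := marg i x (b i) - marg i x (t i).
Definition rel_bias x (j : 'I_q.+1) : R := bias x (lift ord_max j) - bias x ord_max.

(* The marginals are recovered from their restrictions to the [Q i] and the
   differences of their biases: all marginals have the same total mass, and the
   mass at [b i], as well as that at [t i], vanishes for at least one [i]. *)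
Definition extend_bias y (i : I) : R := if unlift ord_max i is Some j then y j else 0.
(** Let [M] be the total mass and [a] the bias at [ord_max]. Twice the mass at [b i] is
    [M + a - (c i - extend_bias y i)], so its vanishing for some [i] forces [bot_level] to be
    [M + a]; likewise [top_level] is [M - a]. *)
Definition bot_level c y : R := \big[Order.max/0]_i (c i - extend_bias y i).
Definition top_level c y : R := \big[Order.max/0]_i (c i + extend_bias y i).
Definition total_mass c y : R := (bot_level c y + top_level c y) / 2.
Definition bot_mass c y i : R := (bot_level c y - (c i - extend_bias y i)) / 2.
Definition top_mass c y i : R := (top_level c y - (c i + extend_bias y i)) / 2.
Definition full z c y i v : R :=
  z i v + point_mass (bot_mass c y i) (b i) v + point_mass (top_mass c y i) (t i) v.

Let nQb i : ~ Q i (b i). Proof. by move=> /Q_strict[]. Qed.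
Let nQt i : ~ Q i (t i). Proof. by move=> /Q_strict[]. Qed.

Lemma extend_bias_max y : extend_bias y ord_max = 0.
Proof. by rewrite /extend_bias unlift_none. Qed.

Lemma extend_bias_lift y j : extend_bias y (lift ord_max j) = y j.
Proof. by rewrite /extend_bias liftK. Qed.

Lemma extend_rel_bias x i : extend_bias (rel_bias x) i = bias x i - bias x ord_max.
Proof.
case: (unliftP ord_max i) => [j|] ->; first by rewrite extend_bias_lift.
by rewrite extend_bias_max subrr.
Qed.

Lemma extend_biasZ a y i : extend_bias (fun j => a * y j) i = a * extend_bias y i.
Proof. by rewrite /extend_bias; case: (unlift _ _) => *; rewrite ?mulr0. Qed.

Lemma bot_level_ge0 c y : 0 <= bot_level c y. Proof. exact: bigmax_ge_id. Qed.
Lemma top_level_ge0 c y : 0 <= top_level c y. Proof. exact: bigmax_ge_id. Qed.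

Lemma bot_mass_ge0 c y i : 0 <= bot_mass c y i.
Proof. by rewrite divr_ge0// subr_ge0; exact: (le_bigmax_cond _ _ (erefl : xpredT i)). Qed.

Lemma top_mass_ge0 c y i : 0 <= top_mass c y i.
Proof. by rewrite divr_ge0// subr_ge0; exact: (le_bigmax_cond _ _ (erefl : xpredT i)). Qed.

Lemma total_massZ a c y : 0 <= a ->
  total_mass (fun i => a * c i) (fun j => a * y j) = a * total_mass c y.
Proof.
move=> a0; rewrite /total_mass mulrA mulrDr -!bigmaxZ//; congr ((_ + _) / _).
  by apply: eq_bigr => i _; rewrite extend_biasZ mulrBr.
by apply: eq_bigr => i _; rewrite extend_biasZ mulrDr.
Qed.

Lemma total_mass0 c y : (forall i, c i = 0) -> (forall j, y j = 0) -> total_mass c y = 0.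
Proof.
move=> c0 y0; have e0 i : extend_bias y i = 0 by rewrite /extend_bias; case: (unlift _ _).
rewrite /total_mass /bot_level /top_level !(bigmax_eq (a := 0) (i := ord0)) ?addr0 ?mul0r//;
  by move=> *; rewrite c0 e0 ?subr0 ?addr0.
Qed.

(** Each [c i] is nonnegative and at most both [extend_bias y i] and its opposite, so everything
    vanishes. Off the origin one may therefore divide by [total_mass]. *)
Lemma total_mass_gt0 c y : (forall i, 0 <= c i) -> total_mass c y = 0 ->
  (forall i, c i = 0) /\ (forall j, y j = 0).
Proof.
move=> c0 /eqP; rewrite mulf_eq0 invr_eq0 pnatr_eq0 orbF paddr_eq0 ?bot_level_ge0 ?top_level_ge0//.
move=> /andP[/eqP B0 /eqP T0].
have hb i : c i <= extend_bias y i.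
  by rewrite -subr_le0 -[leRHS]B0; exact: (le_bigmax_cond _ _ (erefl : xpredT i)).
have ht i : c i + extend_bias y i <= 0.
  by rewrite -[leRHS]T0; exact: (le_bigmax_cond _ _ (erefl : xpredT i)).
have H i : c i = 0 /\ extend_bias y i = 0.
  by have := c0 i; have := hb i; have := ht i; split; lra.
by split=> [i|j]; [exact: (H i).1|rewrite -extend_bias_lift (H _).2].
Qed.

Lemma mass_full z c y i : finite_mass (z i) -> mass setT (z i) = c i ->
  finite_mass (full z c y i) /\ mass setT (full z c y i) = total_mass c y.
Proof.
move=> Fz zc; have Fb := finite_point_mass (b i) (bot_mass_ge0 c y i).
have Ft := finite_point_mass (t i) (top_mass_ge0 c y i).
have Fzb := finite_massD Fz Fb; split; first exact: finite_massD.
rewrite massD// massD// !mass_point !asboolT// zc /bot_mass /top_mass /total_mass; by field.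
Qed.

Lemma fullE z c y i v : full z c y i v =
  z i v + point_mass (bot_mass c y i) (b i) v + point_mass (top_mass c y i) (t i) v.
Proof. by []. Qed.

(** The required index is one where the maximum defining the level is attained. The entry at
    [ord_max] is [c ord_max], which is nonnegative, so the default 0 of the maximum does no harm. *)
Lemma full_attained z c y : (forall i, 0 <= c i) -> (forall i v, z i v != 0 -> Q i v) ->
  (exists i, full z c y i (b i) = 0) /\ (exists i, full z c y i (t i) = 0).
Proof.
move=> c0 zQ.
have zb i : z i (b i) = 0 by apply: contrapT => /eqP/zQ/nQb.
have zt i : z i (t i) = 0 by apply: contrapT => /eqP/zQ/nQt.
split.
  have [|i Hi] := @bigmax_attained _ _ (fun i => c i - extend_bias y i) ord_max.
    by rewrite extend_bias_max subr0 c0.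
  exists i; rewrite fullE zb /point_mass eqxx (negbTE (introN eqP (@bt i))) addr0 add0r.
  by rewrite /bot_mass /bot_level Hi subrr mul0r.
have [|i Hi] := @bigmax_attained _ _ (fun i => c i + extend_bias y i) ord_max.
  by rewrite extend_bias_max addr0 c0.
have tb : (t i == b i) = false by apply/eqP => tb; exact: (bt (esym tb)).
exists i; rewrite fullE zt /point_mass eqxx tb addr0 add0r.
by rewrite /top_mass /top_level Hi subrr mul0r.
Qed.

Section ChainMeasures.
Variables (x : V -> R) (s : {fset V}).
Hypotheses (Fx : finite_mass x) (sx : forall v, v \notin s -> x v = 0)
  (sP : {in s, forall v, P v}) (sle : chain le s).

Let mem_s v : x v != 0 -> v \in s. Proof. by apply: contraR => /sx ->. Qed.

Lemma marginal_neq0 i v : marg i x v != 0 -> exists2 k, k \in s & pr i k = v.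
Proof.
move=> /eqP mv; apply: contrapT => no; apply: mv; apply: mass_set0 => // k /mem_s ks kv.
by apply: no; exists k.
Qed.

Lemma marginal_mem i v : marg i x v != 0 -> [\/ Q i v, v = b i | v = t i].
Proof. by move=> /marginal_neq0[k ks <-]; apply: pr_mem; exact: sP. Qed.

Lemma mass_inner_part i : mass setT (inner_part x i) = inner_size x i.
Proof.
rewrite /inner_size -(mass_marginal pr i (Q i) Fx); apply: eq_fsbigr => v _.
by rewrite asboolT.
Qed.

Lemma cone_inner_part i : cone (A := D i) (inner_size x i) (inner_part x i).
Proof.
have Fm := finite_marginal pr i Fx; apply/cone_order_complexP; first exact: mass_ge0.
split; last 1 first.
- exists [fset v in [fset pr i k | k in s] | `[<Q i v>]]%fset; split.
  + by move=> v; rewrite !inE => /andP[_ /asboolP].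
  + move=> v w; rewrite !inE => /andP[/imfsetP[k /= ks ->] _] /andP[/imfsetP[l /= ls ->] _].
    have /orP[kl|kl] := sle ks ls; apply/orP; [left|right];
      exact: ((pr_le (sP _) (sP _)).1 kl i).
  + move=> v vs; rewrite /inner_part; case: asboolP => // Qv; apply: contrapT => /eqP.
    move=> /marginal_neq0[k ks kv]; move: vs; rewrite !inE asboolT// andbT => /negP; apply.
    by rewrite -kv; apply: in_imfset.
- split=> [v|]; first by rewrite /inner_part; case: ifP => // _; exact: Fm.1.
  have [u ux] := Fm.2; exists u => v /ux mv; rewrite /inner_part mv; exact: if_same.
- exact: mass_inner_part.
Qed.

Lemma marginal_split i v : marg i x v =
  inner_part x i v + point_mass (marg i x (b i)) (b i) v + point_mass (marg i x (t i)) (t i) v.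
Proof.
rewrite /inner_part /point_mass.
have [vb|vb] := eqVneq v (b i).
  by rewrite vb asboolF// (negbTE (introN eqP (@bt i))) addr0 add0r.
have [vt|vt] := eqVneq v (t i); first by rewrite vt asboolF// !add0r.
rewrite !addr0; case: asboolP => // nQ; apply: contrapT => /eqP/marginal_mem[//|/eqP|/eqP].
  by rewrite (negbTE vb).
by rewrite (negbTE vt).
Qed.

Lemma mass_marginal_split i :
  mass setT x = inner_size x i + marg i x (b i) + marg i x (t i).
Proof.
have Fm := finite_marginal pr i Fx; have := mass_marginal pr i setT Fx.
rewrite [mass setT (marg i x)](_ : _ = mass setT (fun v => inner_part x i v +
  point_mass (marg i x (b i)) (b i) v + point_mass (marg i x (t i)) (t i) v)); last first.
  by congr mass; apply/funext => v; exact: marginal_split.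
have [Fz _ _] := (cone_order_complexP _ (mass_ge0 _ Fx)).1 (cone_inner_part i).
have Fb := finite_point_mass (b i) (Fm.1 (b i)); have Ft := finite_point_mass (t i) (Fm.1 (t i)).
rewrite massD//; last exact: finite_massD.
by rewrite massD// !mass_point !asboolT// mass_inner_part => ->.
Qed.

(** The least element of the chain differs from [b] in some coordinate, and in this coordinate so do
    all others, which lie above it. *)
Lemma marginal_b_attained : exists i, marg i x (b i) = 0.
Proof.
have [s0|[k0 k0s]] := fset_0Vmem s.
  by exists ord0; apply: mass_set0 => // k /mem_s; rewrite s0.
have [k [ks _ km]] : exists k, [/\ k \in s, setT k & {in s, forall l, setT l -> le k l}].
  apply: (@chain_max _ (fun u w => le w u) s setT) => [a c d ca ad|u w us ws|].
  - exact: leV_trans ad ca.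
  - by rewrite orbC; exact: sle.
  - by exists k0.
have [[i kb] _] := pr_proper (sP ks); exists i; apply: mass_set0 => // l /mem_s ls lb.
apply: kb; apply: leV_anti; apply/andP; split.
  by rewrite -lb; exact: ((pr_le (sP ks) (sP ls)).1 (km l ls Logic.I)).
by case: (pr_mem i (sP ks)) => [/Q_strict[]//|->|->].
Qed.

Lemma marginal_t_attained : exists i, marg i x (t i) = 0.
Proof.
have [s0|[k0 k0s]] := fset_0Vmem s.
  by exists ord0; apply: mass_set0 => // k /mem_s; rewrite s0.
have [k [ks _ km]] : exists k, [/\ k \in s, setT k & {in s, forall l, setT l -> le l k}].
  by apply: (@chain_max _ le s setT) => //; exists k0.
have [_ [i kt]] := pr_proper (sP ks); exists i; apply: mass_set0 => // l /mem_s ls lt.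
apply: kt; apply: leV_anti; apply/andP; split.
  by case: (pr_mem i (sP ks)) => [/Q_strict[]//|->|->].
by rewrite -lt; exact: ((pr_le (sP ls) (sP ks)).1 (km l ls Logic.I)).
Qed.

Lemma full_inner_part : total_mass (inner_size x) (rel_bias x) = mass setT x /\
  full (inner_part x) (inner_size x) (rel_bias x) = (fun i => marg i x).
Proof.
have m0 i v : 0 <= marg i x v by exact: mass_ge0.
have M i := mass_marginal_split i; set a := bias x ord_max.
have c0 : 0 <= inner_size x ord_max by exact: mass_ge0.
have B : bot_level (inner_size x) (rel_bias x) = mass setT x + a.
  have [i ib] := marginal_b_attained; apply: (bigmax_eq (i := i)) => [|j|].
  - rewrite (M ord_max) /a /bias; have := m0 ord_max (b ord_max); lra.
  - rewrite extend_rel_bias -/a (M j) /bias; have := m0 j (b j); lra.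
  - rewrite extend_rel_bias -/a (M i) /bias ib; lra.
have T : top_level (inner_size x) (rel_bias x) = mass setT x - a.
  have [i it] := marginal_t_attained; apply: (bigmax_eq (i := i)) => [|j|].
  - rewrite (M ord_max) /a /bias; have := m0 ord_max (t ord_max); lra.
  - rewrite extend_rel_bias -/a (M j) /bias; have := m0 j (t j); lra.
  - rewrite extend_rel_bias -/a (M i) /bias it; lra.
split; first by rewrite /total_mass B T; field.
apply/funext => i; apply/funext => v; rewrite fullE marginal_split.
congr (_ + _ + _); congr (point_mass _ _ _).
- by rewrite /bot_mass B extend_rel_bias -/a (M i) /bias; field.
- by rewrite /top_mass T extend_rel_bias -/a (M i) /bias; field.
Qed.

End ChainMeasures.

(** The reconstructed marginals [full z c y] are coupled by [coupling_exists]; [full_attained] is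
    what lets the coupling avoid the two extremes. *)
Lemma inner_part_surj z c y : (forall i, 0 <= c i) -> (forall i, cone (A := D i) (c i) (z i)) ->
  exists x, [/\ cone (A := X) (total_mass c y) x, inner_part x = z, inner_size x = c &
                rel_bias x = y].
Proof.
move=> c0 Hz.
have Fz i : finite_mass (z i) by have /(cone_order_complexP _ (c0 i))[] := Hz i.
have zc i : mass setT (z i) = c i by have /(cone_order_complexP _ (c0 i))[] := Hz i.
have /choice[s sH] : forall i, exists s : {fset V}, [/\ {in s, forall v, Q i v}, chain le s &
    forall v, v \notin s -> z i v = 0].
  by move=> i; have /(cone_order_complexP _ (c0 i))[] := Hz i.
have zQ i v : z i v != 0 -> Q i v.
  by have [sQ _ sz] := sH i; move=> zv; apply: sQ; apply: contraR zv => /sz ->.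
have [ib it] := full_attained y c0 zQ.
have MF i := mass_full y (Fz i) (zc i).
pose s' i := [fset v in (b i |` (t i |` s i)) | full z c y i v != 0]%fset.
have s's i v : v \in s' i -> [\/ v \in s i, v = b i | v = t i].
  rewrite !inE => /andP[/or3P[/eqP ->|/eqP ->|vs] _].
  - by constructor 2.
  - by constructor 3.
  - by constructor 1.
have [x [u [[Fx ux] uP ule xm us]]] : exists x u,
    [/\ finite_mass x /\ forall v, v \notin u -> x v = 0, {in u, forall v, P v},
    chain le u, forall i v, marg i x v = full z c y i v & forall i k, k \in u -> pr i k \in s' i].
  apply: (coupling_exists leVV leV_trans pr_le
    (L := fun i v => [\/ Q i v, v = b i | v = t i]) pr_surj) ib it => [i v|i v|i v|i|i].
  - exact: (MF i).1.1.
  - rewrite !inE; case: (v =P b i) => // vb; case: (v =P t i) => // vt /=.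
    have [//|/= vs] := boolP (v \in s i); have [_ _ /(_ _ vs) zv] := sH i.
    apply/esym/negbTE/negPn; rewrite fullE zv /point_mass.
    by rewrite (introF eqP vb) (introF eqP vt) !addr0.
  - by move=> /s's[vs|->|->]; [constructor 1; have [sQ _ _] := sH i; exact: sQ|constructor 2|constructor 3].
  - have [sQ sc _] := sH i.
    move=> v w /s's[vs|->|->] /s's[ws|->|->]; rewrite ?leVV ?le_bt ?orbT//.
    + exact: sc.
    + by have [-> _ _ _] := Q_strict (sQ _ vs); rewrite orbT.
    + by have [_ -> _ _] := Q_strict (sQ _ vs).
    + by have [-> _ _ _] := Q_strict (sQ _ ws).
    + by have [_ -> _ _] := Q_strict (sQ _ ws); rewrite orbT.
  - exact: (MF i).2.
have zE : inner_part x = z.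
  apply/funext => i; apply/funext => v; rewrite /inner_part xm fullE /point_mass.
  case: asboolP => [Qv|nQ]; last by have [->//|/zQ] := eqVneq (z i v) 0.
  by have [_ _ /eqP/negbTE -> /eqP/negbTE ->] := Q_strict Qv; rewrite !addr0.
exists x; split=> //.
- apply/cone_order_complexP; first by rewrite -(MF ord0).2 mass_ge0//; exact: (MF ord0).1.
  split=> //; last by exists u.
  rewrite -(MF ord0).2 -(mass_marginal pr ord0 setT Fx); congr mass; apply/funext => v.
  by rewrite xm.
- by apply/funext => i; rewrite -(mass_inner_part Fx) zE.
- have zb i : z i (b i) = 0 by apply: contrapT => /eqP/zQ/nQb.
  have zt i : z i (t i) = 0 by apply: contrapT => /eqP/zQ/nQt.
  have biasE i : bias x i = bot_mass c y i - top_mass c y i.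
    have tb : (t i == b i) = false by apply/eqP => tb; exact: (bt (esym tb)).
    rewrite /bias !xm !fullE zb zt /point_mass !eqxx tb (negbTE (introN eqP (@bt i))).
    by rewrite !addr0 !add0r.
  apply/funext => j; rewrite /rel_bias !biasE /bot_mass /top_mass extend_bias_lift.
  by rewrite extend_bias_max; field.
Qed.

Lemma couple_full x M : 0 <= M -> cone (A := X) M x ->
  total_mass (inner_size x) (rel_bias x) = M /\
  couple le P pr M (full (inner_part x) (inner_size x) (rel_bias x)) = x.
Proof.
move=> M0 /(cone_order_complexP _ M0)[Fx <- [s [sP sle sx]]].
have [-> ->] := full_inner_part Fx sx sP sle; split=> //.
apply/funext => k; exact: (couple_marginal leVV leV_anti leV_trans pr_le k Fx sx sP sle).
Qed.

Local Notation J := (joins (sphere R q) (fun i => order_complex le (Q i)) (enum 'I_q.+2)).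

Definition norm2 y : R := Num.sqrt (\sum_j y j ^+ 2).
(** For nonnegative [c], [join_size] and [total_mass] are two gauges on the same cone of parameters,
    homogeneous of degree one and positive off the origin. The join is the level 1 of the first and
    the order complex that of the second; [to_join] and [of_join] are the radial projections between
    them. *)
Definition join_size c y : R := \sum_(i <- enum 'I_q.+2) c i + norm2 y.

Definition normalized_join z c y : coords J -> R :=
  let a := (join_size c y)^-1 in
  join_coords (S := sphere R q) (fun i v => a * z i v) (fun j => a * y j) (fun i => a * c i)
    (a * norm2 y).

Definition to_join x : coords J -> R := normalized_join (inner_part x) (inner_size x) (rel_bias x).

Definition of_join (w : coords J -> R) : V -> R :=
  let c := part_size 1 w in let y := join_rest w in let a := (total_mass c y)^-1 in
  couple le P pr 1 (full (fun i v => a * join_part w i v) (fun i => a * c i) (fun j => a * y j)).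

Lemma norm2_sqr y : norm2 y ^+ 2 = \sum_j y j ^+ 2.
Proof. by rewrite sqr_sqrtr// sumr_ge0// => j _; exact: sqr_ge0. Qed.

Lemma norm2Z a y : 0 <= a -> norm2 (fun j => a * y j) = a * norm2 y.
Proof.
move=> a0; rewrite /norm2; under eq_bigr do rewrite exprMn.
by rewrite -mulr_sumr sqrtrM ?sqr_ge0// sqrtr_sqr ger0_norm.
Qed.

Lemma norm2_eq0 y j : norm2 y = 0 -> y j = 0.
Proof.
move=> y0; have := norm2_sqr y; rewrite y0 expr0n => /esym/eqP.
rewrite psumr_eq0 => [/allP/(_ j)|k _]; last exact: sqr_ge0.
by rewrite mem_index_enum sqrf_eq0 => /(_ erefl)/eqP.
Qed.

Lemma join_size_ge0 c y : (forall i, 0 <= c i) -> 0 <= join_size c y.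
Proof. by move=> c0; rewrite addr_ge0 ?sqrtr_ge0// sumr_ge0. Qed.

Lemma join_sizeZ a c y : 0 <= a ->
  join_size (fun i => a * c i) (fun j => a * y j) = a * join_size c y.
Proof. by move=> a0; rewrite /join_size norm2Z// mulrDr mulr_sumr. Qed.

Lemma normalized_joinZ a z c y : 0 < a ->
  normalized_join (fun i v => a * z i v) (fun i => a * c i) (fun j => a * y j) =
  normalized_join z c y.
Proof.
move=> a0; have an0 := lt0r_neq0 a0; rewrite /normalized_join join_sizeZ ?ltW// norm2Z ?ltW//.
have H u : (a * join_size c y)^-1 * (a * u) = (join_size c y)^-1 * u.
  by rewrite invfM mulrACA mulVf// mul1r.
rewrite H; congr (join_coords _ _ _ _); first by apply/funext => i; apply/funext => v.
  by apply/funext.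
by apply/funext.
Qed.

Lemma join_size_gt0 x : points X x -> 0 < join_size (inner_size x) (rel_bias x).
Proof.
rewrite -cone1 => Xx; have [Fx _ _] := (cone_order_complexP _ ler01).1 Xx.
have c0 i : 0 <= inner_size x i by exact: mass_ge0.
rewrite lt0r join_size_ge0// andbT; apply/eqP => /eqP; rewrite /join_size.
rewrite paddr_eq0 ?sqrtr_ge0 ?sumr_ge0// psumr_eq0// => /andP[/allP H /eqP y0].
have [+ _] := couple_full ler01 Xx.
rewrite total_mass0 => [/esym/eqP|i|j]; first by rewrite oner_eq0.
  by apply/eqP; exact: (H i (mem_enum _ _)).
exact: norm2_eq0.
Qed.

Lemma to_join_points x : points X x -> points J (to_join x).
Proof.
move=> Xx; have N0 := join_size_gt0 Xx; move: Xx; rewrite -!cone1 => Xx.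
have [Fx _ [s [sP sle sx]]] := (cone_order_complexP _ ler01).1 Xx.
have a0 : 0 <= (join_size (inner_size x) (rel_bias x))^-1 by rewrite invr_ge0 ltW.
rewrite -(mulVf (lt0r_neq0 N0)) {2}/join_size mulrDr mulr_sumr.
apply: cone_join_coords => [i||i _|].
- by rewrite mulr_ge0//; exact: mass_ge0.
- by rewrite mulr_ge0// sqrtr_ge0.
- exact/coneZ/(cone_inner_part Fx sx sP sle).
- by apply: coneZ; apply/cone_sphereP; [exact: sqrtr_ge0|rewrite norm2_sqr].
Qed.

Lemma to_joinK x : points X x -> of_join (to_join x) = x.
Proof.
move=> Xx; have N0 := join_size_gt0 Xx; move: Xx; rewrite -cone1 => Xx.
have [Mx xE] := couple_full ler01 Xx.
have an0 : (join_size (inner_size x) (rel_bias x))^-1 != 0 by rewrite invr_eq0 lt0r_neq0.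
have a0 : 0 <= (join_size (inner_size x) (rel_bias x))^-1 by rewrite invr_ge0 ltW.
rewrite /of_join /to_join /normalized_join join_restK; set a := _^-1 in an0 a0 *.
have pE w : part_size 1 (join_coords (S := sphere R q) (K := fun i => order_complex le (Q i))
    (s := enum 'I_q.+2) (fun i v => a * inner_part x i v) w (fun i => a * inner_size x i)
    (a * norm2 (rel_bias x))) = (fun i => a * inner_size x i).
  have E : \sum_(i <- enum 'I_q.+2) a * inner_size x i + a * norm2 (rel_bias x) = 1.
    by rewrite -mulr_sumr -mulrDr mulVf// lt0r_neq0.
  by apply/funext => i; rewrite -{1}E part_sizeK// mem_enum.
rewrite pE total_massZ// Mx mulr1 -[RHS]xE; congr couple; congr full.
- by apply/funext => i; apply/funext => v; rewrite join_partK ?mem_enum// mulKf.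
- by apply/funext => i; rewrite mulKf.
- by apply/funext => j; rewrite mulKf.
Qed.

Lemma join_decomposition w : points J w -> [/\
  forall i, 0 <= part_size 1 w i /\ cone (A := D i) (part_size 1 w i) (join_part w i),
  normalized_join (join_part w) (part_size 1 w) (join_rest w) = w &
  0 < total_mass (part_size 1 w) (join_rest w)].
Proof.
rewrite -cone1 => /(cone_joins_inv (enum_uniq _) ler01)[Hz [r0 Hy] Hs Hw].
have yE : rest_size 1 w = norm2 (join_rest w).
  move/(cone_sphereP _ r0): Hy; rewrite /norm2 => ->; by rewrite sqrtr_sqr ger0_norm.
have H i := Hz i (mem_enum _ i); have c0 i := (H i).1.
have N1 : join_size (part_size 1 w) (join_rest w) = 1 by rewrite /join_size -yE.
split=> //.
  rewrite /normalized_join N1 invr1 -[RHS]Hw yE mul1r; congr (join_coords _ _ _ _).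
  - by apply/funext => i; apply/funext => v; rewrite mul1r.
  - by apply/funext => j; rewrite mul1r.
  - by apply/funext => i; rewrite mul1r.
have M0 : 0 <= total_mass (part_size 1 w) (join_rest w).
  by rewrite divr_ge0// addr_ge0 ?bot_level_ge0 ?top_level_ge0.
rewrite lt0r M0 andbT; apply/eqP => /(total_mass_gt0 c0)[c00 y0].
have /eqP := N1; rewrite /join_size big1 // add0r /norm2 big1 => [|j _].
  by rewrite sqrtr0 eq_sym oner_eq0.
by rewrite y0 expr0n.
Qed.

Lemma of_join_spec w : points J w -> points X (of_join w) /\ to_join (of_join w) = w.
Proof.
move=> /join_decomposition[Hz Hw M0]; rewrite /of_join.
set M := total_mass _ _ in M0 *.
have a0 : 0 < M^-1 by rewrite invr_gt0.
have [x [Xx zx cx yx]] := inner_part_surj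
  (z := fun i v => M^-1 * join_part w i v) (c := fun i => M^-1 * part_size 1 w i)
  (fun j => M^-1 * join_rest w j) (fun i => mulr_ge0 (ltW a0) (Hz i).1)
  (fun i => coneZ M^-1 (Hz i).2).
have M1 : total_mass (fun i => M^-1 * part_size 1 w i) (fun j => M^-1 * join_rest w j) = 1.
  by rewrite total_massZ ?ltW// -/M mulVf// lt0r_neq0.
rewrite M1 in Xx.
have [_ xE] := couple_full ler01 Xx.
rewrite zx cx yx in xE; rewrite xE; split; first by rewrite -cone1.
by rewrite /to_join zx cx yx normalized_joinZ.
Qed.

(** The mass of every set is continuous on the order complex: total mass is constantly 1 there, so
    [mass_cvg] applies. The denominator stays positive by [join_size_gt0]. *)
Lemma to_join_continuous : {within points X, continuous (to_join : {ptws V -> R} -> {ptws coords J -> R})}.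
Proof.
apply: ptws_within_continuous => x Xx w; set F := within _ _.
have FF : Filter F by apply: within_filter; exact: nbhs_filter.
have XF (y : {ptws V -> R}) : points X y -> finite_mass y /\ mass setT y = 1.
  by rewrite -cone1 => /(cone_order_complexP _ ler01)[].
have FX : \forall y \near F, points X y by exact: withinT.
have cF v : y v @[y --> F] --> x v by exact: ptws_within_cvg.
have cm A : mass A y @[y --> F] --> mass A x.
  apply: mass_cvg => //; first exact: (XF x Xx).1.
    by apply: filterS FX => y /XF[].
  by rewrite (XF x Xx).2; apply: cvg_near_cst; apply: filterS FX => y /XF[].
have cc i : inner_size y i @[y --> F] --> inner_size x i by exact: cm.
have cb j : rel_bias y j @[y --> F] --> rel_bias x j by apply: cvgB; apply: cvgB; exact: cm.
have cn : norm2 (rel_bias y) @[y --> F] --> norm2 (rel_bias x).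
  apply: (continuous_cvg _ (@sqrt_continuous R _)); apply: cvg_big => [|j _].
    exact: add_continuous.
  by under eq_fun do rewrite expr2; rewrite expr2; apply: cvgM; exact: cb.
have ca : (join_size (inner_size y) (rel_bias y))^-1 @[y --> F] --> (join_size (inner_size x) (rel_bias x))^-1.
  apply: cvgV; first exact/lt0r_neq0/join_size_gt0.
  by apply: cvgD => //; apply: cvg_big => [|i _]; [exact: add_continuous|exact: cc].
apply: join_coords_cvg => [i v|j|i|]; apply: cvgM => //.
by rewrite /inner_part; case: ifP => _; [exact: cm|exact: cvg_cst].
Qed.

(** This is where the closed formula [couple] is needed: it consists of maxima of masses of the
    marginals, whose total mass is again constantly 1. *)
Lemma of_join_continuous : {within points J, continuous (of_join : {ptws coords J -> R} -> {ptws V -> R})}.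
Proof.
apply: ptws_within_continuous => w Jw k; set F := within _ _.
have FF : Filter F by apply: within_filter; exact: nbhs_filter.
have FJ : \forall u \near F, points J u by exact: withinT.
have cF v : u v @[u --> F] --> w v by exact: ptws_within_cvg.
pose M (u : coords J -> R) := total_mass (part_size 1 u) (join_rest u).
have M0 u : points J u -> 0 < M u by move=> /join_decomposition[].
pose m (u : coords J -> R) := full (fun i v => (M u)^-1 * join_part u i v)
  (fun i => (M u)^-1 * part_size 1 u i) (fun j => (M u)^-1 * join_rest u j).
have mF (u : coords J -> R) i : points J u -> finite_mass (m u i) /\ mass setT (m u i) = 1.
  move=> Ju; have Mu := M0 u Ju; have [/(_ i)[c0 /(cone_order_complexP _ c0)[Fz zc _]] _ _] :=
    join_decomposition Ju.
  have Fz' : finite_mass (fun v => (M u)^-1 * join_part u i v).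
    by apply: finite_massZ => //; rewrite invr_ge0 ltW.
  have zc' : mass setT (fun v => (M u)^-1 * join_part u i v) = (M u)^-1 * part_size 1 u i.
    by rewrite massZ// zc.
  have [Fm mM] := @mass_full (fun i v => (M u)^-1 * join_part u i v)
    (fun i => (M u)^-1 * part_size 1 u i) (fun j => (M u)^-1 * join_rest u j) i Fz' zc'.
  by split=> //; rewrite mM total_massZ ?invr_ge0 ?ltW// mulVf// lt0r_neq0.
have cp i v : join_part u i v @[u --> F] --> join_part w i v by exact: join_part_cvg.
have cy j : join_rest u j @[u --> F] --> join_rest w j by exact: join_rest_cvg.
have cc i : part_size 1 u i @[u --> F] --> part_size 1 w i.
  by apply: part_size_cvg => //; exact: cvg_cst.
have ce (y : (coords J -> R) -> 'I_q.+1 -> R) : (forall j, y u j @[u --> F] --> y w j) ->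
    forall i, extend_bias (y u) i @[u --> F] --> extend_bias (y w) i.
  by move=> H i; rewrite /extend_bias; case: (unlift _ _) => [j|]; [exact: H|exact: cvg_cst].
have cbl (c : (coords J -> R) -> 'I_q.+2 -> R) (y : (coords J -> R) -> 'I_q.+1 -> R) :
    (forall i, c u i @[u --> F] --> c w i) -> (forall j, y u j @[u --> F] --> y w j) ->
    bot_level (c u) (y u) @[u --> F] --> bot_level (c w) (y w).
  move=> Hc Hy; apply: cvg_big => [|i _]; first exact: max_continuous.
  by apply: cvgB; [exact: Hc|exact: ce].
have ctl (c : (coords J -> R) -> 'I_q.+2 -> R) (y : (coords J -> R) -> 'I_q.+1 -> R) :
    (forall i, c u i @[u --> F] --> c w i) -> (forall j, y u j @[u --> F] --> y w j) ->
    top_level (c u) (y u) @[u --> F] --> top_level (c w) (y w).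
  move=> Hc Hy; apply: cvg_big => [|i _]; first exact: max_continuous.
  by apply: cvgD; [exact: Hc|exact: ce].
have cM : (M u)^-1 @[u --> F] --> (M w)^-1.
  apply: cvgV; first exact/lt0r_neq0/M0.
  by apply: cvgM; [apply: cvgD; [exact: cbl|exact: ctl]|exact: cvg_cst].
have cc' i : (M u)^-1 * part_size 1 u i @[u --> F] --> (M w)^-1 * part_size 1 w i by exact: cvgM.
have cy' j : (M u)^-1 * join_rest u j @[u --> F] --> (M w)^-1 * join_rest w j by exact: cvgM.
have cm i v : m u i v @[u --> F] --> m w i v.
  rewrite /m /full /point_mass; apply: cvgD; first apply: cvgD; first exact: cvgM.
    case: ifP => _; last exact: cvg_cst.
    by apply: cvgM; [|exact: cvg_cst]; apply: cvgB; [exact: cbl|apply: cvgB => //; exact: ce].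
  case: ifP => _; last exact: cvg_cst.
  by apply: cvgM; [|exact: cvg_cst]; apply: cvgB; [exact: ctl|apply: cvgD => //; exact: ce].
have cmass i A : mass A (m u i) @[u --> F] --> mass A (m w i).
  apply: mass_cvg => //; first exact: (mF w i Jw).1.
    by apply: filterS FJ => u /mF -/(_ i)[].
  by rewrite (mF w i Jw).2; apply: cvg_near_cst; apply: filterS FJ => u /mF -/(_ i)[].
rewrite /of_join /couple; case: ifP => _; last exact: cvg_cst.
apply: cvg_maxr; first exact: cvg_cst.
apply: cvgB; first apply: cvgB; first exact: cvg_cst.
  by apply: cvg_big => [|i _]; [exact: max_continuous|exact: cmass].
by apply: cvg_big => [|i _]; [exact: max_continuous|exact: cmass].
Qed.

Theorem order_complex_product_join :
  homotopy_equivalent (realization R (order_complex le P))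
    (foldr (@join R) (sphere R q)
       [seq realization R (order_complex le (Q i)) | i <- enum 'I_q.+2]).
Proof.
apply: (@bij_homotopy_equivalent _ X J to_join of_join).
- exact: to_join_continuous.
- exact: to_join_points.
- exact: of_join_continuous.
- by move=> w /of_join_spec[].
- exact: to_joinK.
- by move=> w /of_join_spec[].
Qed.

End ProductPoset.

Theorem corollary5p41 (R : realType) (G : lieGroupType R) (p : nat)
    (Gs Hs : 'I_p -> set G) :
  (2 <= p)%N ->
  compact [set: G] -> connected [set: G] ->
  (forall i, compact_connected_subgroup (Gs i)) ->
  (forall i, compact_connected_subgroup (Hs i)) ->
  direct_product Gs ->
  (forall i, Hs i `<` Gs i) ->
  (forall i, subgroup_dim (normalizer (Gs i) (Hs i)) = subgroup_dim (Hs i)) ->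
  homotopy_equivalent
    (Delta [set: G] (product_set Hs))
    (foldr (@join R) (sphere R (p - 2)%N)
       [seq Delta (Gs i) (Hs i) | i <- enum 'I_p]).
Proof.
move=> p2 cG _ cGs cHs dp HG dimN.
(* With [p = q + 2], the [p - 1] differences of biases are the [q + 1] coordinates of the space
   containing [sphere R q]. *)
case: p p2 Gs Hs cGs cHs dp HG dimN => [|[|q]]// _ Gs Hs cGs cHs dp HG dimN.
rewrite subn2 /=.
have /choice[b bE] : forall i, exists k : {vspace 'rV[R]_(@lie_dim R G)}, [set` k] = lie_algebra (Hs i).
  by move=> i; have [H1 H2 H3 _] := cHs i; apply: lie_vspace_ex.
have /choice[t tE] : forall i, exists k : {vspace 'rV[R]_(@lie_dim R G)}, [set` k] = lie_algebra (Gs i).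
  by move=> i; have [H1 H2 H3 _] := cGs i; apply: lie_vspace_ex.
apply: (@order_complex_product_join R _ (fun k l => (k <= l)%VS) q _ _ _
  (intermediate_subalgebra [set: G] (product_set Hs)) (fun i => intermediate_subalgebra (Gs i) (Hs i))
  b t (component t)).
- by move=> k; exact: subvv.
- by move=> k l; rewrite -eqEsubv => /eqP.
- by move=> k l m; exact: subv_trans.
- by move=> i; apply/eqP/(lie_bt_neq cGs cHs HG bE tE).
- by move=> i; exact: (lie_bt HG bE tE).
- move=> i v [_ [bv nvb] [vt ntv]]; split.
  + by apply/subvP => X Xb; apply: bv; rewrite -bE.
  + by apply/subvP => X /vt; rewrite -tE.
  + by move=> vb; apply: nvb; rewrite vb bE.
  + by move=> vt'; apply: ntv; rewrite vt' tE.
- by move=> k i; exact: component_mem.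
- by move=> k l; exact: component_le.
- by move=> v; exact: component_surj.
- by move=> k; exact: component_proper.
Qed.
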